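(* Let $p$ be an odd prime, put $m=(p-1)/2$, let $E\subset\mathbb F_p$ with $1\le r=|E|\le p-1$, and put $$H_E=K_{2p}-\bigcup_{e\in E}M_e,$$ where $K_{2p}$ is the complete graph on $\mathbb F_p\times\{0,1\}$ and $M_e=\{\{(x,0),(x+e,1)\}:x\in\mathbb F_p\}$. Then $$S(H_E)\equiv(-1)^{mr+1}r\pmod p,$$ and $$\chi'_{\mathrm P}(H_E)=\chi'_{\ell}(H_E)=2p-1-r.$$ The quantities $S(\cdot)$, $\chi'_\ell$, $\chi'_{\mathrm P}$ are as defined in the context.
   Context: Vertex order. The vertex set is $V_0\sqcup V_1$ with $V_i=\mathbb F_p\times\{i\}$; it is linearly ordered with all of $V_0$ before all of $V_1$, and each layer ordered by its first coordinate as $0,1,\dots,p-1$. The graph $K_{2p}-\bigcup_e M_e$ is $K_{2p}$ with the edges of these matchings removed. Signs. For a perfect matching $M$ of a graph on a finite linearly ordered vertex set, let $\operatorname{cr}(M)$ be the number of unordered pairs of edges $\{a,c\},\{b,d\}\in M$ with $a<b<c<d$, and put $\varepsilon(M)=(-1)^{\operatorname{cr}(M)}$. A one-factorization of a graph is a partition of its edge set into perfect matchings (an unordered collection). For a one-factorization $\mathcal F$ put $\varepsilon(\mathcal F)=\prod_{M\in\mathcal F}\varepsilon(M)$. For a regular graph $G$ on an ordered vertex set, $S(G)=\sum_{\mathcal F}\varepsilon(\mathcal F)$, the sum over all one-factorizations of $G$ ($S(G)=0$ if none exist). Coloring indices of a graph $G$. $\chi'_\ell(G)$ is the least integer $k$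 such that whenever each edge is assigned a list of $k$ colors, the edges can be properly colored from their lists. The edge-paintability index $\chi'_{\mathrm P}(G)$ is the least $k$ for which Painter has a winning strategy in the following game: each edge starts with $k$ tokens; in each round Lister marks a nonempty set of uncolored edges and removes one token from each of them; Painter then colors a matching consisting of marked edges (these edges are then colored permanently). After Painter's move, Lister wins if some uncolored edge has no token left. Painter wins if every edge is eventually colored. *)

(* Defs.v *)
From mathcomp Require Import all_boot all_order all_algebra.
Set Implicit Arguments.
Unset Strict Implicit.
Unset Printing Implicit Defensive.

Import GRing.Theory.

(* A simple graph on a finite vertex type T is given by its edge set
   G : {set {set T}}, a set of two-element subsets of T. *)

Definition complete_graph (T : finType) : {set {set T}} :=
  [set e : {set T} | #|e| == 2].

Definition perfect_matching (T : finType) (G M : {set {set T}}) : bool :=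
  (M \subset G) && partition M [set: T].

(* lt is the strict linear order on the vertices. *)
Definition crossings (T : finType) (lt : rel T) (M : {set {set T}}) : nat :=
  #|[set P : {set {set T}} | (P \subset M) &&
      [exists a : T, exists b : T, exists c : T, exists d : T,
        [&& lt a b, lt b c, lt c d & P == [set [set a; c]; [set b; d]]]]]|.

Definition matching_sign (T : finType) (lt : rel T) (M : {set {set T}}) : int :=
  ((-1) ^+ crossings lt M)%R.

Definition one_factorization (T : finType) (G : {set {set T}})
    (F : {set {set {set T}}}) : bool :=
  partition F G && [forall M in F, perfect_matching G M].

Definition factorization_sum (T : finType) (lt : rel T)
    (G : {set {set T}}) : int :=
  (\sum_(F : {set {set {set T}}} | one_factorization G F)
     \prod_(M in F) matching_sign lt M)%R.

Definition least (P : nat -> Prop) (k : nat) : Prop :=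
  P k /\ forall j, P j -> k <= j.

Definition proper_edge_coloring (T : finType) (G : {set {set T}})
    (c : {set T} -> nat) : Prop :=
  {in G &, forall e f : {set T}, e != f -> ~~ [disjoint e & f] -> c e <> c f}.

Definition edge_choosable (T : finType) (G : {set {set T}}) (k : nat) : Prop :=
  forall L : {set T} -> seq nat,
    {in G, forall e, uniq (L e) /\ size (L e) = k} ->
  exists c : {set T} -> nat,
    {in G, forall e, c e \in L e} /\ proper_edge_coloring G c.

Definition is_list_chromatic_index (T : finType) (G : {set {set T}})
    (k : nat) : Prop :=
  least (edge_choosable G) k.

(* painter_wins U t: Painter has a winning strategy from the position, before a
   move of Lister, where U is the set of uncolored edges and t counts the
   tokens. The strategy s maps the marked set B to the edges then colored. The
   requirement 0 < t e on U says that Lister has not already won; it is tested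
   in the initial position too, so nobody marks an edge without tokens. Every
   round uses up a token, so plays are finite and the inductive definition
   captures the game. *)
Inductive painter_wins (T : finType) (U : {set {set T}}) (t : {set T} -> nat)
    : Prop :=
| PainterDone of U = set0
| PainterMove (s : {set {set T}} -> {set {set T}}) of
    (forall e, e \in U -> 0 < t e) &
    (forall B, B != set0 -> B \subset U -> (s B \subset B) && trivIset (s B)) &
    (forall B, B != set0 -> B \subset U ->
       painter_wins (U :\: s B) (fun e => t e - (e \in B))).

Definition edge_paintable (T : finType) (G : {set {set T}}) (k : nat) : Prop :=
  painter_wins G (fun=> k).

Definition is_edge_paintability_index (T : finType) (G : {set {set T}})
    (k : nat) : Prop :=
  least (edge_paintable G) k.

(* (x, false) and (x, true) stand for (x, 0) and (x, 1). For prime p, the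
   coercion of 'F_p to nat gives the representatives 0, ..., p - 1. *)
Definition vertex (p : nat) : finType := ('F_p * bool)%type.

Definition vertex_lt (p : nat) : rel (vertex p) :=
  fun u v => (u.2 < v.2) || (u.2 == v.2) && (u.1 < v.1).

Definition shift_matching (p : nat) (e : 'F_p) : {set {set vertex p}} :=
  [set [set ((x, false) : vertex p); ((x + e)%R, true)] | x : 'F_p].

Definition H_graph (p : nat) (E : {set 'F_p}) : {set {set vertex p}} :=
  complete_graph (vertex p) :\: \bigcup_(e in E) shift_matching e.

(* Main.v *)
(**
Two ingredients. First, for a d-regular graph G with S(G) nonzero, the polynomial
prod (X_e - X_f) over pairs of adjacent edges has a nonzero coefficient at the
monomial with all exponents d - 1: an alternating binomial sum over colorings
isolates this coefficient, only proper d-edge-colorings contribute, and sorting all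
pairs of edges by color shows that the sign of the contribution of a coloring is,
up to a constant, the product of the signs of its color classes, so the sum is a
nonzero multiple of S(G). Schauz's inductive form of the combinatorial
Nullstellensatz turns the coefficient into a strategy for Painter; counting edges
gives the matching lower bound.

Second, translation of the first coordinate acts on the one-factorizations of H_E,
preserving signs as p is odd, so modulo p only the invariant ones count. These
consist of shift matchings and the p translates of one matching with a single cross
edge (of slope f outside E) and one edge of each gap 1, ..., m in each layer. Their
signs add up to (-1)^(m(p-1-r)) (p - r) N^2, with N the signed number of "starters"
x_1, ..., x_m such that 0, x_1, x_1 + 1, ..., x_m, x_m + m list F_p. Multiplied by
the Vandermonde determinant of F_p, N becomes the sum over all x of the Vandermonde
product of the listing. For gaps g_1, ..., g_m this sum is g_1 ... g_m times a sum
over x of m(p - 1) affine forms, which depends only on their linear parts; so N is m!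
times the value for gaps 1, ..., 1, where the starters are the m! orderings of one
domino tiling. Hence N = (m!)^2, and N^2 = 1 in F_p by Wilson's theorem.
*)
Require Import Defs.
From mathcomp Require Import all_boot all_order all_fingroup all_algebra all_solvable.
From mathcomp Require Import mpoly zify ring.

Set Implicit Arguments.
Unset Strict Implicit.
Unset Printing Implicit Defensive.

Import GRing.Theory Num.Theory.

(** * Products over pairs *)

Section PairProducts.

Variable R : comNzRingType.
Local Open Scope ring_scope.

(** The recurring device is a product over unordered pairs with a symmetric factor, whose pairs may
    be oriented at will. For two edges sharing one vertex, X_e - X_f is antisymmetric, and so is the
    product of the comparisons between their endpoints; for disjoint edges that product is symmetric
    and records a crossing. Multiplying the two gives a symmetric factor for all pairs of edges, and
    this is what permits sorting by color. In the same way the sign of a listing of F_p times its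
    Vandermonde product does not depend on the listing. The sign of a single starter matching is not
    the product of its two listing signs: for every layer edge the comparison of its own two ends
    intervenes. Over the p translates this correction becomes, for each gap, a product over all of
    F_p; it is the same in both layers and cancels. The degree m(p - 1) is a borderline value. A
    listing has 2m^2 = m(p - 1) pairs of entries from different blocks, and a monomial survives
    summation over F_p only with exponent at least p - 1 in each of the m variables, so constant
    terms are squeezed out exactly. *)

Definition tournament (I : finType) (A : {set I}) (r : rel I) :=
  {in A &, forall x y, r x y = (x != y) && ~~ r y x}.

(** A tournament chooses one orientation per unordered pair, so each pair enters once, and
    orientations can be spliced together freely. *)
Definition pair_prod (I : finType) (r : rel I) (A : {set I})
    (f : I -> I -> R) : R :=
  \prod_(x in A) \prod_(y in A | r x y) f x y.

Lemma tournament_irr (I : finType) (A : {set I}) r x :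
  tournament A r -> x \in A -> r x x = false.
Proof. by move=> t Ax; rewrite t // eqxx. Qed.

Definition rank_lt (I : finType) : rel I :=
  fun x y => (enum_rank x < enum_rank y)%N.

Lemma rank_lt_tournament (I : finType) (A : {set I}) :
  tournament A (@rank_lt I).
Proof.
move=> x y _ _; rewrite /rank_lt -leqNgt ltn_neqAle; congr (_ && _).
by rewrite -(inj_eq (@enum_rank_inj I)).
Qed.

Lemma eq_pair_prod (I : finType) (r : rel I) (A : {set I}) f g :
  {in A &, forall x y, r x y -> f x y = g x y} ->
  pair_prod r A f = pair_prod r A g.
Proof.
by move=> efg; apply: eq_bigr => x Ax; apply: eq_bigr => y /andP[Ay]; apply: efg.
Qed.

Lemma pair_prodM (I : finType) (r : rel I) (A : {set I}) f g :
  pair_prod r A (fun x y => f x y * g x y) = pair_prod r A f * pair_prod r A g.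
Proof.
by rewrite -big_split; apply: eq_bigr => x _; rewrite big_split.
Qed.

Lemma pair_prodE (I : finType) (r : rel I) (A : {set I}) f :
  pair_prod r A f =
  \prod_(P : I * I | [&& P.1 \in A, P.2 \in A & r P.1 P.2]) f P.1 P.2.
Proof. by rewrite /pair_prod pair_big_dep. Qed.

(** Pairs oriented alike by [r] and [r'] give the same factors; the others are matched by swapping,
    where the symmetry of [f] enters. *)
Lemma pair_prod_tournament (I : finType) (r r' : rel I) (A : {set I}) f :
  tournament A r -> tournament A r' ->
  {in A &, forall x y, x != y -> f x y = f y x} ->
  pair_prod r A f = pair_prod r' A f.
Proof.
move=> tr tr' fC; rewrite !pair_prodE.
rewrite (bigID (fun P => r' P.1 P.2)) [RHS](bigID (fun P => r P.1 P.2)) /=.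
congr (_ * _); first by apply: eq_bigl => P; rewrite -!andbA [r _ _ && _]andbC.
pose swap (P : I * I) := (P.2, P.1).
have swapK : involutive swap by case.
rewrite (reindex_inj (inv_inj swapK)) /=.
apply: eq_big => [[x y]|[x y]] /=; last first.
  case/andP=> /and3P[Ay Ax ryx] _; apply: fC => //.
  by apply: contraTneq ryx => ->; rewrite (tournament_irr tr).
case Ax: (x \in A); rewrite ?andbF //; case Ay: (y \in A) => //=.
by rewrite (tr y x) // (tr' x y) // eq_sym; case: (x == y); case: (r x y); case: (r' y x).
Qed.

Lemma pair_prod_imset (I J : finType) (h : I -> J) (r : rel J) (r' : rel I)
    (A : {set I}) (f : J -> J -> R) :
  {in A &, injective h} -> tournament (h @: A) r -> tournament A r' ->
  {in h @: A &, forall x y, x != y -> f x y = f y x} ->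
  pair_prod r (h @: A) f = pair_prod r' A (fun x y => f (h x) (h y)).
Proof.
move=> injh tr tr' fC.
pose r1 : rel I := fun x y => r (h x) (h y).
have t1 : tournament A r1.
  by move=> x y Ax Ay; rewrite /r1 tr ?imset_f // (inj_in_eq injh).
rewrite -(pair_prod_tournament t1 tr') => [|x y Ax Ay nxy]; last first.
  by apply: fC; rewrite ?imset_f ?(inj_in_eq injh).
rewrite /pair_prod big_imset //=; apply: eq_bigr => x Ax.
by rewrite big_mkcondr big_imset //= -big_mkcondr.
Qed.

(* The tournament that orders [I] by the key [k] first gives the factorization. *)
Lemma pair_prod_partition (I J : finType) (k : I -> J) (r : rel I) (rJ : rel J)
    (A : {set I}) (B : {set J}) f :
  {in A, forall x, k x \in B} -> tournament A r -> tournament B rJ ->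
  {in A &, forall x y, x != y -> f x y = f y x} ->
  pair_prod r A f =
  (\prod_(j in B) pair_prod r [set x in A | k x == j] f) *
  pair_prod rJ B (fun i j =>
     \prod_(x in A | k x == i) \prod_(y in A | k y == j) f x y).
Proof.
move=> kB tr trJ fC.
pose rl : rel I := fun x y => if k x == k y then r x y else rJ (k x) (k y).
have tl : tournament A rl.
  move=> x y Ax Ay; rewrite /rl [k y == _]eq_sym; case: eqVneq => [_|nk].
    by rewrite tr.
  rewrite trJ ?kB // nk /=; case: eqVneq => // xy.
  by rewrite xy eqxx in nk.
rewrite (pair_prod_tournament tr tl fC) /pair_prod.
transitivity (\prod_(x in A) ((\prod_(y in A | (k x == k y) && r x y) f x y) *
   (\prod_(y in A | rJ (k x) (k y)) f x y))).
  apply: eq_bigr => x Ax; rewrite (bigID (fun y => k x == k y)) /=; congr (_ * _).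
    by apply: eq_bigl => y; rewrite /rl; case: eqP; rewrite ?andbT ?andbF.
  apply: eq_bigl => y; rewrite /rl; case: eqVneq => [->|]; rewrite ?andbT ?andbF //.
  by case Ay: (y \in A) => //=; rewrite (tournament_irr trJ) ?kB.
rewrite big_split /=; congr (_ * _).
  rewrite (partition_big k (mem B)) //=; apply: eq_bigr => j Bj.
  rewrite [in RHS](eq_bigl (fun x => (x \in A) && (k x == j))); last by move=> x; rewrite inE.
  apply: eq_bigr => x /andP[Ax /eqP kx].
  by apply: eq_bigl => y; rewrite inE kx [j == _]eq_sym andbA.
rewrite (partition_big k (mem B)) //=; apply: eq_bigr => i Bi.
rewrite exchange_big /=; apply: eq_bigr => x /andP[Ax /eqP kx].
rewrite (partition_big k (fun j => (j \in B) && rJ i j)) /=; last first.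
  by move=> y /andP[Ay]; rewrite kx => ->; rewrite kB.
apply: eq_bigr => j /andP[Bj rij]; apply: eq_bigl => y.
by rewrite kx; case: eqVneq => [->|]; rewrite ?andbF // rij !andbT.
Qed.

End PairProducts.

(** * Signs of perfect matchings *)

Section MatchingSign.

Variables (T : finType) (lt : rel T) (pos : T -> nat).
Hypothesis pos_inj : injective pos.
Hypothesis ltE : forall u v, lt u v = (pos u < pos v).
Local Open Scope ring_scope.

Definition order_sign u v : int := if lt v u then -1 else 1.

(** The same formula serves disjoint edges, where it detects a crossing, and edges with a common
    vertex, where the shared vertex compared with itself contributes 1. *)
Definition edge_sign (e e' : {set T}) : int :=
  \prod_(u in e) \prod_(v in e') order_sign u v.

Lemma lt_tournament (A : {set T}) : tournament A lt.
Proof.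
move=> u v _ _; rewrite !ltE -leqNgt ltn_neqAle; congr (_ && _).
by rewrite (inj_eq pos_inj).
Qed.

Lemma lt_irr u : lt u u = false. Proof. by rewrite ltE ltnn. Qed.

Lemma neq_ltVgt u v : u != v -> lt u v || lt v u.
Proof. by rewrite !ltE -neq_ltn (inj_eq pos_inj). Qed.

Lemma order_sign_sqr u v : order_sign u v * order_sign u v = 1.
Proof. by rewrite /order_sign; case: ifP. Qed.

Lemma order_signuu u : order_sign u u = 1.
Proof. by rewrite /order_sign lt_irr. Qed.

Lemma order_signC u v : u != v -> order_sign u v = - order_sign v u.
Proof.
move=> nuv; rewrite /order_sign (@lt_tournament setT u v) ?inE // nuv /=.
by case: (lt v u).
Qed.

Lemma edge_sign_sqr (e e' : {set T}) : edge_sign e e' * edge_sign e e' = 1.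
Proof.
rewrite -big_split big1 //= => u _; rewrite -big_split big1 //= => v _.
exact: order_sign_sqr.
Qed.

Lemma edge_sign2 a1 a2 b1 b2 : a1 != a2 -> b1 != b2 ->
  edge_sign [set a1; a2] [set b1; b2] =
  order_sign a1 b1 * order_sign a1 b2 * (order_sign a2 b1 * order_sign a2 b2).
Proof.
move=> na nb; rewrite /edge_sign big_setU1 ?inE //= big_set1.
by rewrite !big_setU1 ?inE //= !big_set1.
Qed.

Lemma edge_sign_disjoint (e e' : {set T}) : #|e| = 2 -> #|e'| = 2 -> [disjoint e & e'] ->
  edge_sign e e' = edge_sign e' e.
Proof.
move=> /eqP/cards2P[a1 [a2 [na ->]]] /eqP/cards2P[b1 [b2 [nb ->]]].
rewrite disjoints_subset; move=> /subsetP s.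
have := s a1; have := s a2; rewrite !inE !eqxx orbT !negb_or.
move=> /(_ isT)/andP[n1 n2] /(_ isT)/andP[n3 n4].
rewrite !edge_sign2 // (order_signC n1) (order_signC n2) (order_signC n3) (order_signC n4).
by rewrite !mulrNN mulrACA.
Qed.

(** Exchanging the edges reverses three comparisons of distinct vertices, an odd number; the
    comparison of [w] with itself stays 1. *)
Lemma edge_sign_meet w a b : w != a -> w != b -> a != b ->
  edge_sign [set w; a] [set w; b] = - edge_sign [set w; b] [set w; a].
Proof.
move=> wa wb ab; rewrite !edge_sign2 // order_signuu !mul1r.
rewrite (order_signC wb) (order_signC ab) [order_sign a w]order_signC ?[a == w]eq_sym //.
rewrite [order_sign b w]order_signC ?[b == w]eq_sym //.
by ring.
Qed.

Lemma set2_lt_inj a c a' c' : lt a c -> lt a' c' -> [set a; c] = [set a'; c'] ->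
  a = a' /\ c = c'.
Proof.
move=> ac ac' es; have: a \in [set a'; c'] by rewrite -es set21.
have: c \in [set a'; c'] by rewrite -es set22.
rewrite !inE => /orP[] /eqP ec /orP[] /eqP ea //; subst a c; move: ac ac'.
- by rewrite lt_irr.
- by rewrite !ltE => /ltnW; rewrite leqNgt => /negP.
- by rewrite lt_irr.
Qed.

Definition crossing (P : {set {set T}}) := [exists a : T, exists b : T, exists c : T, exists d : T,
  [&& lt a b, lt b c, lt c d & P == [set [set a; c]; [set b; d]]]].

Lemma set2_ltP (e : {set T}) : #|e| = 2 -> exists a c, lt a c /\ e = [set a; c].
Proof.
move=> /eqP/cards2P[a [c [/neq_ltVgt/orP[ac|ca] ->]]]; first by exists a, c.
by exists c, a; rewrite setUC.
Qed.

(** With the ends of each edge sorted, the number of inverted comparisons between the two edges is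
    odd exactly when they interleave. *)
Lemma edge_sign_crossing (e e' : {set T}) : #|e| = 2 -> #|e'| = 2 -> [disjoint e & e'] ->
  edge_sign e e' = (-1) ^+ crossing [set e; e'].
Proof.
move=> /set2_ltP[a1 [a2 [la ->]]] /set2_ltP[b1 [b2 [lb ->]]].
rewrite disjoints_subset; move=> /subsetP s.
have := s a1; have := s a2; rewrite !inE !eqxx orbT !negb_or.
move=> /(_ isT)/andP[/neq_ltVgt n1 /neq_ltVgt n2] /(_ isT)/andP[/neq_ltVgt n3 /neq_ltVgt n4].
have neq u v : lt u v -> u != v by apply: contraTneq => ->; rewrite lt_irr.
have crossE : crossing [set [set a1; a2]; [set b1; b2]] =
    [&& lt a1 b1, lt b1 a2 & lt a2 b2] || [&& lt b1 a1, lt a1 b2 & lt b2 a2].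
  apply/idP/orP.
    case/existsP=> a /existsP[b /existsP[c /existsP[d /and4P[ab bc cd /eqP eP]]]].
    have ac : lt a c by rewrite ltE; move: ab bc; rewrite !ltE; apply: ltn_trans.
    have bd : lt b d by rewrite ltE; move: bc cd; rewrite !ltE; apply: ltn_trans.
    have: [set a; c] \in [set [set a1; a2]; [set b1; b2]] by rewrite eP set21.
    have: [set b; d] \in [set [set a1; a2]; [set b1; b2]] by rewrite eP set22.
    rewrite !inE => /orP[] /eqP e1 /orP[] /eqP e2.
    - have [_ ?] := set2_lt_inj bd la e1; have [_ ?] := set2_lt_inj ac la e2.
      by subst; rewrite lt_irr in cd.
    - have [? ?] := set2_lt_inj bd la e1; have [? ?] := set2_lt_inj ac lb e2.
      by subst; right; apply/and3P.
    - have [? ?] := set2_lt_inj bd lb e1; have [? ?] := set2_lt_inj ac la e2.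
      by subst; left; apply/and3P.
    - have [_ ?] := set2_lt_inj bd lb e1; have [_ ?] := set2_lt_inj ac lb e2.
      by subst; rewrite lt_irr in cd.
  case=> /and3P[l1 l2 l3].
    apply/existsP; exists a1; apply/existsP; exists b1; apply/existsP; exists a2.
    by apply/existsP; exists b2; apply/and4P.
  apply/existsP; exists b1; apply/existsP; exists a1; apply/existsP; exists b2.
  by apply/existsP; exists a2; apply/and4P; split => //; rewrite setUC.
rewrite crossE edge_sign2 ?neq // /order_sign; move: la lb n1 n2 n3 n4; rewrite !ltE.
set A1 := pos a1; set A2 := pos a2; set B1 := pos b1; set B2 := pos b2.
have g u v : (u < v)%N -> (v < u)%N = false by lia.
move=> la lb /orP[] l1 /orP[] l2 /orP[] l3 /orP[] l4;
rewrite ?l1 ?(g _ _ l1) ?l2 ?(g _ _ l2) ?l3 ?(g _ _ l3) ?l4 ?(g _ _ l4) //=; lia.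
Qed.

(** [crossings] counts two-element sets of edges; orienting each by [rank_lt] turns the count into
    an exponent of -1 in a product over pairs. *)
Lemma matching_signE (M : {set {set T}}) : trivIset M ->
  {in M, forall e : {set T}, #|e| = 2} ->
  matching_sign lt M = pair_prod (@rank_lt _) M edge_sign.
Proof.
move=> tM M2; rewrite pair_prodE /matching_sign.
transitivity (\prod_(P : {set T} * {set T} |
    [&& P.1 \in M, P.2 \in M & rank_lt P.1 P.2])
    (-1) ^+ crossing [set P.1; P.2] : int); last first.
  apply: eq_bigr => [[e e'] /= /and3P[Me Me' ree']].
  rewrite edge_sign_crossing ?M2 //; apply: (trivIsetP tM) => //.
  by apply: contraTneq ree' => ->; rewrite /rank_lt ltnn.
rewrite prodrXr; congr (_ ^+ _).
pose D := [set P : {set T} * {set T} |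
  [&& P.1 \in M, P.2 \in M, rank_lt P.1 P.2 & crossing [set P.1; P.2]]].
have -> : (\sum_(P : {set T} * {set T} | [&& P.1 \in M, P.2 \in M & rank_lt P.1 P.2])
    crossing [set P.1; P.2])%N = #|D|.
  rewrite -sum1_card -big_mkcondr /=; apply: eq_big => // [[e e']] /=.
  by rewrite inE /= -!andbA.
rewrite -(card_in_imset (f := fun P : {set T} * {set T} => [set P.1; P.2]) (D := mem D)).
  apply: eq_card => P; rewrite inE; apply/andP/imsetP => [[sPM crP]|].
    have /existsP[a /existsP[b /existsP[c /existsP[d /and4P[ab bc cd /eqP eP]]]]] := crP.
    have ac : lt a c by move: ab bc; rewrite !ltE; apply: ltn_trans.
    have bd : lt b d by move: bc cd; rewrite !ltE; apply: ltn_trans.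
    have n12 : [set a; c] != [set b; d].
      by apply/eqP=> /(set2_lt_inj ac bd)[e1 _]; rewrite e1 lt_irr in ab.
    have Me : [set a; c] \in M by apply: (subsetP sPM); rewrite eP set21.
    have Me' : [set b; d] \in M by apply: (subsetP sPM); rewrite eP set22.
    case r12: (rank_lt [set a; c] [set b; d]).
      by exists ([set a; c], [set b; d]); rewrite ?inE /= ?Me ?Me' ?r12 -?eP.
    exists ([set b; d], [set a; c]); rewrite ?inE /= ?(setUC [set [set b; d]]) -?eP ?Me ?Me' ?crP //=.
    by rewrite (@rank_lt_tournament _ setT) ?inE // eq_sym n12 r12.
  case=> [[e e']]; rewrite inE /= => /and4P[Me Me' _ cr] ->; split => //.
  by apply/subsetP=> z; rewrite !inE => /orP[] /eqP ->.
move=> [e1 e2] [e3 e4]; rewrite !inE /= => /and4P[_ _ r12 _] /and4P[_ _ r34 _] es.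
have: e1 \in [set e3; e4] by rewrite -es set21.
have: e2 \in [set e3; e4] by rewrite -es set22.
rewrite !inE => /orP[] /eqP E2 /orP[] /eqP E1; subst e1 e2 => //; move: r12 r34;
  rewrite /rank_lt ?ltnn //; lia.
Qed.

(* Every pair of vertices in different edges is counted once, so only the
   pairs forming an edge are missing. *)
Lemma pair_prod_perfect (R : comNzRingType) (M : {set {set T}}) (f : T -> T -> R) r rM :
  partition M [set: T] -> (forall u v, f u v = f v u) ->
  tournament setT r -> tournament M rM ->
  pair_prod r setT f =
  (\prod_(e in M) pair_prod r e f) *
  pair_prod rM M (fun e e' => \prod_(u in e) \prod_(v in e') f u v).
Proof.
move=> pM fC tr trM.
rewrite (pair_prod_partition (k := pblock M) (B := M) _ tr trM); last 2 first.
- by move=> u _; apply: pblock_mem; rewrite (cover_partition pM) inE.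
- by move=> u v _ _ _; apply: fC.
have blk e : e \in M -> [set x in [set: T] | pblock M x == e] = e.
  move=> Me; apply/setP=> u; rewrite !inE /=; apply/eqP/idP => [<-|ue].
    by rewrite mem_pblock (cover_partition pM) inE.
  by apply: def_pblock => //; case/and3P: pM.
congr (_ * _); first by apply: eq_bigr => e Me; rewrite blk.
apply: eq_pair_prod => e e' Me Me' _.
have blk' e1 : e1 \in M -> (fun x => (x \in [set: T]) && (pblock M x == e1)) =1 mem e1.
  by move=> Me1 x; rewrite -{2}(blk _ Me1) !inE.
rewrite (eq_bigl _ _ (blk' _ Me)); apply: eq_bigr => u _.
by rewrite (eq_bigl _ _ (blk' _ Me')).
Qed.

End MatchingSign.

(** * Paintability from a coefficient *)

Lemma prodr_natr_bool (R : comNzRingType) (I : finType) (P b : pred I) :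
  (\prod_(i | P i) (b i)%:R = [forall (i | P i), b i]%:R :> R)%R.
Proof.
case: (boolP [forall (i | P i), b i]) => [/forall_inP all_b | ].
  by rewrite big1 // => i Pi; rewrite all_b.
rewrite negb_forall => /existsP[i]; rewrite negb_imply => /andP[Pi /negbTE nbi].
by rewrite (bigD1 i) //= nbi mul0r.
Qed.

(** * Coefficients after setting variables to 1 *)

Section Specialization.

Variable n : nat.
Local Open Scope ring_scope.
Implicit Types (p q : {mpoly int[n]}) (m : 'X_{1..n}) (A S : {set 'I_n}).

(** This is how homogeneity isolates a single monomial: any competitor of the same degree falls
    short in some variable. *)
Lemma mdeg_lt_coord m m' : mdeg m' = mdeg m -> m' != m -> exists i, (m' i < m i)%N.
Proof.
rewrite !mdegE => eqd nm; apply/existsP; apply: contraNT nm.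
rewrite negb_exists => /forallP no_lt.
have le i : (m i <= m' i)%N by rewrite leqNgt.
apply/eqP/mnmP=> i; apply/eqP; rewrite eqn_leq le andbT.
have: (\sum_i m' i <= \sum_i m i)%N by rewrite eqd.
rewrite (bigD1 i) //= [X in (_ <= X)%N](bigD1 i) //=.
have: (\sum_(j < n | j != i) m j <= \sum_(j < n | j != i) m' j)%N by apply: leq_sum.
move=> le_s le_t; rewrite -(leq_add2r (\sum_(j < n | j != i) m j)).
by apply: leq_trans le_t; rewrite leq_add2l.
Qed.

Definition set_to_one S p : {mpoly int[n]} :=
  p \mPo [tuple if i \in S then 1 else 'X_i | i < n].

Lemma mcoeff_set_to_one S p m : (forall i, i \in S -> m i = 0%N) ->
  (set_to_one S p)@_m =
  \sum_(m' <- msupp p) p@_m' * \prod_(i | i \notin S) (m' i == m i)%:R.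
Proof.
move=> mS; rewrite /set_to_one comp_mpolyEX raddf_sum /=; apply: eq_bigr => m' _.
rewrite mcoeffZ; congr (_ * _); rewrite comp_mpolyX.
pose m'' := [multinom if i \in S then 0%N else m' i | i < n].
have -> : \prod_(i < n) tnth [tuple if i \in S then 1 else 'X_i | i < n] i ^+ m' i
    = 'X_[m''] :> {mpoly int[n]}.
  rewrite [RHS]mpolyXE_id; apply: eq_bigr => i _; rewrite tnth_mktuple mnmE.
  by case: ifP; rewrite ?expr1n ?expr0.
rewrite mcoeffX prodr_natr_bool; congr (nat_of_bool _)%:R.
apply/eqP/forall_inP => [em i nS | em].
  by rewrite -em mnmE (negbTE nS).
apply/mnmP=> i; rewrite mnmE; case: ifPn => [Si | nS]; first by rewrite mS.
exact/eqP/em.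
Qed.

(* On the homogeneous p the indicator of [m i <= m' i for i in A, m' i = m i for
   i notin A] selects m only; the expansion of each [m i <= j] as
   1 - \sum_(k < m i) [j = k] is a sum of coefficients of specializations. *)
Lemma mcoeff_set_to_one_neq0 p d m A : p \is d.-homog for mdeg -> p@_m != 0 ->
  exists S, S \subset A /\ exists m',
    [/\ (set_to_one S p)@_m' != 0, forall i, i \notin A -> m' i = m i
      & forall i, i \in A :\: S -> (m' i < m i)%N].
Proof.
move=> hp pm.
have pm_supp : m \in msupp p by rewrite mcoeff_msupp.
pose chi i j : int := if i \in A then (m i <= j)%N%:R else (j == m i)%:R.
have selE : \sum_(m' <- msupp p) p@_m' * \prod_i chi i (m' i) = p@_m.
  rewrite (bigD1_seq m) ?msupp_uniq //= [X in _ * X]big1; last first.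
    by move=> i _; rewrite /chi leqnn eqxx; case: ifP.
  rewrite mulr1 big_seq_cond big1 ?addr0 // => m' /andP[m'_supp nm].
  have [i lt_i] := mdeg_lt_coord (etrans (dhomogP _ _ _ hp m' m'_supp)
    (esym (dhomogP _ _ _ hp m pm_supp))) nm.
  have /negbTE le_i : ~~ (m i <= m' i)%N by rewrite -ltnNge.
  rewrite (bigD1 i) //= {1}/chi le_i.
  case: ifP => _; rewrite ?mul0r ?mulr0 //.
  by rewrite (ltn_eqF lt_i) mul0r mulr0.
pose N := (mdeg m).+1.
have mN i : (m i < N)%N by rewrite ltnS mdegE (bigD1 i) //= leq_addr.
(* Index 0 stands for the constant 1, present only for i in [A]; index k + 1 stands for the term
   selecting exponent k. All relevant k lie below [N]. *)
pose psi i c j : int := if c is k.+1 then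
   if i \in A then - ((k < m i)%N && (j == k))%:R else ((k == m i) && (j == k))%:R
   else (i \in A)%:R.
have chiE i j : chi i j = \sum_(c < N.+1) psi i c j.
  rewrite big_ord_recl /= /chi; under eq_bigr => k _ do rewrite /bump /=.
  case: ifP => iA.
    rewrite sumrN; apply/eqP; rewrite eq_sym subr_eq eq_sym; apply/eqP.
    case: (leqP (m i) j) => [le|lt].
      rewrite big1 ?addr0 // => k _; case: eqP => [<-|]; rewrite ?andbF //.
      by rewrite ltnNge le.
    rewrite (bigD1 (Ordinal (ltn_trans lt (mN i)))) //= lt eqxx big1 ?addr0 ?add0r // => k.
    by rewrite -val_eqE /= eq_sym => /negbTE ->; rewrite andbF.
  rewrite add0r (bigD1 (Ordinal (mN i))) //= eqxx big1 ?addr0 // => k.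
  by rewrite -val_eqE /= => /negbTE ->.
have := pm; rewrite -selE.
under eq_bigr => m' _ do under eq_bigr => i _ do rewrite chiE.
under eq_bigr => m' _ do rewrite bigA_distr_bigA mulr_sumr.
rewrite exchange_big /= => nz.
have [g] : exists g : {ffun 'I_n -> 'I_N.+1},
    \sum_(m' <- msupp p) p@_m' * \prod_i psi i (g i) (m' i) != 0.
  apply/existsP; apply: contraNT nz; rewrite negb_exists => /forallP z.
  by rewrite big1 // => g _; apply/eqP; move: (z g); rewrite negbK.
(* Choosing the constant 1 leaves the exponent free, which amounts to setting the variable to 1; any
   other choice prescribes the exponent [(g i).-1]. *)
pose S := [set i | g i == ord0].
pose m1 := [multinom (g i).-1 | i < n].
pose cst i : int := if i \in S then (i \in A)%:R else
   if i \in A then - ((g i).-1 < m i)%N%:R else ((g i).-1 == m i)%:R.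
have psiE i j : psi i (g i) j = cst i * (if i \in S then 1 else (j == m1 i)%:R).
  rewrite /psi /cst inE mnmE -val_eqE /=; case: (nat_of_ord (g i)) => [|k] /=.
    by rewrite mulr1.
  by case: ifP => _; rewrite ?mulNr -natrM mulnb.
under eq_bigr => m' _ do under eq_bigr => i _ do rewrite psiE.
under eq_bigr => m' _ do rewrite big_split mulrCA.
rewrite -mulr_sumr mulf_eq0 negb_or => /andP[/prodf_neq0 cst0 coef0].
exists S; split.
  apply/subsetP=> i Si; have := cst0 i isT; rewrite /cst Si.
  by case: (i \in A).
exists m1; split.
- rewrite mcoeff_set_to_one; last by move=> i; rewrite inE mnmE => /eqP ->.
  move: coef0; congr (_ != 0); apply: eq_bigr => m' _; congr (_ * _).
  by rewrite [RHS]big_mkcond; apply: eq_bigr => i _; case: ifP.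
- move=> i nA; have := cst0 i isT; rewrite /cst (negbTE nA) mnmE.
  by case: ifP => _ /=; [|case: (_ =P m i) => //] .
- move=> i; rewrite inE => /andP[nS iA]; have := cst0 i isT.
  by rewrite /cst (negbTE nS) iA mnmE; case: ltnP; rewrite ?oppr0 ?eqxx.
Qed.

Lemma mcoeffM_neq0 p q m : (p * q)@_m != 0 ->
  exists2 m', p@_m' != 0 & forall i, (m' i <= m i)%N.
Proof.
rewrite mcoeffM => nz.
have /existsP[k /andP[/eqP mE pk]] : [exists k : 'X_{1..n < (mdeg m).+1, (mdeg m).+1},
    (m == (k.1 + k.2)%MM) && (p@_k.1 != 0)].
  apply: contraNT nz; rewrite negb_exists => /forallP z; rewrite big1 // => k mk.
  by move: (z k); rewrite mk /= negbK => /eqP ->; rewrite mul0r.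
exists k.1 => // i; have -> : m i = (k.1 i + k.2 i)%N by rewrite {1}mE mnmDE.
exact: leq_addr.
Qed.

End Specialization.

Lemma pair_prod_subset (R : comNzRingType) (I : finType) (r : rel I) (A B : {set I})
    (f : I -> I -> R) : B \subset A ->
  exists c, pair_prod r A f = (pair_prod r B f * c)%R.
Proof.
move=> /subsetP sBA; exists (\prod_(P : I * I | [&& P.1 \in A, P.2 \in A & r P.1 P.2] &&
   ~~ ((P.1 \in B) && (P.2 \in B))) f P.1 P.2)%R.
rewrite !pair_prodE (bigID (fun P => (P.1 \in B) && (P.2 \in B))) /=.
congr (_ * _)%R; apply: eq_bigl => P; case: (boolP (P.1 \in B)) => [/sBA ->|_]; last by rewrite andbF.
by case: (boolP (P.2 \in B)) => [/sBA ->|_]; rewrite ?andbF //= andbT.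
Qed.

(** * The strategy of Painter *)

Section EdgePainting.

Variable T : finType.
Local Open Scope ring_scope.
Implicit Types (U S B : {set {set T}}) (e f : {set T}).

(** Variables are indexed by all sets of vertices, so that the polynomial ring stays the same while
    edges leave the graph. *)
Definition edge_var e : {mpoly int[#|{set T}|]} := 'X_(enum_rank e).

Definition line_lt : rel {set T} := fun e f => rank_lt e f && ~~ [disjoint e & f].

Definition edge_poly U := pair_prod line_lt U (fun e f => edge_var e - edge_var f).

Lemma edge_poly_homog U : exists d, edge_poly U \is d.-homog for mdeg.
Proof.
pose K (p : {mpoly int[#|{set T}|]}) := exists d, p \is d.-homog for mdeg.
have K1 : K 1 by exists 0%N; apply: dhomog1.
have KM p q : K p -> K q -> K (p * q).
  by move=> [d hp] [d' hq]; exists (d + d')%N; apply: dhomogM.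
apply: (big_ind K) => // e _; apply: (big_ind K) => // f _.
by exists 1%N; apply: rpredB; rewrite dhomogX; apply/eqP; apply: mdeg1.
Qed.

(** Two meeting edges both set to 1 would produce a zero factor, so if the polynomial survives,
    these edges form a matching. Factors with only one edge set to 1 go into [c]. *)
Lemma edge_poly_set_to_one (S : {set 'I_#|{set T}|}) U :
  let SE := [set e | enum_rank e \in S] in
  set_to_one S (edge_poly U) != 0 ->
  trivIset (SE :&: U) /\ exists c, set_to_one S (edge_poly U) = edge_poly (U :\: SE) * c.
Proof.
move=> SE; pose h e := if e \in SE then 1 else edge_var e.
have -> : set_to_one S (edge_poly U) = pair_prod line_lt U (fun e f => h e - h f).
  rewrite /set_to_one /edge_poly /pair_prod rmorph_prod; apply: eq_bigr => e _.
  rewrite rmorph_prod; apply: eq_bigr => f _.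
  by rewrite /= rmorphB /= /edge_var !comp_mpolyXU -!tnth_nth !tnth_mktuple /h !inE.
move=> nz; split.
  have ndis e f : e \in SE :&: U -> f \in SE :&: U -> line_lt e f -> False.
    rewrite !(inE, in_setI) => /andP[Se Ue] /andP[Sf Uf] lef; case/negP: nz.
    rewrite /pair_prod (bigD1 e) //= (bigD1 f) /=; last by rewrite Uf lef.
    by rewrite /h !inE Se Sf subrr !mul0r.
  apply/trivIsetP => e f Se Sf nef; apply: contraT => ndef.
  case/orP: (orbN (rank_lt e f)) => lef.
    by case: (ndis e f Se Sf); rewrite /line_lt lef.
  case: (ndis f e Sf Se); rewrite /line_lt disjoint_sym ndef andbT.
  by rewrite (@rank_lt_tournament _ setT) ?inE // eq_sym nef.
have [c ->] := pair_prod_subset line_lt (fun e f => h e - h f) (subsetDl U SE).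
exists c; congr (_ * _); apply: eq_pair_prod => e f; rewrite !in_setD.
by move=> /andP[/negbTE nSe _] /andP[/negbTE nSf _] _; rewrite /h nSe nSf.
Qed.

(** One round of the game. The invariant is that the polynomial of the uncolored edges has a
    monomial with nonzero coefficient whose exponents are all below the token counts. *)
Lemma edge_poly_mark U B (t : {set T} -> nat) m :
  (edge_poly U)@_m != 0 -> {in U, forall e, (m (enum_rank e) < t e)%N} -> B \subset U ->
  exists S, [/\ S \subset B, trivIset S & exists m',
    (edge_poly (U :\: S))@_m' != 0 /\
    {in U :\: S, forall e, (m' (enum_rank e) < t e - (e \in B))%N}].
Proof.
move=> Pm mt /subsetP sBU; have [d hP] := edge_poly_homog U.
(* The marked edges without slack: after losing a token, each must be colored or have its exponent
   lowered. *)
pose A : {set 'I_#|{set T}|} :=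
  [set i | (enum_val i \in B) && (m i == (t (enum_val i)).-1)].
have [S [/subsetP sSA [m' [nz mA mSA]]]] := mcoeff_set_to_one_neq0 A hP Pm.
have nzP : set_to_one S (edge_poly U) != 0.
  by apply: contraNneq nz => ->; rewrite mcoeff0.
have [triv [c Pc]] := edge_poly_set_to_one nzP.
set SE := [set e | enum_rank e \in S] in triv Pc.
have sSB e : e \in SE -> e \in B.
  by rewrite inE => /sSA; rewrite inE enum_rankK => /andP[].
have SEU : SE :&: U = SE by apply/setIidPl/subsetP=> e /sSB /sBU.
exists SE; split; [exact/subsetP | by rewrite -SEU | ].
(* Passing to a factor of the polynomial can only lower exponents, which keeps the invariant. *)
rewrite Pc in nz; have [m1 nz1 le1] := mcoeffM_neq0 nz.
exists m1; split => // e; rewrite inE => /andP[nSe Ue].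
apply: leq_ltn_trans (le1 _) _; have mte := mt e Ue.
have nS : enum_rank e \notin S by move: nSe; rewrite inE.
case: (boolP (enum_rank e \in A)) => [Ae|nA].
  have := mSA (enum_rank e); rewrite in_setD nS Ae => /(_ isT).
  by move: Ae; rewrite inE enum_rankK => /andP[-> /eqP ->]; rewrite subn1.
rewrite mA //; move: nA; rewrite inE enum_rankK negb_and.
case: (e \in B) => /= [/eqP neq|_]; last by rewrite subn0.
move: neq mte; set x := m _; set y := t e; lia.
Qed.

(** Lister marks at least one uncolored edge, which still has a token, so the total number of tokens
    decreases and serves as the induction measure. *)
Lemma painter_wins_edge_poly U (t : {set T} -> nat) m :
  (edge_poly U)@_m != 0 -> {in U, forall e, (m (enum_rank e) < t e)%N} ->
  painter_wins U t.
Proof.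
have [k] := ubnP (\sum_(e in U) t e)%N.
elim: k U t m => // k IHk U t m lek Pm mt.
have [->|U0] := eqVneq U set0; first exact: PainterDone.
have t0 e : e \in U -> (0 < t e)%N by move=> /mt; lia.
(* Finite choice collects the answers to all marked sets into one strategy; the implications inside
   the existential allow a dummy answer when B is not contained in [U]. *)
have /fin_all_exists[s sP] : forall B, exists S, B != set0 -> B \subset U ->
    [/\ S \subset B, trivIset S & exists m',
      (edge_poly (U :\: S))@_m' != 0 /\
      {in U :\: S, forall e, (m' (enum_rank e) < t e - (e \in B))%N}].
  move=> B; case: (boolP (B \subset U)) => [sBU|_]; last by exists set0.
  by have [S PS] := edge_poly_mark Pm mt sBU; exists S.
apply: (PainterMove (s := s)) => // B B0 sBU; have [sB triv [m' [nz lt_m']]] := sP B B0 sBU.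
  by rewrite sB triv.
apply: IHk nz lt_m'; rewrite ltnS in lek; apply: leq_trans lek.
have /set0Pn[b Bb] := B0; have Ub := subsetP sBU _ Bb.
apply: (@leq_ltn_trans (\sum_(e in U) (t e - (e \in B)))%N).
  rewrite [X in (_ <= X)%N](bigID (mem (s B))) /= addnC; apply: leq_trans (leq_addr _ _).
  by rewrite (eq_bigl (fun e => (e \in U) && (e \notin s B))) // => e; rewrite inE andbC.
rewrite (bigD1 b) //= [X in (_ < X)%N](bigD1 b) //= -addSn leq_add //.
  by rewrite Bb; have := t0 b Ub; lia.
by apply: leq_sum => e _; apply: leq_subr.
Qed.

End EdgePainting.

(** * List colorings and the counting bound *)

Section Choosability.

Variable T : finType.
Implicit Types (U G M : {set {set T}}) (e f : {set T}).

(* Lister marks all uncolored edges whose list contains a given color. *)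
Lemma painter_wins_choosable U (t : {set T} -> nat) : painter_wins U t ->
  forall L : {set T} -> seq nat, {in U, forall e, uniq (L e) /\ size (L e) = t e} ->
  exists c : {set T} -> nat, {in U, forall e, c e \in L e} /\ proper_edge_coloring U c.
Proof.
elim=> {U t} [U t ->|U t s t0 sP _ IH] L LP.
  by exists (fun=> 0); split=> [e|e f]; rewrite inE.
have [->|/set0Pn[e0 Ue0]] := eqVneq U set0.
  by exists (fun=> 0); split=> [e|e f]; rewrite inE.
have [a La] : exists a, a \in L e0.
  have [_ szL] := LP e0 Ue0; have := t0 e0 Ue0; rewrite -szL.
  by case: (L e0) => // a l _; exists a; rewrite mem_head.
pose B := [set e in U | a \in L e].
have B0 : B != set0 by apply/set0Pn; exists e0; rewrite inE Ue0.
have sBU : B \subset U by apply/subsetP=> e; rewrite inE => /andP[].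
have /andP[/subsetP sB /trivIsetP triv] := sP B B0 sBU.
have [|c [cL cP]] := IH B B0 sBU (fun e => rem a (L e)).
  move=> e; rewrite !inE => /andP[_ Ue]; have [uL szL] := LP e Ue.
  rewrite rem_uniq // Ue /=; split=> //; case: (boolP (a \in L e)) => aL.
    by rewrite size_rem // szL subn1.
  by rewrite rem_id // subn0.
have ca e : e \in U -> e \notin s B -> c e <> a.
  move=> Ue nsB ce; have := cL e; rewrite inE nsB Ue ce => /(_ isT).
  by rewrite mem_rem_uniq ?inE ?eqxx //; case: (LP e Ue).
exists (fun e => if e \in s B then a else c e); split=> [e Ue|e f Ue Uf nef mef].
  case: ifPn => [/sB|nsB]; first by rewrite inE => /andP[].
  by apply: mem_rem (a) _ _ (cL e _); rewrite inE nsB.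
case: ifPn => se; case: ifPn => sf.
- by rewrite triv in mef.
- by move/esym/(ca f Uf sf).
- exact: ca.
- by apply: cP => //; rewrite inE ?se ?sf.
Qed.

Lemma edge_paintable_choosable G k : edge_paintable G k -> edge_choosable G k.
Proof. by move=> PG L LP; apply: painter_wins_choosable PG L LP. Qed.

Lemma card_trivIset_edges M : trivIset M -> {in M, forall e, #|e| = 2} ->
  #|M| * 2 = #|cover M|.
Proof.
move=> /eqP <- M2; rewrite -sum_nat_const; apply: eq_bigr => e Me.
by rewrite M2.
Qed.

(** Identical lists give an ordinary proper coloring with k colors, and each color class is a
    matching, hence covers at most [#|T|] vertices. *)
Lemma edge_choosable_card G k : {in G, forall e, #|e| = 2} ->
  edge_choosable G k -> #|G| * 2 <= #|T| * k.
Proof.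
move=> G2 chG; have [|c [cL cP]] := chG (fun=> iota 0 k).
  by move=> e _; rewrite iota_uniq size_iota.
have ck e : e \in G -> c e < k by move=> /cL; rewrite mem_iota.
rewrite -sum1_card big_distrl /=.
have -> : \sum_(e in G) 1 * 2 = \sum_(i < k) \sum_(e in G | c e == i) 2.
  rewrite (eq_bigr (fun e => \sum_(i < k | c e == i) 2)) => [|e Ge]; last first.
    by rewrite (big_pred1 (Ordinal (ck e Ge))) // => i; rewrite -val_eqE /= eq_sym.
  by rewrite (exchange_big_dep predT) //=; apply: eq_bigr => i _; apply: eq_bigl => e.
rewrite mulnC -[k in k * _]card_ord -sum_nat_const; apply: leq_sum => i _.
pose M := [set e in G | c e == i].
rewrite (eq_bigl (mem M)) => [|e]; last by rewrite !inE.
rewrite sum_nat_const card_trivIset_edges ?max_card //.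
  apply/trivIsetP=> e f; rewrite !inE => /andP[Ge /eqP ce] /andP[Gf /eqP cf] nef.
  by apply: contraT => /(cP e f Ge Gf nef); rewrite ce cf.
by move=> e; rewrite inE => /andP[/G2].
Qed.

Lemma coloring_indices G d : {in G, forall e, #|e| = 2} -> 0 < #|T| ->
  #|G| * 2 = #|T| * d -> edge_paintable G d ->
  is_edge_paintability_index G d /\ is_list_chromatic_index G d.
Proof.
move=> G2 T0 cardG PG; have lb k : edge_choosable G k -> d <= k.
  by move/(edge_choosable_card G2); rewrite cardG leq_pmul2l.
have chG := edge_paintable_choosable PG.
by do !split=> //; move=> k /edge_paintable_choosable/lb.
Qed.

End Choosability.

(** * The coefficient as a signed sum of colorings *)

Section FiniteDifferences.

Local Open Scope ring_scope.

(** Up to a global sign, the weights of the a-th finite difference at 0. *)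
Definition bin_weight (a s : nat) : int := (-1) ^+ s * 'C(a, s)%:R.

Lemma sum_bin_weightS a (f : nat -> int) :
  \sum_(s < a.+2) bin_weight a.+1 s * f s =
  \sum_(s < a.+1) bin_weight a s * (f s - f s.+1).
Proof.
rewrite big_ord_recl [X in _ + X](eq_bigr (fun i : 'I_a.+1 =>
   bin_weight a i.+1 * f i.+1 - bin_weight a i * f i.+1)); last first.
  move=> i _; rewrite lift0 /bin_weight binS natrD exprS; ring.
rewrite big_split /= addrA sumrN.
have -> : bin_weight a.+1 0 * f 0%N + \sum_(i < a.+1) bin_weight a i.+1 * f i.+1 =
   \sum_(s < a.+1) bin_weight a s * f s.
  rewrite big_ord_recr /= {3}/bin_weight bin_small // mulr0 mul0r addr0.
  by rewrite [RHS]big_ord_recl /= /bin_weight !bin0.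
by rewrite -sumrN -big_split; apply: eq_bigr => i _; rewrite /= mulrBr.
Qed.

(** The a-th difference annihilates polynomials of degree below a: Pascal's rule turns one
    difference into f(s) - f(s + 1), where the leading power cancels. *)
Lemma sum_bin_weight_exp a j (b : int) : (j < a)%N ->
  \sum_(s < a.+1) bin_weight a s * (s%:R + b) ^+ j = 0.
Proof.
elim: a j => // a IHa j; rewrite ltnS => leja.
rewrite (sum_bin_weightS a (fun s => (s%:R + b) ^+ j)).
under eq_bigr => s _.
  rewrite [s.+1%:R]mulrS -addrA (exprDn 1) big_ord_recr /=.
  rewrite subnn expr0 mul1r binn mulr1n opprD addrCA subrr addr0 mulrN mulr_sumr -sumrN.
  over.
rewrite exchange_big big1 //= => i _; rewrite expr1n.
rewrite (eq_bigr (fun s : 'I_a.+1 =>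
   - 'C(j, i)%:R * (bin_weight a s * (s%:R + b) ^+ i))); last first.
  by move=> s _; rewrite -mulr_natr; ring.
by rewrite -mulr_sumr IHa ?mulr0 // (leq_trans (ltn_ord i)).
Qed.

(** Binomial coefficients vanish beyond a, so all variables can share one range of colors although
    their exponents differ. *)
Lemma sum_bin_weight_widen K a (f : nat -> int) : (a <= K)%N ->
  \sum_(s < K.+1) bin_weight a s * f s = \sum_(s < a.+1) bin_weight a s * f s.
Proof.
move=> leaK; rewrite [RHS](big_ord_widen K.+1 (fun s => bin_weight a s * f s)) ?ltnS //.
rewrite [RHS]big_mkcond; apply: eq_bigr => s _; case: ltnP => // las.
by rewrite /bin_weight bin_small // mulr0 mul0r.
Qed.

(* Each monomial other than m of the same degree has an exponent below that of m,
   and the alternating binomial sum in that variable annihilates it. *)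
Lemma mcoeff_neq0_of_sum (I : finType) (p : {mpoly int[#|I|]}) (m : 'X_{1..#|I|}) K :
  p \is (mdeg m).-homog for mdeg -> (forall i, (m i <= K)%N) ->
  \sum_(c : {ffun I -> 'I_K.+1})
     (\prod_e bin_weight (m (enum_rank e)) (c e)) *
     p.@[fun i => (c (enum_val i))%:R] != 0 ->
  p@_m != 0.
Proof.
move=> hp mK; apply: contraNneq => pm.
under eq_bigr => c _ do rewrite mevalE mulr_sumr.
rewrite exchange_big /= big_seq big1 // => m' m'_supp.
have nm : m' != m by apply: contraTneq m'_supp => ->; rewrite mcoeff_msupp pm eqxx.
have [i lt_i] := mdeg_lt_coord (dhomogP _ _ _ hp m' m'_supp) nm.
under eq_bigr => c _.
  rewrite mulrCA (reindex_onto (@enum_val I I) enum_rank) /=; last by move=> x _; rewrite enum_rankK.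
  rewrite (eq_bigl predT) => [|x]; last by rewrite enum_valK eqxx.
  rewrite -big_split /=.
  rewrite (eq_bigr (fun x => bin_weight (m x) (c (enum_val x)) * (c (enum_val x))%:R ^+ m' x)); last first.
    by move=> x _; rewrite enum_valK.
  rewrite (reindex_onto (@enum_rank I) enum_val) /=; last by move=> x _; rewrite enum_valK.
  rewrite (eq_bigl predT) => [|x]; last by rewrite enum_rankK eqxx.
  under eq_bigr => x _ do rewrite enum_rankK.
  over.
rewrite -mulr_sumr.
rewrite -(bigA_distr_bigA (fun x (s : 'I_K.+1) =>
  bin_weight (m (enum_rank x)) s * (s%:R : int) ^+ m' (enum_rank x))).
rewrite (bigD1 (enum_val i)) //= enum_valK.
rewrite (sum_bin_weight_widen (fun s => s%:R ^+ m' i)) //.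
rewrite [X in _ * (X * _)](_ : _ = 0) ?mul0r ?mulr0 // -[RHS](sum_bin_weight_exp 0 lt_i).
by apply: eq_bigr => s _; rewrite addr0.
Qed.

End FiniteDifferences.

(** * Sorting pairs of edges by color *)

Section ColorClasses.

Variables (T : finType) (lt : rel T) (pos : T -> nat).
Hypothesis pos_inj : injective pos.
Hypothesis ltE : forall u v, lt u v = (pos u < pos v).
Local Open Scope ring_scope.
Implicit Types (e f : {set T}) (C G : {set {set T}}).

Lemma set2_meet e f : #|e| = 2 -> #|f| = 2 -> e != f -> ~~ [disjoint e & f] ->
  exists w a b, [/\ w != a, w != b, a != b & e = [set w; a] /\ f = [set w; b]].
Proof.
move=> e2 f2 nef; rewrite -setI_eq0 => /set0Pn[w]; rewrite inE => /andP[we wf].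
have [a ae] : exists a, e :\ w = [set a].
  by apply/cards1P; move: e2; rewrite (cardsD1 w) we add1n => -[->].
have [b bf] : exists b, f :\ w = [set b].
  by apply/cards1P; move: f2; rewrite (cardsD1 w) wf add1n => -[->].
exists w, a, b; have := set11 a; have := set11 b.
rewrite -{1}ae -{1}bf !inE => /andP[nbw _] /andP[naw _].
have eE : e = [set w; a] by rewrite -(setD1K we) ae.
have fE : f = [set w; b] by rewrite -(setD1K wf) bf.
rewrite eq_sym naw eq_sym nbw; split=> //.
by apply: contraNneq nef => ab; rewrite eE fE ab.
Qed.

(** Meeting pairs correspond to vertices: a vertex determines its edge in [C] and its edge in
    [C']. *)
Lemma prod_meeting_pairs (R : comNzRingType) C C' (y : R) :
  partition C [set: T] -> partition C' [set: T] ->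
  {in C, forall e, #|e| = 2} -> {in C', forall e, #|e| = 2} -> [disjoint C & C'] ->
  \prod_(e in C) \prod_(f in C') (if [disjoint e & f] then 1 else y) = y ^+ #|T|.
Proof.
move=> pC pC' C2 C'2 dCC'.
have inC v : pblock C v \in C by rewrite pblock_mem ?(cover_partition pC) ?inE.
have inC' v : pblock C' v \in C' by rewrite pblock_mem ?(cover_partition pC') ?inE.
have vC v : v \in pblock C v by rewrite mem_pblock (cover_partition pC) inE.
have vC' v : v \in pblock C' v by rewrite mem_pblock (cover_partition pC') inE.
pose h v := (pblock C v, pblock C' v).
(* Two vertices with the same pair of edges would make both edges equal to {v, w}, against the
   disjointness of [C] and [C']. *)
have h_inj : injective h.
  move=> v w [ev fv]; apply/eqP; apply: contraT => nvw.
  have svw (P : {set T}) : v \in P -> w \in P -> #|P| = 2 -> P = [set v; w].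
    move=> Pv Pw P2; apply/esym/eqP; rewrite eqEcard cards2 nvw P2 leqnn andbT.
    by apply/subsetP=> z; rewrite !inE => /orP[] /eqP ->.
  have eP : pblock C v = [set v; w] by apply: svw (vC v) _ (C2 _ (inC v)); rewrite ev.
  have fP : pblock C' v = [set v; w] by apply: svw (vC' v) _ (C'2 _ (inC' v)); rewrite fv.
  by have := disjointFr dCC' (inC v); rewrite eP -fP inC'.
transitivity (\prod_(P in [set h v | v : T]) y); last first.
  by rewrite prodr_const card_imset.
rewrite pair_big_dep /= (bigID (fun P : {set T} * {set T} => [disjoint P.1 & P.2])) /=.
rewrite big1 ?mul1r => [|P /andP[_ ->]] //.
rewrite (eq_bigr (fun=> y)) => [|P /andP[_ /negbTE ->]] //.
apply: eq_bigl => -[e f] /=; apply/andP/imsetP => [[/andP[Ce C'f] nd]|[v _ [-> ->]]].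
  move: nd; rewrite -setI_eq0 => /set0Pn[v]; rewrite inE => /andP[ve vf].
  exists v => //; rewrite /h; have /and3P[_ tC _] := pC; have /and3P[_ tC' _] := pC'.
  by rewrite (def_pblock tC Ce ve) (def_pblock tC' C'f vf).
rewrite inC inC'; split=> //; apply/pred0Pn; exists v.
by rewrite /= vC vC'.
Qed.

Variables (k : nat) (G : {set {set T}}).
Hypothesis G2 : {in G, forall e, #|e| = 2}.
Implicit Types (c : {ffun {set T} -> 'I_k.+1}) (i j : 'I_k.+1).

Definition color_class c i := [set e in G | c e == i].

Definition perfect_coloring c := [forall i, partition (color_class c i) [set: T]].

Lemma pair_prod_ord_const (R : comNzRingType) (y : R) n :
  pair_prod (fun i j : 'I_n => (i < j)%N) setT (fun _ _ => y) = y ^+ 'C(n, 2).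
Proof.
rewrite /pair_prod -bin2_sum big_mkord -prodrXr.
under [LHS]eq_bigl => i do rewrite inE.
rewrite (exchange_big_dep predT) //=; apply: eq_bigr => j _.
rewrite (eq_bigl (fun i : 'I_n => (i < j)%N)) => [|i]; last by rewrite inE.
by rewrite -(big_ord_widen n (fun=> y)) ?prodr_const ?card_ord // ltnW.
Qed.

Lemma ltn_tournament n (A : {set 'I_n}) : tournament A (fun x y : 'I_n => (x < y)%N).
Proof.
by move=> x y _ _; rewrite -leqNgt ltn_neqAle.
Qed.

Lemma rank_lt_neq (I : finType) (x y : I) : rank_lt x y -> x != y.
Proof. by apply: contraTneq => ->; rewrite /rank_lt ltnn. Qed.

Lemma pair_prod_coloring (R : comNzRingType) c (f : {set T} -> {set T} -> R) :
  {in G &, forall e e', e != e' -> f e e' = f e' e} ->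
  pair_prod (@rank_lt _) G f =
  (\prod_i pair_prod (@rank_lt _) (color_class c i) f) *
  pair_prod (fun i j => (i < j)%N) setT (fun i j : 'I_k.+1 =>
    \prod_(e in color_class c i) \prod_(e' in color_class c j) f e e').
Proof.
move=> fC; rewrite (pair_prod_partition (k := c) (B := setT) (rJ := fun i j => (i < j)%N)) //.
- congr (_ * _); first by apply: eq_bigl => i; rewrite inE.
  apply: eq_pair_prod => i j _ _ _.
  have cE i' e : (e \in color_class c i') = (e \in G) && (c e == i') by rewrite inE.
  by rewrite (eq_bigl _ _ (cE i)); apply: eq_bigr => e _; rewrite (eq_bigl _ _ (cE j)).
- exact: rank_lt_tournament.
- exact: ltn_tournament.
Qed.

Lemma color_class2 c i : {in color_class c i, forall e, #|e| = 2}.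
Proof. by move=> e; rewrite inE => /andP[/G2]. Qed.

Lemma color_class_disjoint c i j : i != j -> [disjoint color_class c i & color_class c j].
Proof.
move=> nij; rewrite disjoints_subset; apply/subsetP=> e.
by rewrite !inE => /andP[-> /eqP ->].
Qed.

(** [line_lt] is no tournament. Filling in the factor 1 for disjoint edges gives a product over all
    pairs, which can be reoriented. *)
Lemma pair_prod_line (R : comNzRingType) (A : {set {set T}}) (f : {set T} -> {set T} -> R) :
  pair_prod (@line_lt T) A f =
  pair_prod (@rank_lt _) A (fun e e' => if [disjoint e & e'] then 1 else f e e').
Proof.
rewrite /pair_prod; apply: eq_bigr => e _.
rewrite big_mkcond [RHS]big_mkcond; apply: eq_bigr => e' _; rewrite /line_lt.
by case: (e' \in A); case: (rank_lt e e') => //=; rewrite if_neg.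
Qed.

Lemma perfect_coloringP c : perfect_coloring c ->
  forall i, partition (color_class c i) [set: T].
Proof. by move/forallP. Qed.

(** A multiplicative count of the adjacent pairs of edges: none within a color, one per vertex
    between two colors. *)
Lemma pair_prod_line_const (R : comNzRingType) c (y : R) : perfect_coloring c ->
  pair_prod (@line_lt T) G (fun _ _ => y) = y ^+ (#|T| * 'C(k.+1, 2)).
Proof.
move=> /perfect_coloringP pc; rewrite pair_prod_line (pair_prod_coloring c); last first.
  by move=> e e' _ _ _; rewrite disjoint_sym.
rewrite big1 ?mul1r => [|i _]; last first.
  rewrite /pair_prod big1 // => e Ce; rewrite big1 // => e' /andP[Ce' /rank_lt_neq nee'].
  by have /and3P[_ /trivIsetP t _] := pc i; rewrite t.
rewrite exprM -pair_prod_ord_const; apply: eq_pair_prod => i j _ _ ltij.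
apply: prod_meeting_pairs => //; try exact: color_class2.
by apply: color_class_disjoint; rewrite neq_ltn ltij.
Qed.

(** The degree is carried along as an exponent of 2, so that it can be read off from the
    multiplicative count of adjacent pairs. *)
Lemma edge_poly_dhomog c : perfect_coloring c ->
  edge_poly G \is (#|T| * 'C(k.+1, 2)).-homog for mdeg.
Proof.
move=> pc; pose K (p : {mpoly int[#|{set T}|]}) (x : int) :=
  exists2 d, p \is d.-homog for mdeg & x = 2 ^+ d.
have K1 : K 1 1 by exists 0%N; rewrite ?expr0 //; apply: dhomog1.
have KM p x q y : K p x -> K q y -> K (p * q) (x * y).
  by move=> [d hp ->] [d' hq ->]; exists (d + d')%N; rewrite ?exprD //; apply: dhomogM.
have [d hG] : K (edge_poly G) (pair_prod (@line_lt T) G (fun _ _ => 2)).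
  apply: (big_ind2 K) => // e _; apply: (big_ind2 K) => // f _.
  by exists 1%N => //; apply: rpredB; rewrite dhomogX; apply/eqP; apply: mdeg1.
rewrite (pair_prod_line_const _ pc) => /(@ieexprIn int 2) ->//.
Qed.

(** The total edge sign between two different color classes. Both classes cover every vertex, so it
    runs over all ordered pairs of vertices and does not see the coloring. *)
Definition all_pairs_sign : int := \prod_(u : T) \prod_(v : T) order_sign lt u v.

(** The extra product of edge signs depends on [G] only. It makes the factors symmetric; after
    sorting, pairs of equal color give the matching signs, and pairs of different colors a factor
    fixed by the two colors. *)
Lemma edge_poly_perfect_coloring c : perfect_coloring c ->
  (edge_poly G).@[fun x => (c (enum_val x))%:R] * pair_prod (@rank_lt _) G (edge_sign lt) =
  (\prod_i matching_sign lt (color_class c i)) *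
  pair_prod (fun i j : 'I_k.+1 => (i < j)%N) setT
    (fun i j => all_pairs_sign * (i%:R - j%:R) ^+ #|T|).
Proof.
move=> pc'; have pc := perfect_coloringP pc'.
have -> : (edge_poly G).@[fun x => (c (enum_val x))%:R] =
    pair_prod (@line_lt T) G (fun e e' => (c e)%:R - (c e')%:R).
  rewrite /edge_poly /pair_prod rmorph_prod; apply: eq_bigr => e _.
  rewrite rmorph_prod; apply: eq_bigr => f _.
  by rewrite rmorphB /= !mevalXU !enum_rankK.
rewrite pair_prod_line -pair_prodM (pair_prod_coloring c); last first.
  move=> e f Ge Gf nef; rewrite disjoint_sym; case: ifPn => dis.
    by rewrite (edge_sign_disjoint pos_inj ltE) ?G2 // disjoint_sym.
  rewrite disjoint_sym in dis.
  have [w [a [b [wa wb ab [-> ->]]]]] := set2_meet (G2 Ge) (G2 Gf) nef dis.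
  by rewrite (edge_sign_meet pos_inj ltE) // mulrN -mulNr opprB.
congr (_ * _).
  apply: eq_bigr => i _; have /and3P[_ tC _] := pc i.
  rewrite (matching_signE pos_inj ltE) //; last exact: color_class2.
  apply: eq_pair_prod => e f Ce Cf /rank_lt_neq nef.
  by rewrite (trivIsetP tC) ?mul1r.
apply: eq_pair_prod => i j _ _ ltij.
rewrite (eq_bigr (fun e =>
   (\prod_(f in color_class c j) (if [disjoint e & f] then 1 else i%:R - j%:R)) *
   \prod_(f in color_class c j) edge_sign lt e f)); last first.
  move=> e; rewrite inE => /andP[_ /eqP <-]; rewrite -big_split; apply: eq_bigr => f.
  by rewrite inE => /andP[_ /eqP <-].
rewrite big_split /= prod_meeting_pairs //; try exact: color_class2; last first.
  by apply: color_class_disjoint; rewrite neq_ltn ltij.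
rewrite mulrC; congr (_ * _); rewrite /all_pairs_sign /edge_sign.
rewrite [RHS](eq_bigl (fun u => u \in [set: T])) => [|u]; last by rewrite inE.
rewrite (set_partition_big _ (pc i)); apply: eq_bigr => e _.
rewrite exchange_big; apply: eq_bigr => u _ /=.
rewrite [RHS](eq_bigl (fun u => u \in [set: T])) => [|v]; last by rewrite inE.
by rewrite (set_partition_big _ (pc j)).
Qed.

End ColorClasses.

(** * From the sum over one-factorizations to the coefficient *)

Section FactorizationSum.

Variables (T : finType) (lt : rel T) (pos : T -> nat).
Hypothesis pos_inj : injective pos.
Hypothesis ltE : forall u v, lt u v = (pos u < pos v).
Hypothesis T_gt0 : 0 < #|T|.
Variables (k : nat) (G : {set {set T}}).
Hypothesis G2 : {in G, forall e : {set T}, #|e| = 2}.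
Hypothesis cardG : #|G| * 2 = #|T| * k.+1.
Local Open Scope ring_scope.
Implicit Types (e f : {set T}) (c : {ffun {set T} -> 'I_k.+1}).

Local Notation color_class := (color_class G).
Local Notation perfect_coloring := (perfect_coloring G).

Lemma color_cover c e : e \in G -> e \in color_class c (c e).
Proof. by move=> Ge; rewrite inE Ge eqxx. Qed.

(** The k + 1 color classes are matchings and cover [#|T| * k.+1] vertices in total, so none of them
    can miss a vertex. *)
Lemma proper_perfect_coloring c :
  {in G &, forall e f, e != f -> ~~ [disjoint e & f] -> c e != c f} ->
  perfect_coloring c.
Proof.
move=> pc.
have tC i : trivIset (color_class c i).
  apply/trivIsetP=> e f; rewrite !inE => /andP[Ge /eqP ce] /andP[Gf /eqP cf] nef.
  by apply: contraT => /(pc e f Ge Gf nef); rewrite ce cf eqxx.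
have cC i : (#|color_class c i| * 2 = #|cover (color_class c i)|)%N.
  by apply: card_trivIset_edges => //; apply: color_class2.
have := leqif_sum (fun (i : 'I_k.+1) (_ : true) => subset_leqif_cards (subsetT (cover (color_class c i)))).
move/eq_leqif; rewrite sum_nat_const card_ord cardsT mulnC -cardG.
have -> : (\sum_(i : 'I_k.+1) #|cover (color_class c i)| = #|G| * 2)%N.
  under eq_bigr => i _ do rewrite -cC; rewrite -big_distrl /=; congr (_ * _)%N.
  rewrite -[RHS]sum1_card (partition_big c predT) //=; apply: eq_bigr => i _.
  by rewrite -sum1_card; apply: eq_bigl => e; rewrite inE.
rewrite eqxx => /esym/forall_inP covT; apply/forallP=> i; apply/and3P; split=> //.
  by apply: covT.
by apply/negP; rewrite inE => /andP[/G2]; rewrite cards0.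
Qed.

Lemma card_perfect_class c i : perfect_coloring c -> (#|color_class c i| = #|T|./2)%N.
Proof.
move=> /perfect_coloringP/(_ i) pc; have /and3P[/eqP cov tC _] := pc.
have := card_trivIset_edges tC (@color_class2 _ _ _ G2 c i); rewrite cov cardsT => <-.
by rewrite muln2 doubleK.
Qed.

Lemma color_class_neq0 c i : perfect_coloring c -> exists e, e \in color_class c i.
Proof.
move=> /perfect_coloringP/(_ i) /cover_partition cov.
have [v _] : exists v : T, true by have /card_gt0P[v] := T_gt0; exists v.
have : v \in [set: T] by rewrite inE.
by rewrite -cov => /bigcupP[e Ce _]; exists e.
Qed.

Lemma color_class_inj c : perfect_coloring c -> injective (color_class c).
Proof.
move=> pc i j eqC; have [e Ci] := color_class_neq0 i pc.
have Cj : e \in color_class c j by rewrite -eqC.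
by move: Ci Cj; rewrite !inE => /andP[_ /eqP <-] /andP[_ /eqP].
Qed.

(** Colorings are functions on all sets of vertices. Off [G] the exponent is 0, so 0 is the only
    value there with nonzero binomial weight. *)
Definition zero_off c := [forall (e | e \notin G), c e == ord0].

Definition color_classes c := [set color_class c i | i : 'I_k.+1].

Lemma color_classes_factorization c : perfect_coloring c ->
  one_factorization G (color_classes c).
Proof.
move=> pc; apply/andP; split; last first.
  apply/forall_inP=> _ /imsetP[i _ ->]; rewrite /perfect_matching.
  by rewrite (perfect_coloringP pc) andbT; apply/subsetP=> e; rewrite inE => /andP[].
apply/and3P; split.
- apply/eqP/setP=> e; apply/bigcupP/idP => [[_ /imsetP[i _ ->]]|Ge].
    by rewrite inE => /andP[].
  by exists (color_class c (c e)); rewrite ?color_cover ?imset_f.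
- apply/trivIsetP=> _ _ /imsetP[i _ ->] /imsetP[j _ ->] nC.
  by apply: color_class_disjoint; apply: contraNneq nC => ->.
- apply/imsetP=> -[i _ C0]; have [e] := color_class_neq0 i pc.
  by rewrite -C0 inE.
Qed.

Lemma card_one_factorization F : one_factorization G F -> #|F| = k.+1.
Proof.
case/andP=> pF /forall_inP perfF; apply/eqP; rewrite -(eqn_pmul2l T_gt0) -cardG.
rewrite (card_partition pF) big_distrl /= mulnC -sum_nat_const; apply/eqP.
apply: eq_bigr => M /perfF/andP[/subsetP sMG /and3P[/eqP cov tM _]].
by rewrite (card_trivIset_edges tM) ?cov ?cardsT // => e /sMG/G2.
Qed.

(** The colorings with given classes correspond to the injections from the k + 1 colors into the k +
    1 matchings. *)
Lemma card_colorings F : one_factorization G F ->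
  #|[set c | (perfect_coloring c && zero_off c) && (color_classes c == F)]| = k.+1`!.
Proof.
move=> oF; have cF := card_one_factorization oF.
have [/and3P[/eqP covF tF _] /forall_inP perfF] := andP oF.
have -> : k.+1`! = (#|F| ^_ #|'I_k.+1|)%N by rewrite cF card_ord ffactnn.
rewrite -(card_inj_ffuns_on 'I_k.+1 (mem F)).
pose h c := [ffun i => color_class c i].
rewrite -(card_in_imset (f := h)) => [|c c']; last first.
  rewrite !inE => /andP[/andP[pc /forall_inP zc] _] /andP[/andP[_ /forall_inP zc'] _] eh.
  apply/ffunP=> e; case: (boolP (e \in G)) => [Ge|nG]; last by rewrite (eqP (zc e nG)) (eqP (zc' e nG)).
  have := color_cover c Ge; move/ffunP/(_ (c e)): eh; rewrite !ffunE => ->.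
  by rewrite inE => /andP[_ /eqP].
apply: eq_card => f; rewrite inE; apply/imsetP/andP => [[c]|[/ffun_onP fF /injectiveP f_inj]].
  rewrite inE => /andP[/andP[pc _] /eqP cc] ->; split.
    by apply/ffun_onP=> i; rewrite ffunE -cc imset_f.
  by apply/injectiveP=> i j; rewrite !ffunE; apply: color_class_inj.
have f_onto : [set f i | i : 'I_k.+1] = F.
  apply/eqP; rewrite eqEcard card_imset // card_ord cF leqnn andbT.
  by apply/subsetP=> _ /imsetP[i _ ->]; apply: fF.
have f_uniq e i j : e \in f i -> e \in f j -> i = j.
  move=> ei ej; apply: f_inj; apply/eqP; apply: contraT => nij.
  by have := disjointFr (trivIsetP tF _ _ (fF i) (fF j) nij) ei; rewrite ej.
(* The default [ord0] is reached only by sets outside [G], as [zero_off] demands. *)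
pose c : {ffun {set T} -> 'I_k.+1} := [ffun e => if [pick i | e \in f i] is Some i then i else ord0].
have cE e i : e \in f i -> c e = i.
  move=> ei; rewrite ffunE; case: pickP => [j ej|/(_ i)]; last by rewrite ei.
  exact: f_uniq ej ei.
have fG e i : e \in f i -> e \in G.
  by move=> ei; rewrite -covF; apply/bigcupP; exists (f i); first exact: fF.
have classE i : color_class c i = f i.
  apply/setP=> e; rewrite inE; apply/andP/idP => [[Ge /eqP ce]|ei].
    move: Ge; rewrite -covF => /bigcupP[M]; rewrite -f_onto => /imsetP[j _ ->] ej.
    by rewrite -ce (cE _ _ ej).
  by rewrite (cE _ _ ei) (fG _ _ ei).
exists c; last by apply/ffunP=> i; rewrite ffunE classE.
rewrite inE; apply/andP; split; last first.
  by rewrite -f_onto; apply/eqP/eq_imset.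
apply/andP; split.
  by apply/forallP=> i; rewrite classE; case/andP: (perfF _ (fF i)).
apply/forall_inP=> e nG; rewrite ffunE; case: pickP => // i ei.
by rewrite (fG _ _ ei) in nG.
Qed.

Lemma sum_colorings : \sum_(c | perfect_coloring c && zero_off c)
    \prod_i matching_sign lt (color_class c i) = factorization_sum lt G *+ k.+1`!.
Proof.
rewrite (partition_big color_classes (one_factorization G)) /=; last first.
  by move=> c /andP[pc _]; apply: color_classes_factorization.
rewrite /factorization_sum -sumrMnl; apply: eq_bigr => F oF.
rewrite -(card_colorings oF) -sumr_const; apply: eq_big => [c|c /andP[/andP[pc _] /eqP <-]].
  by rewrite inE.
by rewrite big_imset //= => i j _ _; apply: color_class_inj.
Qed.

Lemma pair_prod_neq0 (I : finType) (r : rel I) A (f : I -> I -> int) :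
  (forall x y, r x y -> f x y != 0) -> pair_prod r A f != 0.
Proof.
by move=> f0; apply/prodf_neq0 => x _; apply/prodf_neq0 => y /andP[_]; apply: f0.
Qed.

Lemma edge_poly_mcoeff_neq0 : factorization_sum lt G != 0 ->
  (edge_poly G)@_[multinom if enum_val i \in G then k else 0%N | i < #|{set T}|] != 0.
Proof.
move=> S0; set m := [multinom _ | _ < _].
have mE e : m (enum_rank e) = if e \in G then k else 0%N by rewrite mnmE enum_rankK.
(* A nonzero sum has a summand; a coloring obtained from it pins down the degree of
   [edge_poly G]. *)
have [c0 pc0] : exists c0 : {ffun {set T} -> 'I_k.+1}, perfect_coloring c0.
  apply/existsP; apply: contraNT S0 => /existsPn nc.
  have := sum_colorings; rewrite big_pred0 => [/esym/eqP|c]; last by rewrite (negbTE (nc c)).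
  by rewrite mulrn_eq0 -[_`! == _]negbK -lt0n fact_gt0.
have degm : mdeg m = (#|T| * 'C(k.+1, 2))%N.
  rewrite mdegE (reindex_onto (@enum_rank {set T}) enum_val) /=; last by move=> x _; rewrite enum_valK.
  rewrite (eq_bigl predT) => [|x]; last by rewrite enum_rankK eqxx.
  under eq_bigr => x _ do rewrite mE.
  rewrite -big_mkcond sum_nat_const /=; apply/eqP; rewrite -(eqn_pmul2r (isT : 0 < 2)%N).
  have C2 : ('C(k.+1, 2) * 2 = k.+1 * k)%N.
    by rewrite -[X in (_ * X)%N]/(2`!)%N bin_ffact ffactnS ffactn1.
  by apply/eqP; rewrite -[RHS]mulnA C2 mulnA -cardG mulnAC.
apply: (@mcoeff_neq0_of_sum _ _ _ k).
- by rewrite degm; apply: edge_poly_dhomog pc0.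
- by move=> i; rewrite mnmE; case: ifP.
(* [W], [L] and [Q] are common to all perfect colorings: the binomial weights (each color is used
   [#|T|./2] times), the factors between different colors, and the edge signs of [G]. *)
pose W := \prod_(i < k.+1) bin_weight k i ^+ #|T|./2.
pose Q := pair_prod (@rank_lt _) G (edge_sign lt).
pose L := pair_prod (fun i j : 'I_k.+1 => (i < j)%N) setT
    (fun i j => all_pairs_sign lt * ((i%:R : int) - j%:R) ^+ #|T|).
have QQ : Q * Q = 1.
  rewrite /Q -pair_prodM /pair_prod big1 // => e _; rewrite big1 // => f _.
  exact: edge_sign_sqr.
suff -> : \sum_(c : {ffun {set T} -> 'I_k.+1})
     (\prod_e bin_weight (m (enum_rank e)) (c e)) *
     (edge_poly G).@[fun i => (c (enum_val i))%:R] =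
   W * L * Q * (factorization_sum lt G *+ k.+1`!).
  rewrite !mulf_neq0 //.
  - apply/prodf_neq0=> i _; rewrite expf_neq0 // mulf_neq0 ?signr_eq0 //.
    by rewrite pnatr_eq0 -lt0n bin_gt0 -ltnS.
  - apply: pair_prod_neq0 => i j ltij; apply: mulf_neq0.
      apply/prodf_neq0=> u _; apply/prodf_neq0=> v _.
      by rewrite /order_sign; case: ifP; rewrite ?oppr_eq0 ?oner_eq0.
    by rewrite expf_neq0 // subr_eq0 eqr_nat neq_ltn ltij.
  - by apply: contraTneq isT => Q0; move: QQ; rewrite Q0 mul0r => /eqP; rewrite eq_sym oner_eq0.
  - by rewrite -mulr_natr mulf_neq0 // pnatr_eq0 -lt0n fact_gt0.
rewrite -sum_colorings mulr_sumr [RHS]big_mkcond; apply: eq_bigr => c _.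
case: (boolP (zero_off c)) => [zc|]; last first.
  rewrite andbF negb_forall => /existsP[e]; rewrite negb_imply => /andP[nG ce].
  rewrite (bigD1 e) //= mE (negbTE nG) {1}/bin_weight bin0n.
  by rewrite -[_ == _]/(c e == ord0) (negbTE ce) mulr0 !mul0r.
rewrite andbT; case: ifPn => [pc|npc]; last first.
  (* Two meeting edges of the same color make a factor of the polynomial vanish. *)
  rewrite [X in _ * X](_ : _ = 0) ?mulr0 //; apply/eqP; apply: contraNT npc => P0.
  apply: proper_perfect_coloring => e f Ge Gf nef mef; apply: contraNneq P0 => cef.
  have pz e1 f1 : e1 \in G -> f1 \in G -> line_lt e1 f1 -> c e1 = c f1 ->
      (edge_poly G).@[fun i => (c (enum_val i))%:R] = 0.
    move=> Ge1 Gf1 l1 c1; rewrite /edge_poly /pair_prod rmorph_prod (bigD1 e1) //=.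
    rewrite rmorph_prod (bigD1 f1) /=; last by rewrite Gf1 l1.
    by rewrite rmorphB /= !mevalXU !enum_rankK c1 subrr !mul0r.
  case/orP: (orbN (rank_lt e f)) => lef.
    by rewrite (pz e f) // /line_lt lef mef.
  rewrite (pz f e) // /line_lt disjoint_sym mef andbT.
  by rewrite (@rank_lt_tournament _ setT) ?inE // eq_sym nef lef.
have -> : \prod_e bin_weight (m (enum_rank e)) (c e) = W.
  rewrite (bigID (mem G)) /= [X in _ * X]big1 ?mulr1; last first.
    move=> e nG; rewrite mE (negbTE nG); move/forall_inP: zc => /(_ e nG)/eqP ->.
    by rewrite /bin_weight bin0 expr0.
  rewrite (partition_big c predT) //=; apply: eq_bigr => i _.
  rewrite -(card_perfect_class i pc) -prodr_const; apply: eq_big => [e|e /andP[Ge /eqP <-]].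
    by rewrite inE.
  by rewrite mE Ge.
have := edge_poly_perfect_coloring pos_inj ltE G2 pc; rewrite -/Q -/L => E.
set P := (edge_poly G).@[_] in E *.
have -> : P = P * Q * Q by rewrite -mulrA QQ mulr1.
by rewrite E; ring.
Qed.

Lemma edge_paintable_of_factorization_sum :
  factorization_sum lt G != 0 -> edge_paintable G k.+1.
Proof.
move=> /edge_poly_mcoeff_neq0 nz; apply: painter_wins_edge_poly nz _ => e Ge.
by rewrite mnmE enum_rankK Ge.
Qed.

End FactorizationSum.

(** * The signed number of starters *)

Section PowerSums.

Variable p : nat.
Hypothesis p_pr : prime p.
Local Notation F := 'F_p.
Local Open Scope ring_scope.

(** For exponent 0 the sum is p = 0. Otherwise X^k - 1 has too few roots to contain all units, and
    multiplying by a unit a with a^k != 1 permutes the summands while scaling the sum by a^k. *)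
Lemma sum_expr_Fp k : (k < p.-1)%N -> \sum_(y : F) y ^+ k = 0.
Proof.
case: k => [_|k ltk].
  under eq_bigr => y _ do rewrite expr0.
  by rewrite sumr_const card_Fp // pchar_Fp_0.
have [a a0 ak] : exists2 a : F, a != 0 & a ^+ k.+1 != 1.
  apply/exists_inP; apply: contraT; rewrite negb_exists_in => /forall_inP ak1.
  have P0 : ('X^(k.+1) - 1%:P : {poly F}) != 0 by rewrite -size_poly_eq0 size_XnsubC.
  have := max_poly_roots P0 (rs := enum [pred a : F | a != 0]).
  rewrite enum_uniq size_XnsubC // -cardE => /(_ _ isT).
  have -> : #|[pred a : F | a != 0]| = p.-1.
    have := cardC1 (0 : F); rewrite card_Fp //.
  move=> lt_p; have : (p.-1 < k.+2)%N.
    apply: lt_p; apply/allP=> a; rewrite mem_enum inE => a0.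
    by rewrite rootE !hornerE subr_eq0 -[_ == _]negbK ak1.
  by rewrite ltnS leqNgt ltk.
have aU : a \is a GRing.unit by rewrite unitfE.
have E : a ^+ k.+1 * \sum_(y : F) y ^+ k.+1 = \sum_(y : F) y ^+ k.+1.
  rewrite mulr_sumr [RHS](reindex_inj (mulrI aU)) /=.
  by apply: eq_bigr => y _; rewrite exprMn.
apply/eqP; have := subrr (\sum_(y : F) y ^+ k.+1); rewrite -{1}E -[X in _ - X]mul1r -mulrBl.
by move/eqP; rewrite mulf_eq0 subr_eq0 (negbTE ak).
Qed.

(* Chevalley-Warning counting: expanding the product, a monomial survives the
   summation only if every variable has exponent at least p - 1, which leaves no
   room for a constant term. *)
Lemma sum_prod_affine (J K : finType) (A : {set K}) (l : K -> J -> F) (c c' : K -> F) :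
  {in ~: A, forall t, c t = c' t /\ forall j, l t j = 0} ->
  (#|A| <= #|J| * p.-1)%N ->
  \sum_(x : {ffun J -> F}) \prod_t (\sum_j l t j * x j + c t) =
  \sum_(x : {ffun J -> F}) \prod_t (\sum_j l t j * x j + c' t).
Proof.
move=> offA leA.
(* [None] stands for the constant term, so that each factor becomes one sum and the product expands
   over choice functions. *)
pose coef (d : K -> F) t (j : option J) := if j is Some j' then l t j' else d t.
pose var (x : {ffun J -> F}) (j : option J) := if j is Some j' then x j' else 1.
have optE (g : option J -> F) : \sum_j g j = \sum_j g (Some j) + g None.
  rewrite (bigD1 None) //= addrC; congr (_ + _).
  rewrite (reindex_omap Some id) /=; last by case.
  by apply: eq_bigl => j; rewrite eqxx.
have expand d : \sum_(x : {ffun J -> F}) \prod_t (\sum_j l t j * x j + d t) =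
    \sum_(phi : {ffun K -> option J}) (\prod_t coef d t (phi t)) *
      \sum_x \prod_t var x (phi t).
  under eq_bigr => x _.
    under eq_bigr => t _ do rewrite -[d t]mulr1 -(optE (fun j => coef d t j * var x j)).
    rewrite bigA_distr_bigA; under eq_bigr => phi _ do rewrite big_split /=.
    over.
  by rewrite exchange_big /=; apply: eq_bigr => phi _; rewrite mulr_sumr.
rewrite !expand; apply: eq_bigr => phi _.
have [->|S0] := eqVneq (\sum_x \prod_t var x (phi t)) 0; first by rewrite !mulr0.
(* If no factor in [A] contributes its constant, the two expansions have the same term. *)
case: (boolP [forall (t | t \in A), phi t != None]) => [/forall_inP noNone|].
  congr (_ * _); apply: eq_bigr => t _; rewrite /coef; case: (boolP (t \in A)) => tA.
    by have := noNone t tA; case: (phi t).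
  by have [-> _] := offA t (introT setCP (negP tA)).
rewrite negb_forall => /existsP[t0]; rewrite negb_imply negbK => /andP[At0 /eqP phi0].
pose n j := #|[set t | phi t == Some j]|.
have big_deg j : (p.-1 <= n j)%N.
  rewrite leqNgt; apply: contraNN S0 => ltj; apply/eqP.
  transitivity (\sum_(x : {ffun J -> F}) \prod_j x j ^+ n j).
    apply: eq_bigr => x _.
    transitivity (\prod_t \prod_j (if phi t == Some j then x j else 1)).
      apply: eq_bigr => t _; rewrite -big_mkcond /=; case: (phi t) => [j'|] /=.
        by rewrite (big_pred1 j') // => i; rewrite eq_sym.
      by rewrite big_pred0.
    rewrite exchange_big; apply: eq_bigr => i _; rewrite -big_mkcond /= -prodr_const.
    by apply: eq_bigl => t; rewrite inE.
  rewrite -(bigA_distr_bigA (fun j (y : F) => y ^+ n j)) (bigD1 j) //=.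
  by rewrite sum_expr_Fp ?mul0r.
have sum_n : (\sum_j n j = #|[set t | phi t != None]|)%N.
  rewrite -sum1_card (eq_bigr (fun j => \sum_(t | phi t == Some j) 1)%N) => [|j _]; last first.
    by rewrite /n -sum1_card; apply: eq_bigl => t; rewrite inE.
  rewrite (exchange_big_dep (fun t => phi t != None)) /=; last by move=> j t _ /eqP ->.
  rewrite [RHS](eq_bigl (fun t => phi t != None)) => [|t]; last by rewrite inE.
  apply: eq_bigr => t; case: (phi t) => // j _.
  by rewrite (big_pred1 j) // => i; rewrite eq_sym.
(* With one factor of [A] spent on its constant, [A] has too few left for p - 1 occurrences of every
   variable. So a variable is picked from a factor outside [A], where all linear coefficients
   vanish. *)
have [t1 nAt1 [j1 phi1]] : exists2 t, t \notin A & exists j, phi t = Some j.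
  have /subsetPn[t] : ~~ ([set t | phi t != None] \subset A :\ t0).
    apply/negP=> /subset_leq_card; rewrite -sum_n leqNgt => /negP; apply.
    have := leA; rewrite (cardsD1 t0) At0 add1n => /leq_trans; apply.
    by rewrite -sum_nat_const; apply: leq_sum.
  rewrite !inE negb_and negbK => phit /orP[/eqP tt0|nAt].
    by rewrite tt0 phi0 in phit.
  by exists t => //; case: (phi t) phit => // j _; exists j.
have z d : \prod_t coef d t (phi t) = 0.
  by rewrite (bigD1 t1) //= phi1 /=; have [_ ->] := offA t1 (introT setCP (negP nAt1)); rewrite mul0r.
by rewrite !z.
Qed.

End PowerSums.

(** * Listings arranged in blocks *)

Section Blocks.

Variables (R : comNzRingType) (m : nat).
Local Open Scope ring_scope.
Local Notation blk := (option ('I_m * bool)).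

(* Positions in a listing a, u_0, v_0, u_1, v_1, ... of 2m + 1 values: [None] is the
   place of a, and [Some (i, false)], [Some (i, true)] are those of u_i, v_i. *)
Definition block_pos (x : blk) : nat := if x is Some (i, b) then (i.*2 + b).+1 else 0%N.

Lemma block_pos_inj : injective block_pos.
Proof.
have half_pos (i : 'I_m) (b : bool) : ((i.*2 + b)./2 = i)%N.
  by rewrite addnC half_bit_double.
move=> [[i b]|] [[i' b']|] //= [e].
have ei : i = i' by apply: val_inj; rewrite /= -(half_pos i b) -(half_pos i' b') e.
by rewrite ei; move: e; rewrite ei => /addnI; case: b b' => [] [].
Qed.

Definition block_lt : rel blk := fun x y => (block_pos x < block_pos y)%N.

Lemma block_lt_tournament A : tournament A block_lt.
Proof. exact: (lt_tournament block_pos_inj (fun _ _ => erefl)). Qed.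

Lemma block_lt_Some (i i' : 'I_m) b b' : block_lt (Some (i, b)) (Some (i', b')) =
  (i < i')%N || (i == i') && (b < b')%N.
Proof.
rewrite /block_lt /= -val_eqE /=; case: b; case: b'; rewrite -!muln2; lia.
Qed.

Lemma big_blk (g : blk -> R) :
  \prod_x g x = g None * \prod_i (g (Some (i, false)) * g (Some (i, true))).
Proof.
rewrite (bigD1 None) //=; congr (_ * _).
rewrite (reindex_omap Some id) /=; last by case.
rewrite (eq_bigl predT) => [|x]; last by rewrite eqxx.
rewrite (eq_bigr (fun q => g (Some (q.1, q.2)))) => [|[]] //.
rewrite -(pair_bigA _ (fun i b => g (Some (i, b)))) /=; apply: eq_bigr => i _.
by rewrite big_bool mulrC.
Qed.

Lemma pair_prod_blocks (g : blk -> blk -> R) :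
  pair_prod block_lt setT g =
  \prod_i (g None (Some (i, false)) * g None (Some (i, true))) *
  \prod_i g (Some (i, false)) (Some (i, true)) *
  pair_prod (fun i k : 'I_m => (i < k)%N) setT (fun i k =>
    \prod_(b : bool) \prod_(b' : bool) g (Some (i, b)) (Some (k, b'))).
Proof.
rewrite /pair_prod.
rewrite (eq_bigr (fun x => \prod_y if block_lt x y then g x y else 1)); last first.
  by move=> x _; rewrite big_mkcond; apply: eq_bigr => y _; rewrite inE.
rewrite (eq_bigl predT) => [|x]; last by rewrite inE.
rewrite big_blk -mulrA; congr (_ * _).
  rewrite big_blk /= mul1r; apply: eq_bigr => i _.
  by rewrite /block_lt /=.
rewrite [X in _ * X](eq_bigl predT) => [|x]; last by rewrite inE.
rewrite -big_split; apply: eq_bigr => i _ /=.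
rewrite !big_blk /= !mul1r -big_split /=.
rewrite [in RHS]big_mkcond (bigD1 i) //= [X in _ = _ * X](bigD1 i) //= !inE !ltnn mul1r.
rewrite !block_lt_Some !ltnn eqxx /= mul1r mulr1 mulr1; congr (_ * _).
apply: eq_bigr => k ki; rewrite inE /= !block_lt_Some [i == k]eq_sym (negbTE ki) /= !orbF.
case: ifP => _; rewrite ?mulr1 // !big_bool. rewrite /=; ring.
Qed.

End Blocks.

Section Listings.

Variables (m : nat) (D : finType).
Hypothesis cardD : #|D| = m.*2.+1.
Local Open Scope ring_scope.
Implicit Types (a : D) (u v : 'I_m -> D).
Local Notation blk := (option ('I_m * bool)).

Definition listing a u v (x : blk) : D :=
  if x is Some (i, b) then if b then v i else u i else a.

(** The product of [f] over all pairs of positions, written out by blocks because the sign of a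
    starter matching splits in the same way. *)
Definition block_prod (R : comNzRingType) (f : D -> D -> R) a u v : R :=
  \prod_i (f a (u i) * f a (v i)) * \prod_i f (u i) (v i) *
  pair_prod (fun i k : 'I_m => (i < k)%N) setT
    (fun i k => f (u i) (u k) * f (u i) (v k) * (f (v i) (u k) * f (v i) (v k))).

Lemma block_prodE (R : comNzRingType) (f : D -> D -> R) a u v :
  block_prod f a u v =
  pair_prod (@block_lt m) setT (fun x y => f (listing a u v x) (listing a u v y)).
Proof.
rewrite pair_prod_blocks /block_prod; congr (_ * _ * _).
by apply: eq_pair_prod => i k _ _ _; rewrite !big_bool /=; ring.
Qed.

Lemma block_prodM (R : comNzRingType) (f g : D -> D -> R) a u v :
  block_prod (fun s t => f s t * g s t) a u v = block_prod f a u v * block_prod g a u v.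
Proof. by rewrite !block_prodE pair_prodM. Qed.

Lemma card_blk : #|{: blk}| = m.*2.+1.
Proof. by rewrite card_option card_prod card_ord card_bool muln2. Qed.

Lemma listing_onto a u v : injective (listing a u v) -> [set listing a u v x | x in setT] = setT.
Proof.
by move=> inj; apply/eqP; rewrite eqEcard subsetT card_imset // !cardsT card_blk cardD /=.
Qed.

(** An injective listing enumerates all of [D], so a symmetric product over its pairs does not
    depend on it. *)
Lemma block_prod_listing (R : comNzRingType) (f : D -> D -> R) a u v :
  injective (listing a u v) -> (forall s t, s != t -> f s t = f t s) ->
  block_prod f a u v = pair_prod (@rank_lt D) setT f.
Proof.
move=> inj fC; rewrite block_prodE -(listing_onto inj).
rewrite (pair_prod_imset (r := @rank_lt D) (r' := @block_lt m)) //.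
- by move=> x y _ _; apply: inj.
- exact: rank_lt_tournament.
- exact: block_lt_tournament.
- by move=> s t _ _; apply: fC.
Qed.

End Listings.

(** * Signed starters and Vandermonde products *)

Section StarterSum.

Variables (p m : nat).
Hypothesis p_pr : prime p.
Hypothesis pE : p = m.*2.+1.
Local Notation F := 'F_p.
Local Notation blk := (option ('I_m * bool)).
Local Open Scope ring_scope.

Definition Fp_lt : rel 'F_p := fun s t => (s < t)%N.
Definition Fp_pos (s : 'F_p) : nat := s.

Lemma Fp_pos_inj : injective Fp_pos. Proof. exact: val_inj. Qed.

Lemma Fp_ltE s t : Fp_lt s t = (Fp_pos s < Fp_pos t)%N. Proof. by []. Qed.

Definition Fp_sign (s t : 'F_p) : int := order_sign Fp_lt s t.

Lemma Fp_signC s t : s != t -> Fp_sign s t = - Fp_sign t s.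
Proof. exact: (order_signC Fp_pos_inj Fp_ltE). Qed.

Lemma Fp_sign_sqr s t : Fp_sign s t * Fp_sign s t = 1.
Proof. exact: order_sign_sqr. Qed.

Lemma cardFp : #|{: F}| = m.*2.+1.
Proof. by rewrite card_Fp. Qed.

(** For an injective listing, the sign of the permutation that sorts it. *)
Definition listing_sign (a : F) (u v : 'I_m -> F) : int := block_prod Fp_sign a u v.

Definition vandermonde (a : F) (u v : 'I_m -> F) : F := block_prod (fun s t => t - s) a u v.

Lemma listing_sign_sqr a u v : listing_sign a u v * listing_sign a u v = 1.
Proof.
rewrite -block_prodM block_prodE /pair_prod big1 // => x _; rewrite big1 // => y _.
exact: Fp_sign_sqr.
Qed.

(** The Vandermonde determinant of 0, ..., p - 1: the order sign turns every factor into larger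
    minus smaller, whatever the enumeration. *)
Definition vandermonde0 : F :=
  pair_prod (@rank_lt F) setT (fun s t => (Fp_sign s t)%:~R * (t - s)).

Lemma vandermonde0_neq0 : vandermonde0 != 0.
Proof.
apply/prodf_neq0=> s _; apply/prodf_neq0=> t /andP[_ /rank_lt_neq nst].
rewrite mulf_neq0 ?subr_eq0 1?eq_sym // /Fp_sign /order_sign.
by case: ifP => _; rewrite eq_sym ?rmorphN ?oppr_eq0 rmorph1 oner_eq0.
Qed.

Lemma block_prod_int (f : F -> F -> int) a (u v : 'I_m -> F) :
  block_prod (fun s t => (f s t)%:~R : F) a u v = (block_prod f a u v)%:~R.
Proof.
rewrite !block_prodE /pair_prod rmorph_prod; apply: eq_bigr => x _.
by rewrite rmorph_prod.
Qed.

Lemma vandermonde_listing a u v : injective (listing a u v) ->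
  vandermonde a u v = (listing_sign a u v)%:~R * vandermonde0.
Proof.
move=> inj; have E : (listing_sign a u v)%:~R * vandermonde a u v = vandermonde0.
  rewrite -block_prod_int -block_prodM (block_prod_listing cardFp inj) // => s t nst.
  by rewrite Fp_signC // rmorphN /= mulNr -mulrN opprB.
by rewrite -E mulrA -rmorphM listing_sign_sqr /= mul1r.
Qed.

Lemma vandermonde_eq0 a u v : ~~ injectiveb (listing a u v) -> vandermonde a u v = 0.
Proof.
move/injectivePn=> [x [y nxy exy]]; rewrite /vandermonde block_prodE.
have [lxy|lyx] : block_lt x y \/ block_lt y x.
  by rewrite (@block_lt_tournament m setT x y) ?inE // nxy /=; case: (block_lt y x); auto.
  rewrite /pair_prod (bigD1 x) ?inE //= (bigD1 y) ?inE //=.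
  by rewrite exy subrr !mul0r.
rewrite /pair_prod (bigD1 y) ?inE //= (bigD1 x) ?inE //=.
by rewrite exy subrr !mul0r.
Qed.

Definition is_starter (g x : 'I_m -> F) := injectiveb (listing 0 x (fun i => x i + g i)).

Definition starter_sign (g x : 'I_m -> F) := listing_sign 0 x (fun i => x i + g i).

Definition starter_sum (g : 'I_m -> F) : int :=
  \sum_(x : {ffun 'I_m -> F} | is_starter g x) starter_sign g x.

Lemma sum_vandermonde g :
  \sum_(x : {ffun 'I_m -> F}) vandermonde 0 x (fun i => x i + g i) =
  (starter_sum g)%:~R * vandermonde0.
Proof.
rewrite (bigID (fun x : {ffun 'I_m -> F} => is_starter g x)) /= [X in _ + X]big1 ?addr0; last first.
  by move=> x; apply: vandermonde_eq0.
rewrite rmorph_sum mulr_suml; apply: eq_bigr => x /injectiveP inj.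
exact: vandermonde_listing.
Qed.

Definition same_block (x y : blk) :=
  if (x, y) is (Some (i, _), Some (j, _)) then i == j else false.

(** Inside a block the difference is the gap, free of x. The remaining pairs, those with [None]
    included, give affine forms that truly involve x. *)
Definition cross_pairs : {set blk * blk} :=
  [set P | block_lt P.1 P.2 && ~~ same_block P.1 P.2].

Lemma pair_prod_cross (R : comNzRingType) (f : blk -> blk -> R) :
  pair_prod (@block_lt m) setT f =
  \prod_i f (Some (i, false)) (Some (i, true)) * \prod_(P in cross_pairs) f P.1 P.2.
Proof.
have -> : \prod_(P in cross_pairs) f P.1 P.2 =
    pair_prod (@block_lt m) setT (fun x y => if same_block x y then 1 else f x y).
  rewrite pair_prodE big_mkcond [RHS]big_mkcond; apply: eq_bigr => P _.
  by rewrite !inE; case: (block_lt _ _) => //=; case: (same_block _ _).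
rewrite !pair_prod_blocks /= [X in _ = _ * (_ * X * _)]big1 => [|i _]; last by rewrite /same_block eqxx.
rewrite mulr1 mulrA [X in _ = X * _]mulrC; congr (_ * _).
apply: eq_pair_prod => i k _ _ ltik.
apply: eq_bigr => b _; apply: eq_bigr => b' _; rewrite /same_block -val_eqE /=.
by rewrite ltn_eqF.
Qed.

(** The number of pairs is read off as an exponent of 2: of the C(2m + 1, 2) pairs of positions, m
    lie inside a block. *)
Lemma card_cross_pairs : #|cross_pairs| = (m * p.-1)%N.
Proof.
have : pair_prod (@block_lt m) setT (fun _ _ => 2 : int) = 2 ^+ (m * 2 + m + 4 * 'C(m, 2)).
  rewrite pair_prod_blocks !big_const_ord !iter_mulr_1.
  have -> : 2 ^+ (m * 2 + m + 4 * 'C(m, 2)) = (2 * 2) ^+ m * 2 ^+ m * (2 ^+ 4) ^+ 'C(m, 2) :> int.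
    by rewrite -expr2 -!exprM -!exprD [(m * 2)%N]mulnC.
  congr (_ * _); rewrite -pair_prod_ord_const.
  by apply: eq_pair_prod => i j _ _ _; rewrite !big_bool.
rewrite pair_prod_cross !prodr_const card_ord -exprD => /(@ieexprIn int 2).
have : ('C(m, 2) * 2 = m * m.-1)%N.
  by rewrite -[X in (_ * X)%N]/(2`!)%N bin_ffact ffactnS ffactn1.
rewrite pE /=; set c := 'C(m, 2); set n := #|_|; rewrite -muln2.
by case: (m) => [|m']; nia.
Qed.

Definition var_coef (x : blk) (j : 'I_m) : F := if x is Some (i, _) then (i == j)%:R else 0.
Definition shift_coef (g : 'I_m -> F) (x : blk) : F := if x is Some (i, true) then g i else 0.

Lemma listing_affine (g x : 'I_m -> F) y :
  listing 0 x (fun i => x i + g i) y = \sum_j var_coef y j * x j + shift_coef g y.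
Proof.
case: y => [[i b]|] /=; last by rewrite big1 ?addr0 // => j _; rewrite mul0r.
rewrite (bigD1 i) //= eqxx mul1r big1 ?addr0 => [|j]; last first.
  by rewrite eq_sym => /negbTE ->; rewrite mul0r.
by case: b; rewrite ?addr0.
Qed.

Definition linear_vandermonde (x : 'I_m -> F) : F :=
  \prod_(P in cross_pairs) (\sum_j (var_coef P.2 j - var_coef P.1 j) * x j).

Lemma sum_vandermonde_prod g :
  \sum_(x : {ffun 'I_m -> F}) vandermonde 0 x (fun i => x i + g i) =
  \prod_i g i * \sum_(x : {ffun 'I_m -> F}) linear_vandermonde x.
Proof.
(* Outside [cross_pairs] the form is the constant 1, so the product may run over all pairs of
   positions. *)
pose l (P : blk * blk) (j : 'I_m) : F :=
  if P \in cross_pairs then var_coef P.2 j - var_coef P.1 j else 0.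
pose c (P : blk * blk) : F :=
  if P \in cross_pairs then shift_coef g P.2 - shift_coef g P.1 else 1.
pose c0 (P : blk * blk) : F := if P \in cross_pairs then 0 else 1.
transitivity (\prod_i g i * \sum_(x : {ffun 'I_m -> F}) \prod_P (\sum_j l P j * x j + c P)).
  rewrite mulr_sumr; apply: eq_bigr => x _.
  rewrite /vandermonde block_prodE pair_prod_cross; congr (_ * _).
    by apply: eq_bigr => i _; rewrite /= addrC addKr.
  rewrite big_mkcond; apply: eq_bigr => P _; rewrite /l /c; case: ifP => _.
    rewrite !listing_affine opprD addrACA -sumrB; congr (_ + _).
    by apply: eq_bigr => j _; rewrite mulrBl.
  by rewrite big1 ?add0r // => j _; rewrite mul0r.
rewrite (sum_prod_affine p_pr (A := cross_pairs) (c' := c0)); last 2 first.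
- by move=> P; rewrite inE /l /c /c0 => /negbTE ->; split.
- by rewrite card_cross_pairs card_ord.
congr (_ * _); apply: eq_bigr => x _; rewrite /linear_vandermonde [RHS]big_mkcond.
apply: eq_bigr => P _; rewrite /l /c0; case: ifP => _; first by rewrite addr0.
by rewrite big1 ?add0r // => j _; rewrite mul0r.
Qed.

Lemma starter_sum_scale g : (starter_sum g)%:~R = \prod_i g i * (starter_sum (fun=> 1))%:~R :> F.
Proof.
apply: (mulIf vandermonde0_neq0); rewrite -mulrA -!sum_vandermonde !sum_vandermonde_prod.
by rewrite [X in _ * (X * _)]big1_eq mul1r.
Qed.

End StarterSum.

(** * Unit gaps and Wilson's theorem *)

Section UnitGaps.

Variables (p m : nat).
Hypothesis p_pr : prime p.
Hypothesis pE : p = m.*2.+1.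
Local Notation F := 'F_p.
Local Open Scope ring_scope.

Let natF n : (n < p)%N -> (n%:R : F) = n :> nat.
Proof. by move=> ltn; rewrite val_Fp_nat // modn_small. Qed.

Let natF_inj i j : (i < p)%N -> (j < p)%N -> (i%:R : F) = j%:R -> i = j.
Proof. by move=> lti ltj e; rewrite -(natF lti) -(natF ltj) e. Qed.

(* The only tilings of {1, ..., p - 1} by dominos {x, x + 1} mod p avoiding 0. *)
Definition domino_starter (s : {perm 'I_m}) : {ffun 'I_m -> F} := [ffun i => (s i).*2.+1%:R].

Lemma domino_listing (s : {perm 'I_m}) y :
  listing 0 (domino_starter s) (fun i => domino_starter s i + 1) y =
  (if y is Some (i, b) then block_pos (Some (s i, b)) else 0%N)%:R :> F.
Proof.
by case: y => [[i []]|] //=; rewrite ffunE -?mulrSr ?addn0 ?addn1.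
Qed.

Lemma block_pos_ltp (y : option ('I_m * bool)) : (block_pos y < p)%N.
Proof.
rewrite pE; case: y => [[i b]|] //=; have := ltn_ord i; case: b; rewrite -!muln2 /=; lia.
Qed.

Lemma domino_is_starter s : is_starter (fun=> 1) (domino_starter s).
Proof.
apply/injectiveP=> y y'; rewrite !domino_listing => e.
have {e}: block_pos (omap (fun q => (s q.1, q.2)) y) = block_pos (omap (fun q => (s q.1, q.2)) y').
  apply: natF_inj; try exact: block_pos_ltp.
  by move: e; case: y => [[i b]|]; case: y' => [[i' b']|].
by move/block_pos_inj; case: y => [[i b]|]; case: y' => [[i' b']|] //= [/perm_inj -> ->].
Qed.

(** Reordering the dominos moves two entries past two entries, so all inversions come in fours. *)
Lemma domino_sign s : starter_sign (fun=> 1) (domino_starter s) = 1.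
Proof.
rewrite /starter_sign /listing_sign block_prodE pair_prod_blocks.
have lt_pos (i : 'I_m) (b : bool) : ((i.*2 + b).+1 < p)%N := block_pos_ltp (Some (i, b)).
have signE y y' : Fp_sign (listing 0 (domino_starter s) (fun i => domino_starter s i + 1) y)
      (listing 0 (domino_starter s) (fun i => domino_starter s i + 1) y') =
    if block_lt (omap (fun q => (s q.1, q.2)) y') (omap (fun q => (s q.1, q.2)) y) then -1 else 1.
  rewrite !domino_listing /Fp_sign /order_sign /Fp_lt /block_lt.
  by case: y => [[i b]|]; case: y' => [[i' b']|] //=; rewrite !natF //;
    exact: lt_pos.
rewrite big1 => [|i _]; last by rewrite !signE /= mulr1.
rewrite big1 => [|i _]; last by rewrite signE /= block_lt_Some ltnn eqxx.
rewrite !mul1r /pair_prod big1 // => i _.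
rewrite big1 // => j /andP[_ ltij]; rewrite !big_bool !signE /= !block_lt_Some.
have /negbTE -> : s j != s i by rewrite (inj_eq perm_inj) neq_ltn ltij orbT.
by rewrite /= !orbF; case: ifP.
Qed.

Lemma domino_starter_inj : injective domino_starter.
Proof.
move=> s s' e; apply/permP=> i; move/ffunP/(_ i): e; rewrite !ffunE => e.
apply: val_inj; apply/eqP; rewrite /= -eqSS -(eqn_pmul2l (isT : (0 < 2)%N)).
have lt_s (t : {perm 'I_m}) : ((t i).*2.+1 < p)%N by rewrite pE ltnS ltn_double.
by have := natF_inj (lt_s s) (lt_s s') e; rewrite -!muln2; lia.
Qed.

(** The value 0 is taken by the first position, so 1 cannot end a domino and must start one; then 2
    is its end, so 3 must start one, and so on. *)
Lemma starter_domino (x : {ffun 'I_m -> F}) : is_starter (fun=> 1) x ->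
  exists s, x = domino_starter s.
Proof.
move=> /injectiveP inj; set L := listing _ _ _ in inj.
have onto z : exists y, L y = z.
  have : z \in [set L y | y in setT] by rewrite (listing_onto (cardFp p_pr pE)) // inE.
  by case/imsetP=> y _ ->; exists y.
have odd_x k : (k < m)%N -> exists i, x i = k.*2.+1%:R.
  elim: k => [|k IHk] ltk.
    have [y Ly] := onto 1; case: y Ly => [[i []]|] /=.
    - by move/(canRL (addrK _)); rewrite subrr => xi; have := inj (Some (i, false)) None xi.
    - by exists i; rewrite double0.
    - by move/eqP; rewrite eq_sym oner_eq0.
  have [i xi] := IHk (ltnW ltk); have [y Ly] := onto k.+1.*2.+1%:R.
  case: y Ly => [[j []]|] /=.
  - rewrite mulrSr => /addIr xj.
    have := inj (Some (j, false)) (Some (i, true)).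
    by rewrite /= xi xj doubleS [k.*2.+2%:R]mulrSr => /(_ erefl).
  - by exists j.
  - move/esym => e; have ltp : (k.+1.*2.+1 < p)%N by rewrite pE ltnS ltn_double.
    by have := @natF_inj k.+1.*2.+1 0 ltp (prime_gt0 p_pr) e.
have /fin_all_exists[h hE] : forall k : 'I_m, exists i, x i = k.*2.+1%:R.
  by move=> k; apply: odd_x.
have h_inj : injective h.
  move=> k k' e; have := hE k; rewrite e hE => /natF_inj e'.
  apply: val_inj; move: (ltn_ord k) (ltn_ord k') e'; rewrite /= pE -!muln2; lia.
exists (perm h_inj)^-1%g; apply/ffunP=> i; rewrite ffunE.
by rewrite -hE -[h _](permE h_inj) permKV.
Qed.

Lemma starter_sum1 : starter_sum (fun _ : 'I_m => 1 : F) = m`!%:R.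
Proof.
rewrite /starter_sum (eq_bigl (mem [set domino_starter s | s : {perm 'I_m}])); last first.
  move=> x; rewrite !inE; apply/idP/imsetP => [/starter_domino[s ->]|[s _ ->]].
    by exists s.
  exact: domino_is_starter.
rewrite big_imset /=; last by move=> s s' _ _; apply: domino_starter_inj.
rewrite (eq_bigr (fun=> 1)) => [|s _]; last exact: domino_sign.
by rewrite sumr_const card_Sn.
Qed.

(** The gaps 1, ..., m: one from each pair {d, -d} of nonzero residues. *)
Definition gap (i : 'I_m) : F := i.+1%:R.

Lemma prod_gap : \prod_i gap i = m`!%:R.
Proof.
rewrite /gap -natr_prod; congr (_%:R); rewrite fact_prod big_add1 /= big_mkord.
by [].
Qed.

(* Wilson: (p - 1)! = (-1)^m (m!)^2. *)
Lemma fact_expr4 : (m`!%:R : F) ^+ 4 = 1.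
Proof.
have wil : (p.-1)`!%:R = -1 :> F.
  apply/eqP; rewrite -subr_eq0 opprK -mulrSr.
  have : (p %| (p.-1)`!.+1)%N by rewrite -Wilson // prime_gt1.
  by case/dvdnP=> q ->; rewrite natrM pchar_Fp_0 // mulr0.
have : (p.-1)`!%:R = m`!%:R * ((-1) ^+ m * m`!%:R) :> F.
  have factD n : ((m + n)`! = m`! * \prod_(i < n) (m + i).+1)%N.
    elim: n => [|n IHn]; first by rewrite big_ord0 addn0 muln1.
    by rewrite big_ord_recr mulnA -IHn addnS factS mulnC.
  have -> : p.-1 = (m + m)%N by rewrite pE addnn.
  rewrite factD natrM -[X in _ = _ * (_ * X)]prod_gap natr_prod.
  (* The upper half of the factorial, read backwards: 2m - i = -(i + 1) in F_p. *)
  rewrite -[m in _ ^+ m]card_ord -prodr_const -big_split (reindex_inj rev_ord_inj) /=.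
  congr (_ * _); apply: eq_bigr => i _; rewrite /gap mulN1r; apply/eqP.
  rewrite -subr_eq0 opprK -natrD; have -> : ((m + (m - i.+1)).+1 + i.+1 = p)%N.
    by have := ltn_ord i; rewrite pE; lia.
  by rewrite pchar_Fp_0.
move=> e; have sq : (m`!%:R : F) ^+ 2 * (-1) ^+ m = -1 by rewrite -[RHS]wil e; ring.
rewrite -[4%N]/(2 * 2)%N exprM.
have -> : (m`!%:R : F) ^+ 2 = - (-1) ^+ m.
  by rewrite -[LHS]mulr1 -[X in _ * X = _](sqrr_sign _ m) [X in _ * X = _]expr2 mulrA sq mulN1r.
by rewrite sqrrN sqrr_sign.
Qed.

Lemma starter_sum_gap_sqr : (starter_sum gap)%:~R ^+ 2 = 1 :> F.
Proof.
rewrite (starter_sum_scale p_pr pE) starter_sum1 prod_gap.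
by rewrite rmorph_nat -expr2 -exprM fact_expr4.
Qed.

End UnitGaps.

(** * Relabelling and fixed points *)

Section FixedPointSum.

Variables (p : nat) (X : finType) (s : {perm X}).
Hypothesis p_pr : prime p.
Hypothesis sp : forall x, iter p s x = x.
Local Open Scope ring_scope.

(** The cyclic group generated by [s] has order 1 or p, hence is a p-group, and the fixed point
    congruence applies. *)
Lemma card_fixed_mod (D : {set X}) : (forall x, x \in D -> s x \in D) ->
  (#|D|%:R = #|[set x in D | s x == x]|%:R :> 'F_p).
Proof.
move=> sD; have pG : p.-group%g <[s]>%g.
  have : (#[s]%g %| p)%N.
    by rewrite order_dvdn; apply/eqP/permP=> x; rewrite permX sp perm1.
  by case/(primeP p_pr).2/orP => /eqP o; rewrite /pgroup -orderE o ?pnat_id.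
have act : [acts <[s]>%g, on D | 'P].
  rewrite gen_subG; apply/subsetP=> _ /set1P ->; rewrite !inE.
  by apply/subsetP=> x Dx; rewrite !inE /= apermE sD.
have /eqP := pgroup_fix_mod pG act.
have -> : #|'Fix_(D | 'P)(<[s]>)%g| = #|[set x in D | s x == x]|.
  apply: eq_card => x; rewrite in_setI [RHS]inE; case: (x \in D) => //=.
  apply/afixP/eqP => [fx|fx _ /cycleP[i ->]].
    by have := fx s (cycle_id s); rewrite /= apermE.
  by rewrite /= apermE permX; elim: i => //= i ->.
move/eqP=> e; have modE n : (n%:R = (n %% p)%:R :> 'F_p).
  by rewrite {1}(divn_eq n p) natrD natrM pchar_Fp_0 // mulr0 add0r.
by rewrite modE e -modE.
Qed.

(** A sum of signs is the number of terms minus twice the number of terms -1; both counts concern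
    sets stable under [s]. *)
Lemma sum_fixed_mod (D : {set X}) (f : X -> int) : (forall x, x \in D -> s x \in D) ->
  {in D, forall x, f (s x) = f x} -> {in D, forall x, f x = 1 \/ f x = -1} ->
  (\sum_(x in D) f x)%:~R = (\sum_(x in D | s x == x) f x)%:~R :> 'F_p.
Proof.
move=> sD fs f1.
have sumE (B : {set X}) : B \subset D ->
    (\sum_(x in B) f x)%:~R = #|B|%:R - 2 * #|[set x in B | f x != 1]|%:R :> 'F_p.
  move=> /subsetP sBD; rewrite -!sumr_const mulr_sumr rmorph_sum.
  rewrite [X in _ - X](eq_bigl (fun x => (x \in B) && (f x != 1))) => [|x]; last by rewrite inE.
  rewrite [X in _ - X]big_mkcondr -sumrB; apply: eq_bigr => x /sBD/f1[->|->] /=.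
    by rewrite subr0.
  by rewrite mulr1 opprD addrA subrr add0r.
rewrite (sumE D) // [RHS](_ : _ = (\sum_(x in [set x in D | s x == x]) f x)%:~R); last first.
  by congr (_%:~R); apply: eq_bigl => x; rewrite inE.
rewrite sumE; last by apply/subsetP=> x; rewrite inE => /andP[].
rewrite (card_fixed_mod sD) (card_fixed_mod (D := [set x in D | f x != 1])); last first.
  by move=> x; rewrite !inE => /andP[Dx fx]; rewrite sD // fs.
congr (_ - _ * _%:R); apply: eq_card => x; rewrite !inE.
by rewrite -!andbA [(f x != 1) && _]andbC.
Qed.

End FixedPointSum.

(** * How signs change under a relabelling of the vertices *)

Section Relabel.

Variables (T : finType) (lt : rel T) (pos : T -> nat).
Hypothesis pos_inj : injective pos.
Hypothesis ltE : forall u v, lt u v = (pos u < pos v).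
Variables (h : T -> T).
Hypothesis h_inj : injective h.
Local Open Scope ring_scope.
Local Notation os := (order_sign lt).

Definition relabel (M : {set {set T}}) : {set {set T}} := [set h @: (e : {set T}) | e in M].

(** It is -1 exactly when [h] reverses the order of [u] and [v]. As a product of two antisymmetric
    signs it is symmetric. *)
Definition relabel_sign (u v : T) : int := os (h u) (h v) * os u v.

Lemma relabel_signC u v : relabel_sign u v = relabel_sign v u.
Proof.
rewrite /relabel_sign; have [->//|nuv] := eqVneq u v.
rewrite (order_signC pos_inj ltE nuv) (order_signC pos_inj ltE (u := h u)).
  by rewrite mulrNN.
by rewrite (inj_eq h_inj).
Qed.

Lemma pair_prod_sqr1 (I : finType) (r : rel I) A (f : I -> I -> int) :
  (forall x y, f x y * f x y = 1) -> pair_prod r A f * pair_prod r A f = 1.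
Proof.
by move=> ff; rewrite -pair_prodM /pair_prod big1 // => x _; rewrite big1.
Qed.

Lemma relabel_sign_sqr u v : relabel_sign u v * relabel_sign u v = 1.
Proof. by rewrite /relabel_sign mulrACA !order_sign_sqr. Qed.

Lemma partition_setT_trivIset (M : {set {set T}}) : partition M [set: T] -> trivIset M.
Proof. by case/and3P. Qed.

Lemma relabel_partition (M : {set {set T}}) :
  partition M [set: T] -> partition (relabel M) [set: T].
Proof.
rewrite -(imset_partition M _ h_inj); congr (partition _ _).
by apply/eqP; rewrite eqEcard subsetT card_imset // !cardsT leqnn.
Qed.

Lemma card_imset_edge (e : {set T}) : #|[set h x | x in e]| = #|e|.
Proof. exact: card_imset. Qed.

(** The sign changes by the product of [relabel_sign] over pairs of vertices in different edges.
    Signs are their own inverses, so this is the product over all pairs times that over the pairs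
    forming an edge. *)
Lemma matching_sign_relabel (M : {set {set T}}) : partition M [set: T] ->
  {in M, forall e : {set T}, #|e| = 2} ->
  matching_sign lt (relabel M) =
  matching_sign lt M * pair_prod lt setT relabel_sign *
    \prod_(e in M) pair_prod lt e relabel_sign.
Proof.
move=> pM M2; have pM' := relabel_partition pM.
have tM := partition_setT_trivIset pM; have tM' := partition_setT_trivIset pM'.
have M'2 : {in relabel M, forall e : {set T}, #|e| = 2}.
  by move=> _ /imsetP[e Me ->]; rewrite card_imset_edge M2.
rewrite !(matching_signE pos_inj ltE) //.
rewrite (pair_prod_imset (r' := @rank_lt _)) //; last 4 first.
- by move=> e e' _ _; apply: imset_inj.
- exact: rank_lt_tournament.
- exact: rank_lt_tournament.
- move=> e e' Me Me' nee'; rewrite (edge_sign_disjoint pos_inj ltE) ?M'2 //.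
  exact: (trivIsetP tM').
rewrite (pair_prod_perfect (rM := @rank_lt _) pM relabel_signC); last 2 first.
- exact: (lt_tournament pos_inj ltE).
- exact: rank_lt_tournament.
set c := \prod_(e in M) _.
set d := pair_prod _ M (fun e e' => \prod_(u in e) \prod_(v in e') relabel_sign u v).
have cc : c * c = 1.
  rewrite -big_split big1 //= => e _; apply: pair_prod_sqr1; exact: relabel_sign_sqr.
rewrite -mulrA -[c * d * c]mulrAC cc mul1r -pair_prodM.
apply: eq_pair_prod => e e' _ _ _.
rewrite {1}/edge_sign big_imset /=; last by move=> x y _ _; apply: h_inj.
rewrite -big_split; apply: eq_bigr => u _.
rewrite big_imset /=; last by move=> x y _ _; apply: h_inj.
rewrite -big_split; apply: eq_bigr => v _ /=.
by rewrite /relabel_sign mulrCA order_sign_sqr mulr1.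
Qed.

Variable (G : {set {set T}}).
Hypothesis G2 : {in G, forall e : {set T}, #|e| = 2}.
Hypothesis hG : forall e : {set T}, e \in G -> [set h x | x in e] \in G.

Lemma relabel_inj : injective relabel.
Proof. exact/imset_inj/imset_inj. Qed.

Lemma relabel_graph : relabel G = G.
Proof.
apply/eqP; rewrite eqEcard card_imset ?leqnn ?andbT; last exact: imset_inj.
by apply/subsetP=> _ /imsetP[e Ge ->]; apply: hG.
Qed.

Lemma relabel_factorization F : one_factorization G F ->
  one_factorization G [set relabel M | M in F].
Proof.
case/andP=> pF /forall_inP perfF; apply/andP; split.
  by rewrite -[G]relabel_graph imset_partition //; apply: imset_inj.
apply/forall_inP=> _ /imsetP[M FM ->]; have /andP[sMG pM] := perfF M FM.
rewrite /perfect_matching relabel_partition // andbT.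
by apply/subsetP=> _ /imsetP[e Me ->]; apply/hG/(subsetP sMG).
Qed.

Definition factorization_sign (F : {set {set {set T}}}) : int := \prod_(M in F) matching_sign lt M.

(** Each edge of [G] lies in exactly one matching of the factorization, so the correction depends
    only on [G] and the number of matchings. *)
Lemma factorization_sign_relabel k F : one_factorization G F -> #|F| = k ->
  factorization_sign [set relabel M | M in F] =
  factorization_sign F * (pair_prod lt setT relabel_sign ^+ k *
     \prod_(e in G) pair_prod lt e relabel_sign).
Proof.
case/andP=> pF /forall_inP perfF <-.
rewrite /factorization_sign big_imset /=; last by move=> M M' _ _; apply: relabel_inj.
rewrite (eq_bigr (fun M => matching_sign lt M * (pair_prod lt setT relabel_sign *
    \prod_(e in M) pair_prod lt e relabel_sign))); last first.
  move=> M /perfF/andP[/subsetP sMG pM]; rewrite matching_sign_relabel ?mulrA //.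
  by move=> e /sMG/G2.
rewrite big_split /= big_split /= prodr_const; congr (_ * (_ * _)).
by rewrite (set_partition_big _ pF).
Qed.

Lemma iter_imset (A : finType) (g : A -> A) n (B : {set A}) :
  iter n (fun C : {set A} => g @: C) B = iter n g @: B.
Proof.
elim: n => [|n IHn] /=; first by rewrite imset_id.
by rewrite IHn -imset_comp.
Qed.

Lemma factorization_sign1 F : factorization_sign F = 1 \/ factorization_sign F = -1.
Proof.
apply: (big_ind (fun x : int => x = 1 \/ x = -1)); first by left.
  by move=> x y [->|->] [->|->]; rewrite ?mul1r ?mulr1 ?mulN1r ?opprK; auto.
move=> M _; rewrite /matching_sign -signr_odd.
by case: odd; [right|left].
Qed.

(** Relabelling multiplies the sign of every factorization by one and the same c with c^2 = 1. After
    p relabellings the factorization is back, so c^p = 1, and c = 1 because p is odd. *)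
Lemma factorization_sum_fixed p k : prime p -> odd p -> (forall x, iter p h x = x) ->
  (forall F, one_factorization G F -> #|F| = k) ->
  (factorization_sum lt G)%:~R =
  (\sum_(F | one_factorization G F && ([set relabel M | M in F] == F))
     factorization_sign F)%:~R :> 'F_p.
Proof.
move=> p_pr p_odd hp cardF.
set c := pair_prod lt setT relabel_sign ^+ k * \prod_(e in G) pair_prod lt e relabel_sign.
have cc : c * c = 1.
  have pp e : pair_prod lt e relabel_sign * pair_prod lt e relabel_sign = 1.
    by apply: pair_prod_sqr1; apply: relabel_sign_sqr.
  by rewrite mulrACA -exprMn pp expr1n mul1r -big_split big1 //= => e _; apply: pp.
pose s := perm (imset_inj relabel_inj).
have sE F : s F = [set relabel M | M in F] by rewrite permE.
have iterE (F : {set {set {set T}}}) : iter p s F = F.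
  have -> : iter p s F = iter p (fun B : {set {set {set T}}} => relabel @: B) F.
    by elim: p {p_pr p_odd hp} => //= n ->; rewrite sE.
  rewrite iter_imset -[RHS]imset_id; apply: eq_imset => M.
  rewrite iter_imset -[RHS]imset_id; apply: eq_imset => e.
  by rewrite iter_imset -[RHS]imset_id; apply: eq_imset.
have oF n F : one_factorization G F -> one_factorization G (iter n s F).
  by move=> oF; elim: n => //= n IHn; rewrite sE; apply: relabel_factorization.
have c1 F : one_factorization G F -> c = 1.
  move=> oF0; have E n : factorization_sign (iter n s F) = factorization_sign F * c ^+ n.
    elim: n => [|n IHn]; first by rewrite mulr1.
    rewrite iterS sE (factorization_sign_relabel (k := k)) ?IHn ?exprSr ?mulrA //.
      exact: oF.
    by apply: cardF; apply: oF.
  have := E p; rewrite iterE -(odd_double_half p) p_odd add1n exprS -mul2n exprM expr2 cc expr1n mulr1.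
  by case: (factorization_sign1 F) => ->; rewrite ?mul1r // mulN1r => /oppr_inj.
rewrite /factorization_sum.
have := @sum_fixed_mod p _ s p_pr iterE [set F | one_factorization G F] factorization_sign.
move=> H; transitivity ((\sum_(F in [set F | one_factorization G F]) factorization_sign F)%:~R : 'F_p).
  by congr (_%:~R); apply: eq_bigl => F; rewrite inE.
rewrite H.
- by congr (_%:~R); apply: eq_bigl => F; rewrite inE sE.
- by move=> F; rewrite !inE; apply: (oF 1).
- move=> F; rewrite inE => oF0; rewrite sE (factorization_sign_relabel (k := k)) ?cardF //.
  by rewrite -/c (c1 F oF0) mulr1.
- by move=> F _; apply: factorization_sign1.
Qed.

End Relabel.

(** * The graph H_E *)

Section Gaps.

Variables (p m : nat).
Hypothesis p_pr : prime p.
Hypothesis pE : p = m.*2.+1.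
Local Notation F := 'F_p.
Local Open Scope ring_scope.

Lemma ltFp (x : F) : (x < p)%N.
Proof. by rewrite -{2}(Fp_cast p_pr) ltn_ord. Qed.

Lemma natF_eq0 n : (n%:R == 0 :> F) = (p %| n)%N.
Proof. by rewrite -[n%:R == 0]val_eqE /= val_Fp_nat. Qed.

Lemma gap_neq0 (i : 'I_m) : gap p i != 0.
Proof. by rewrite natF_eq0 gtnNdvd // pE ltnS -addnn ltn_addl. Qed.

Lemma gapD_neq0 (i j : 'I_m) : gap p i + gap p j != 0.
Proof.
rewrite -natrD natF_eq0 gtnNdvd // pE ltnS -addnn.
exact: leq_add (ltn_ord i) (ltn_ord j).
Qed.

Lemma gap_inj : injective (@gap p m).
Proof.
have gapE (k : 'I_m) : gap p k = k.+1 :> nat.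
  by rewrite val_Fp_nat // modn_small // pE ltnS -addnn ltn_addl.
by move=> i j e; apply: val_inj; apply/eqP; rewrite -eqSS -!gapE e.
Qed.

Lemma gap_onto (d : F) : d != 0 -> exists i : 'I_m, d = gap p i \/ d = - gap p i.
Proof.
move=> d0; have ltd := ltFp d.
have d_gt0 : (0 < d)%N by rewrite lt0n; apply: contraNneq d0 => e; apply/eqP/val_inj.
have dE : d = (nat_of_ord d)%:R by rewrite natr_Zp.
case: (leqP d m) => [led|gtd].
  have lti : (d.-1 < m)%N by rewrite prednK.
  by exists (Ordinal lti); left; rewrite /gap /= prednK.
have lti : ((p - d).-1 < m)%N by lia.
exists (Ordinal lti); right; apply/eqP; rewrite -addr_eq0 /gap /= prednK ?subn_gt0 //.
by rewrite {1}dE -natrD subnKC ?pchar_Fp_0 // ltnW.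
Qed.

End Gaps.

Section Geometry.

Variables (p m : nat).
Hypothesis p_pr : prime p.
Hypothesis pE : p = m.*2.+1.
Local Notation F := 'F_p.
Local Notation V := (vertex p).
Local Open Scope ring_scope.

Definition vertex_pos (v : V) : nat := (v.2 * p + v.1)%N.

Lemma vertex_pos_inj : injective vertex_pos.
Proof.
clear m pE; move=> [x b] [y c]; rewrite /vertex_pos /=; have := ltFp p_pr x; have := ltFp p_pr y.
case: b; case: c; rewrite ?mul0n ?mul1n ?add0n => lty ltx.
- by move/addnI/val_inj => ->.
- lia.
- lia.
- by move/val_inj => ->.
Qed.

Lemma vertex_ltE (u v : V) : vertex_lt u v = (vertex_pos u < vertex_pos v)%N.
Proof.
clear m pE; case: u v => [x b] [y c]; rewrite /vertex_pos /vertex_lt /=.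
have := ltFp p_pr x; have := ltFp p_pr y.
by case: b; case: c; rewrite /= ?mul0n ?mul1n ?ltn_add2l; lia.
Qed.

(** Cross edges are classified by the slope [b - a], which names the only shift matching containing
    them; layer edges are classified by layer and gap. *)
Definition cedge (a b : F) : {set V} := [set ((a, false) : V); ((b, true) : V)].
Definition ledge (b : bool) (u v : F) : {set V} := [set ((u, b) : V); ((v, b) : V)].

Lemma card_cedge a b : #|cedge a b| = 2.
Proof. by rewrite cards2 xpair_eqE andbF. Qed.

Lemma card_ledge b u v : u != v -> #|ledge b u v| = 2.
Proof. by move=> nuv; rewrite cards2 xpair_eqE (negbTE nuv). Qed.

Lemma cedge_inj a b a' b' : cedge a b = cedge a' b' -> a = a' /\ b = b'.
Proof.
move=> e; have : ((a, false) : V) \in cedge a' b' by rewrite -e set21.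
have : ((b, true) : V) \in cedge a' b' by rewrite -e set22.
by rewrite !inE !xpair_eqE /= !andbF !andbT ?orbF /= => /eqP -> /eqP ->.
Qed.

Lemma cedge_ledge a b c u v : cedge a b <> ledge c u v.
Proof.
move=> e; have : ((a, false) : V) \in ledge c u v by rewrite -e set21.
have : ((b, true) : V) \in ledge c u v by rewrite -e set22.
by rewrite !inE !xpair_eqE; case: c {e}; rewrite !andbF.
Qed.

(** No two of the gaps 1, ..., m add up to 0, so writing an edge as {u, u + gap} leaves no choice of
    the first end. *)
Lemma ledge_gap_inj b u i b' u' (i' : 'I_m) :
  ledge b u (u + gap p i) = ledge b' u' (u' + gap p i') -> [/\ b = b', u = u' & i = i'].
Proof.
move=> e; have : ((u, b) : V) \in ledge b' u' (u' + gap p i') by rewrite -e set21.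
have : ((u + gap p i, b) : V) \in ledge b' u' (u' + gap p i') by rewrite -e set22.
rewrite !inE !xpair_eqE; case: (b =P b') => [->|]; rewrite ?andbF // !andbT => {e b}.
case/orP=> /eqP e1 /orP[] /eqP e2.
- by have := gap_neq0 p_pr pE i; rewrite -(inj_eq (addrI u)) e1 addr0 e2 eqxx.
- have := gapD_neq0 p_pr pE i' i.
  by rewrite -(inj_eq (addrI u')) addrA -e2 e1 addr0 eqxx.
- by split=> //; apply: (gap_inj p_pr pE); apply: (addrI u); rewrite e1 e2.
- by have := gap_neq0 p_pr pE i; rewrite -(inj_eq (addrI u)) e1 -e2 addr0 eqxx.
Qed.

Lemma edge_cases (e : {set V}) : #|e| = 2 ->
  (exists a b, e = cedge a b) \/
  (exists b u (i : 'I_m), e = ledge b u (u + gap p i)).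
Proof.
move=> /eqP/cards2P[[x b] [[y c] [nxy ->]]].
case: (eqVneq b c) nxy => [->|nbc _]; last first.
  left; case: b c nbc => [] [] // _; last by exists x, y.
  by exists y, x; rewrite setUC.
rewrite xpair_eqE eqxx andbT => nxy; right.
have [|i [d|d]] := gap_onto p_pr pE (d := y - x); first by rewrite subr_eq0 eq_sym.
  by exists c, x, i; rewrite -d addrC subrK.
by exists c, y, i; rewrite setUC -[gap p i]opprK -d opprB addrC subrK.
Qed.

Lemma cedge_shift_matching a b e : (cedge a b \in shift_matching e) = (b == a + e).
Proof.
apply/imsetP/eqP => [[x _ /cedge_inj[-> ->]] //|->].
by exists a.
Qed.

Lemma ledge_shift_matching c u v e : ledge c u v \notin shift_matching e.
Proof. by apply/imsetP=> -[x _ /esym/cedge_ledge]. Qed.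

Variable E : {set F}.
Local Notation H := (H_graph E).

Lemma cedge_H a b : (cedge a b \in H) = (b - a \notin E).
Proof.
rewrite !inE card_cedge eqxx andbT; congr (~~ _).
apply/bigcupP/idP => [[e Ee]|Eba]; last first.
  by exists (b - a); rewrite ?cedge_shift_matching // addrC subrK.
by rewrite cedge_shift_matching => /eqP ->; rewrite addrC addKr.
Qed.

Lemma ledge_H c u v : (ledge c u v \in H) = (u != v).
Proof.
rewrite !inE cards2 xpair_eqE eqxx andbT; case: (u != v); rewrite ?andbF // andbT.
by apply/bigcupP=> -[e _]; rewrite (negbTE (ledge_shift_matching c u v e)).
Qed.

Lemma H_card2 : {in H, forall e : {set V}, #|e| = 2}.
Proof. by move=> e; rewrite !inE => /andP[_ /eqP]. Qed.

Definition shift (k : F) (v : V) : V := (v.1 + k, v.2).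

Lemma shift_inj k : injective (shift k).
Proof.
by move=> [x b] [y c] /eqP; rewrite xpair_eqE /= => /andP[/eqP/addIr -> /eqP ->].
Qed.

Lemma shift_cedge k a b : [set shift k v | v in cedge a b] = cedge (a + k) (b + k).
Proof. by rewrite imsetU1 imset_set1. Qed.

Lemma shift_ledge k c u v : [set shift k z | z in ledge c u v] = ledge c (u + k) (v + k).
Proof. by rewrite imsetU1 imset_set1. Qed.

Lemma shift_H k (e : {set V}) : e \in H -> [set shift k v | v in e] \in H.
Proof.
move=> He; have [[a [b eE]]|[c [u [i eE]]]] := edge_cases (H_card2 He).
  by move: He; rewrite eE shift_cedge !cedge_H opprD addrACA subrr addr0.
by move: He; rewrite eE shift_ledge !ledge_H (inj_eq (addIr k)).
Qed.

Lemma iter_shift k n v : iter n (shift k) v = shift (k *+ n) v.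
Proof.
elim: n => [|n /= ->]; first by case: v => x b; rewrite /shift /= addr0.
by rewrite /shift /= mulrSr addrA.
Qed.

Lemma iter_shift_p k v : iter p (shift k) v = v.
Proof.
rewrite iter_shift -mulr_natr pchar_Fp_0 // mulr0.
by case: v => x b; rewrite /shift /= addr0.
Qed.

Lemma card_vertex : #|V| = p.*2.
Proof. by rewrite card_prod card_Fp // card_bool muln2. Qed.

Lemma card_H : #|H| = (p * (2 * p - 1 - #|E|))%N.
Proof.
rewrite /H_graph cardsD (setIidPr _); last first.
  apply/bigcupsP=> e _; apply/subsetP=> _ /imsetP[x _ ->].
  by rewrite inE card_cedge.
have -> : \bigcup_(e in E) shift_matching e = [set cedge P.1 (P.1 + P.2) | P in setX setT E].
  apply/setP=> A; apply/bigcupP/imsetP => [[e Ee /imsetP[x _ ->]]|[[x e] /setXP[_ Ee] ->]].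
    by exists (x, e); rewrite ?inE.
  by exists e => //; apply/imsetP; exists x.
rewrite card_in_imset; last first.
  by move=> [x e] [x' e'] _ _ /cedge_inj[/= -> /addrI ->].
have -> : #|complete_graph V| = (p * (2 * p - 1))%N.
  by rewrite card_draws card_vertex bin2 -mul2n -mulnA mul2n doubleK subn1.
by rewrite cardsX cardsT card_Fp // -mulnBr.
Qed.

Lemma shift_matching_partition e : partition (shift_matching e) [set: V].
Proof.
have mem_edge (v : V) x : (v \in cedge x (x + e)) = (x == if v.2 then v.1 - e else v.1).
  case: v => y []; rewrite !inE !xpair_eqE !andbF ?andbT ?orbF /=.
    by rewrite [RHS]eq_sym subr_eq.
  by rewrite eq_sym.
apply/and3P; split.
- apply/eqP/setP=> v; rewrite inE; apply/bigcupP.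
  pose x := if v.2 then v.1 - e else v.1.
  by exists (cedge x (x + e)); [apply: imset_f | rewrite mem_edge].
- apply/trivIsetP=> _ _ /imsetP[x _ ->] /imsetP[y _ ->] nxy.
  rewrite -setI_eq0; apply/eqP/setP=> v; rewrite !inE -!/(cedge _ _).
  have := mem_edge v x; have := mem_edge v y; rewrite !inE => -> ->.
  by apply/negP=> /andP[/eqP ex /eqP ey]; rewrite ex ey eqxx in nxy.
- by apply/imsetP=> -[x _ /esym/eqP]; rewrite -cards_eq0 card_cedge.
Qed.

Lemma shift_matching_perfect e : e \notin E -> perfect_matching H (shift_matching e).
Proof.
move=> nE; rewrite /perfect_matching shift_matching_partition andbT.
apply/subsetP=> _ /imsetP[x _ ->]; rewrite -/(cedge _ _) cedge_H.
by rewrite addrC addKr.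
Qed.

Lemma shift_matching_inj : injective (@shift_matching p).
Proof.
move=> e f ef; have : cedge 0 e \in shift_matching f.
  by rewrite -ef cedge_shift_matching add0r.
by rewrite cedge_shift_matching add0r => /eqP.
Qed.

Lemma card_perfect M : partition M [set: V] -> {in M, forall e : {set V}, #|e| = 2} -> #|M| = p.
Proof.
move=> /and3P[/eqP cov tM _] M2; have := card_trivIset_edges tM M2.
by rewrite cov cardsT card_vertex -muln2 => /eqP; rewrite eqn_pmul2r // => /eqP.
Qed.

End Geometry.

(** * Translation-invariant one-factorizations *)

Section StarterMatchings.

Variables (p m : nat).
Hypothesis p_pr : prime p.
Hypothesis pE : p = m.*2.+1.
Local Notation F := 'F_p.
Local Notation V := (vertex p).
Local Notation blk := (option ('I_m * bool)).
Local Open Scope ring_scope.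
Implicit Types (a : bool -> F) (w : bool -> 'I_m -> F).

(** The index type of listings is reused with another meaning: the boolean now names the layer
    instead of an end of the block, and [None] is the cross edge. *)
Definition starter_edge a w (x : blk) : {set V} :=
  if x is Some (i, b) then ledge b (w b i) (w b i + gap p i) else cedge (a false) (a true).

Definition starter_matching a w : {set {set V}} := [set starter_edge a w x | x in setT].

Definition layer_listing a w b : blk -> F := listing (a b) (w b) (fun i => w b i + gap p i).

(* The edge through the vertex of layer b listed at position y. *)
Definition layer_edge (b : bool) (y : blk) : blk := if y is Some (i, _) then Some (i, b) else None.

Lemma mem_starter_edge a w z b x :
  reflect (exists2 y, x = layer_edge b y & z = layer_listing a w b y)
          (((z, b) : V) \in starter_edge a w x).
Proof.
apply: (iffP idP); last first.
  move=> [[[i c]|] -> ->] /=; rewrite !inE !xpair_eqE /=.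
    by case: c; rewrite !eqxx ?orbT.
  by case: b; rewrite !eqxx ?orbT.
case: x => [[i c]|]; rewrite !inE !xpair_eqE.
  case/orP=> /andP[/eqP -> /eqP ->]; first by exists (Some (i, false)).
  by exists (Some (i, true)).
by case: b; rewrite ?andbF ?orbF ?andbT => /= /eqP ->; exists None.
Qed.

Lemma card_starter_edge a w x : #|starter_edge a w x| = 2.
Proof.
case: x => [[i b]|] /=; last exact: card_cedge.
by apply: card_ledge; rewrite -[X in X != _]addr0 (inj_eq (addrI _)) eq_sym gap_neq0.
Qed.

Section Perfect.

Variables (a : bool -> F) (w : bool -> 'I_m -> F).
Hypothesis inj : forall b, injective (layer_listing a w b).

Lemma starter_edge_disjoint x x' : x != x' ->
  [disjoint starter_edge a w x & starter_edge a w x'].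
Proof.
apply: contraR => /pred0Pn[[z b] /andP[/mem_starter_edge[y -> zy] /mem_starter_edge[y' -> zy']]].
by rewrite (inj (etrans (esym zy) zy')).
Qed.

Lemma starter_edge_inj : injective (starter_edge a w).
Proof.
move=> x x' e; apply/eqP; apply: contraT => /starter_edge_disjoint.
by rewrite e -setI_eq0 setIid -cards_eq0 card_starter_edge.
Qed.

Lemma starter_matching_partition : partition (starter_matching a w) [set: V].
Proof.
have tM : trivIset (starter_matching a w).
  apply/trivIsetP=> _ _ /imsetP[x _ ->] /imsetP[x' _ ->] nxx'.
  by apply: starter_edge_disjoint; apply: contraNneq nxx' => ->.
have M2 : {in starter_matching a w, forall e : {set V}, #|e| = 2}.
  by move=> _ /imsetP[x _ ->]; apply: card_starter_edge.
apply/and3P; split=> //; last by apply/negP=> /M2; rewrite cards0.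
rewrite eqEcard subsetT cardsT (card_vertex p_pr) -(card_trivIset_edges tM M2) /=.
by rewrite card_imset ?cardsT ?card_blk; [rewrite -pE muln2 | apply: starter_edge_inj].
Qed.

Local Notation lt := (@vertex_lt p).

Lemma edge_sign_ledge b u v u' v' : u != v -> u' != v' ->
  edge_sign lt (ledge b u v) (ledge b u' v') =
  Fp_sign u u' * Fp_sign u v' * (Fp_sign v u' * Fp_sign v v').
Proof.
have os x y : order_sign lt (x, b) (y, b) = Fp_sign x y.
  by rewrite /order_sign /vertex_lt /= ltnn eqxx.
move=> nuv nuv'; rewrite edge_sign2 ?os //; first by rewrite xpair_eqE (negbTE nuv).
by rewrite xpair_eqE (negbTE nuv').
Qed.

Lemma order_sign_cross b x y : order_sign lt (x, b) (y, ~~ b) = if b then -1 else 1.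
Proof. by rewrite /order_sign /vertex_lt /=; case: b. Qed.

Lemma edge_sign_ledge_cross b c u v u' v' : b != c -> u != v -> u' != v' ->
  edge_sign lt (ledge b u v) (ledge c u' v') = 1.
Proof.
have -> : (b != c) = (c == ~~ b) by case: b; case: c.
move=> /eqP -> nuv nuv'; rewrite edge_sign2 ?order_sign_cross; first by case: b.
  by rewrite xpair_eqE (negbTE nuv).
by rewrite xpair_eqE (negbTE nuv').
Qed.

Lemma edge_sign_cedge_ledge x y b u v : u != v ->
  edge_sign lt (cedge x y) (ledge b u v) =
  Fp_sign (if b then y else x) u * Fp_sign (if b then y else x) v.
Proof.
move=> nuv; rewrite edge_sign2 ?xpair_eqE ?andbF ?(negbTE nuv) //.
by rewrite /order_sign /vertex_lt /Fp_sign /order_sign /=; case: b => /=;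
  rewrite ?mulr1 ?mul1r ?mulrNN ?mulr1 ?mul1r.
Qed.

(** Layer edges of different layers never cross. Within a layer, all pairs of the listing are
    compared except the two ends of one edge; the second factor cancels these from
    [listing_sign]. *)
Lemma starter_matching_sign :
  matching_sign lt (starter_matching a w) =
  \prod_(b : bool) (listing_sign (a b) (w b) (fun i => w b i + gap p i) *
    \prod_i Fp_sign (w b i) (w b i + gap p i)).
Proof.
have pM := starter_matching_partition; have tM := partition_setT_trivIset pM.
have M2 : {in starter_matching a w, forall e : {set V}, #|e| = 2}.
  by move=> _ /imsetP[x _ ->]; apply: card_starter_edge.
have ng b i : w b i != w b i + gap p i.
  by rewrite -[X in X != _]addr0 (inj_eq (addrI _)) eq_sym gap_neq0.
have vp := vertex_pos_inj p_pr; have vE := vertex_ltE p_pr.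
rewrite (matching_signE vp vE) //.
rewrite (pair_prod_imset (r' := @block_lt m)); last 4 first.
- by move=> x x' _ _; apply: starter_edge_inj.
- exact: rank_lt_tournament.
- exact: block_lt_tournament.
- move=> _ _ /imsetP[x _ ->] /imsetP[x' _ ->] nxx'.
  rewrite (edge_sign_disjoint vp vE) ?card_starter_edge //.
  by apply: starter_edge_disjoint; apply: contraNneq nxx' => ->.
rewrite pair_prod_blocks big_bool.
have blockE b : listing_sign (a b) (w b) (fun i => w b i + gap p i) *
    \prod_i Fp_sign (w b i) (w b i + gap p i) =
  \prod_i (Fp_sign (a b) (w b i) * Fp_sign (a b) (w b i + gap p i)) *
  pair_prod (fun i k : 'I_m => (i < k)%N) setT (fun i k =>
    edge_sign lt (starter_edge a w (Some (i, b))) (starter_edge a w (Some (k, b)))).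
  rewrite /listing_sign /block_prod [X in X * _]mulrAC -[LHS]mulrA -[X in _ * X]big_split.
  rewrite [X in _ * X]big1 ?mulr1 => [|i _]; last by rewrite /= Fp_sign_sqr.
  congr (_ * _); apply: eq_pair_prod => i k _ _ _.
  by rewrite /= edge_sign_ledge.
rewrite !blockE [RHS]mulrACA -[X in _ = X * _]big_split -[X in _ = _ * X]pair_prodM.
have cross1 : \prod_i edge_sign lt (starter_edge a w (Some (i, false)))
    (starter_edge a w (Some (i, true))) = 1.
  by rewrite big1 // => i _; apply: edge_sign_ledge_cross.
rewrite cross1 mulr1.
congr (_ * _); last first.
  apply: eq_pair_prod => i k _ _ ltik; rewrite !big_bool /=.
  by rewrite [X in _ * X * _]edge_sign_ledge_cross // [X in _ * (X * _)]edge_sign_ledge_cross // mulr1 mul1r.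
by apply: eq_bigr => i _; rewrite /= !edge_sign_cedge_ledge //= mulrC.
Qed.

End Perfect.

End StarterMatchings.

(** * Signs of translates and of shift matchings *)

Section StarterFactorizations.

Variables (p m : nat).
Hypothesis p_pr : prime p.
Hypothesis pE : p = m.*2.+1.
Local Notation F := 'F_p.
Local Notation V := (vertex p).
Local Notation blk := (option ('I_m * bool)).
Local Notation lt := (@vertex_lt p).
Local Open Scope ring_scope.
Implicit Types (a : bool -> F) (w : bool -> 'I_m -> F).

Lemma exp_p_sign (x : int) : x * x = 1 -> x ^+ p = x.
Proof.
by move=> xx; rewrite pE -mul2n exprS exprM expr2 xx expr1n mulr1.
Qed.

(** The sign of the permutation s -> s + k of F_p. *)
Definition translate_sign (k : F) : int :=
  pair_prod (@rank_lt F) setT (fun s t => Fp_sign (s + k) (t + k) * Fp_sign s t).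

Lemma translate_signD k l : translate_sign (k + l) = translate_sign k * translate_sign l.
Proof.
have -> : translate_sign k = pair_prod (@rank_lt F) setT (fun s t =>
    Fp_sign (s + l + k) (t + l + k) * Fp_sign (s + l) (t + l)).
  rewrite /translate_sign.
  have -> : [set: F] = [set s + l | s in [set: F]].
    apply/esym/eqP; rewrite eqEcard subsetT card_imset ?leqnn //; exact: addIr.
  rewrite (pair_prod_imset (r' := @rank_lt F)); last 4 first.
  - by move=> s t _ _; apply: addIr.
  - exact: rank_lt_tournament.
  - exact: rank_lt_tournament.
  - move=> s t _ _ nst; rewrite (Fp_signC nst) Fp_signC ?mulrNN //.
    by rewrite (inj_eq (addIr _)).
  congr (pair_prod _ _ _).
  apply/esym/eqP; rewrite eqEcard subsetT card_imset ?leqnn //; exact: addIr.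
rewrite -pair_prodM; apply: eq_pair_prod => s t _ _ _.
rewrite -[in RHS]mulrA [Fp_sign (s + l) _ * (_ * _)]mulrA Fp_sign_sqr mul1r.
by rewrite [k + l]addrC !addrA.
Qed.

(** The sign is multiplicative in k, p k = 0, and a sign equals its own p-th power as p is odd. *)
Lemma translate_sign1 k : translate_sign k = 1.
Proof.
have sqr1 l : translate_sign l * translate_sign l = 1.
  by apply: pair_prod_sqr1 => s t; rewrite mulrACA !Fp_sign_sqr.
have sign0 : translate_sign 0 = 1.
  rewrite /translate_sign /pair_prod big1 // => s _; rewrite big1 // => t _.
  by rewrite !addr0 Fp_sign_sqr.
have expE n : translate_sign (k *+ n) = translate_sign k ^+ n.
  by elim: n => // n IHn; rewrite mulrS translate_signD IHn exprS.
by rewrite -[LHS]exp_p_sign // -expE -mulr_natr pchar_Fp_0 // mulr0.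
Qed.

Lemma listing_sign_translate k b (u v : 'I_m -> F) : injective (listing b u v) ->
  listing_sign (b + k) (fun i => u i + k) (fun i => v i + k) = listing_sign b u v.
Proof.
move=> inj; rewrite -[LHS]mulr1 -(listing_sign_sqr b u v) mulrA.
rewrite [X in X * _](_ : _ = 1) ?mul1r // -(translate_sign1 k) /translate_sign.
rewrite -(block_prod_listing (cardFp p_pr pE) inj); last first.
  move=> s t nst; rewrite (Fp_signC nst) Fp_signC ?mulrNN //.
  by rewrite (inj_eq (addIr _)).
by rewrite block_prodM.
Qed.

Definition translate_cross a (k : F) : bool -> F := fun b => a b + k.
Definition translate_layers w (k : F) : bool -> 'I_m -> F := fun b i => w b i + k.

Lemma layer_listing_translate a w k b y :
  layer_listing (translate_cross a k) (translate_layers w k) b y = layer_listing a w b y + k.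
Proof. by case: y => [[i []]|] //=; rewrite /translate_layers addrAC. Qed.

Lemma layer_listing_translate_inj a w k :
  (forall b, injective (layer_listing a w b)) ->
  forall b, injective (layer_listing (translate_cross a k) (translate_layers w k) b).
Proof. by move=> inj b y y'; rewrite !layer_listing_translate => /addIr/inj. Qed.

Lemma relabel_starter_matching a w k :
  relabel (shift k) (starter_matching a w) =
  starter_matching (translate_cross a k) (translate_layers w k).
Proof.
rewrite /relabel /starter_matching -imset_comp; apply: eq_imset => x /=.
case: x => [[i b]|] /=; last exact: shift_cedge.
by rewrite shift_ledge /translate_layers addrAC.
Qed.

(** The listing signs are the same for all p translates, and an odd power of a sign is that sign.
    For a fixed gap, the lower ends of the translated edges run through F_p, so the corrections give
    the same [Q] in both layers and cancel. *)
Lemma prod_starter_matching_sign a w : (forall b, injective (layer_listing a w b)) ->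
  \prod_(k : F) matching_sign lt (starter_matching (translate_cross a k) (translate_layers w k)) =
  \prod_(b : bool) listing_sign (a b) (w b) (fun i => w b i + gap p i).
Proof.
move=> inj.
pose Q := \prod_(i < m) \prod_(y : F) Fp_sign y (y + gap p i).
have QQ : Q * Q = 1.
  rewrite -big_split big1 //= => i _; rewrite -big_split big1 //= => y _.
  exact: Fp_sign_sqr.
transitivity (\prod_(b : bool) (listing_sign (a b) (w b) (fun i => w b i + gap p i) * Q)); last first.
  by rewrite !big_bool /= mulrACA QQ mulr1.
under eq_bigr => k _.
  rewrite (starter_matching_sign p_pr pE (layer_listing_translate_inj (k := k) inj)).
  over.
rewrite exchange_big; apply: eq_bigr => b _ /=.
rewrite big_split /=; congr (_ * _).
  rewrite (eq_bigr (fun=> listing_sign (a b) (w b) (fun i => w b i + gap p i))) => [|k _].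
    by rewrite prodr_const card_Fp // exp_p_sign // listing_sign_sqr.
  rewrite -(listing_sign_translate k (inj b)) /translate_cross /translate_layers /listing_sign.
  rewrite !block_prodE; apply: eq_pair_prod => x y _ _ _.
  have addE i : w b i + k + gap p i = w b i + gap p i + k by rewrite addrAC.
  by case: x => [[i []]|]; case: y => [[j []]|] //=; rewrite ?addE.
rewrite exchange_big; apply: eq_bigr => i _; rewrite [RHS](reindex_inj (addrI (w b i))) /=.
by apply: eq_bigr => k _; rewrite /translate_layers.
Qed.

(** Each of the C(p, 2) = mp pairs of edges contributes -1 times the sign by which translation by
    [e] changes its order. The latter signs multiply to 1, and (-1)^(mp) = (-1)^m. *)
Lemma shift_matching_sign e : matching_sign lt (shift_matching e) = (-1) ^+ m.
Proof.
have vp := vertex_pos_inj p_pr; have vE := vertex_ltE p_pr.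
have tM := partition_setT_trivIset (shift_matching_partition e).
have M2 : {in shift_matching e, forall A : {set V}, #|A| = 2}.
  by move=> _ /imsetP[x _ ->]; apply: card_cedge.
rewrite (matching_signE vp vE) //.
have -> : shift_matching e = [set cedge x (x + e) | x in setT].
  by apply/setP=> A; apply/imsetP/imsetP => -[x _ ->]; exists x; rewrite ?inE.
rewrite (pair_prod_imset (r' := fun s t : F => (s < t)%N)); last 4 first.
- by move=> x y _ _ /cedge_inj[].
- exact: rank_lt_tournament.
- exact: ltn_tournament.
- move=> _ _ /imsetP[x _ ->] /imsetP[y _ ->] nxy.
  rewrite (edge_sign_disjoint vp vE) ?card_cedge //.
  by apply: (trivIsetP tM) => //; apply: imset_f.
have signE x y : edge_sign lt (cedge x (x + e)) (cedge y (y + e)) =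
    (-1) * (Fp_sign (x + e) (y + e) * Fp_sign x y).
  rewrite edge_sign2 ?xpair_eqE ?andbF //.
  rewrite /order_sign /Fp_sign /order_sign /vertex_lt /=.
  by rewrite mulr1 !mulN1r mulrN mulrC.
rewrite (eq_pair_prod (g := fun x y => (-1) * (Fp_sign (x + e) (y + e) * Fp_sign x y))) //.
rewrite pair_prodM (pair_prod_tournament (r' := @rank_lt F)
  (f := fun x y => Fp_sign (x + e) (y + e) * Fp_sign x y)).
- rewrite [X in _ * X]translate_sign1 mulr1 (pair_prod_ord_const (-1) _).
  have -> : 'C((Zp_trunc (pdiv p)).+2, 2) = (m * p)%N.
    by rewrite Fp_cast // bin2 {2}pE /= -doubleMr doubleK mulnC.
  by rewrite exprM exp_p_sign // -expr2 sqrr_sign.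
- exact: ltn_tournament.
- exact: rank_lt_tournament.
- move=> s t _ _ nst; rewrite (Fp_signC nst) Fp_signC ?mulrNN //.
  by rewrite (inj_eq (addIr _)).
Qed.

End StarterFactorizations.

(** * Factorizations built from a slope and two starters *)

Section FactorizationsFromStarters.

Variables (p m : nat).
Hypothesis p_pr : prime p.
Hypothesis pE : p = m.*2.+1.
Hypothesis m_gt0 : (0 < m)%N.
Local Notation F := 'F_p.
Local Notation V := (vertex p).
Local Notation blk := (option ('I_m * bool)).
Local Notation lt := (@vertex_lt p).
Local Open Scope ring_scope.
Implicit Types (a : bool -> F) (w : bool -> 'I_m -> F).

Variable E : {set F}.
Hypothesis E_lt : (#|E| < p)%N.
Local Notation H := (H_graph E).

Lemma eq_starter_matching a a' w w' : a =1 a' -> (forall b, w b =1 w' b) ->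
  starter_matching a w = starter_matching a' w'.
Proof.
move=> ea ew; apply: eq_imset => -[[i b]|] /=; first by rewrite ew.
by rewrite !ea.
Qed.

Lemma cedge_starter_matching a w s t :
  (cedge s t \in starter_matching a w) = (s == a false) && (t == a true).
Proof.
apply/imsetP/andP => [[[[i b]|] _ /=]|[/eqP -> /eqP ->]].
- by move/cedge_ledge.
- by move/cedge_inj=> [-> ->].
- by exists None.
Qed.

Lemma ledge_starter_matching a w b u (i : 'I_m) :
  (ledge b u (u + gap p i) \in starter_matching a w) = (u == w b i).
Proof.
apply/imsetP/eqP => [[[[i' b']|] _ /=]|->].
- by move/(ledge_gap_inj p_pr pE) => [-> -> ->].
- by move/esym/cedge_ledge.
- by exists (Some (i, b)).
Qed.

Lemma neq_shift_starter_matching e a w : shift_matching e <> starter_matching a w.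
Proof.
move=> eM; have i0 : 'I_m := Ordinal m_gt0.
have := ledge_starter_matching a w false (w false i0) i0.
by rewrite eqxx -eM (negbTE (ledge_shift_matching _ _ _ _)).
Qed.

Lemma starter_matching_perfect a w : (forall b, injective (layer_listing a w b)) ->
  a true - a false \notin E -> perfect_matching H (starter_matching a w).
Proof.
move=> inj nE; rewrite /perfect_matching (starter_matching_partition p_pr pE) // andbT.
apply/subsetP=> _ /imsetP[[[i b]|] _ ->] /=; last by rewrite cedge_H.
by rewrite ledge_H -[X in X != _]addr0 (inj_eq (addrI _)) eq_sym gap_neq0.
Qed.

(** The slope of the cross edge and a starter for each layer. Among the translates, the one whose
    cross edge starts at 0 is the representative, so its cross edge joins 0 to the slope, and each
    starter is placed relative to the end of the cross edge in its layer. *)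
Definition starter_params : finType := (F * ({ffun 'I_m -> F} * {ffun 'I_m -> F}))%type.
Implicit Types (P : starter_params).

Definition param_a P : bool -> F := fun b => if b then P.1 else 0.
Definition param_x P (b : bool) : {ffun 'I_m -> F} := if b then P.2.2 else P.2.1.
Definition param_w P : bool -> 'I_m -> F := fun b i => param_a P b + param_x P b i.

Definition valid_params P :=
  [&& P.1 \notin E, is_starter (@gap p m) P.2.1 & is_starter (@gap p m) P.2.2].

Definition param_matching P (k : F) :=
  starter_matching (translate_cross (param_a P) k) (translate_layers (param_w P) k).

Definition starter_factorization P : {set {set {set V}}} :=
  [set shift_matching e | e in ~: (P.1 |: E)] :|: [set param_matching P k | k in setT].

Lemma param_listing_inj P : valid_params P ->
  forall b, injective (layer_listing (param_a P) (param_w P) b).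
Proof.
case/and3P=> _ /injectiveP s0 /injectiveP s1 b y y'.
have lE z : layer_listing (param_a P) (param_w P) b z =
    param_a P b + listing 0 (param_x P b) (fun i => param_x P b i + gap p i) z.
  by case: z => [[i []]|] /=; rewrite /param_w ?addr0 ?addrA.
by rewrite !lE => /addrI; rewrite /param_x; case: b {lE}; [apply: s1 | apply: s0].
Qed.

Lemma param_matching_perfect P k : valid_params P -> perfect_matching H (param_matching P k).
Proof.
move=> vP; apply: starter_matching_perfect.
  exact: layer_listing_translate_inj (param_listing_inj vP).
by rewrite /translate_cross /param_a add0r addrK; case/and3P: vP.
Qed.

Lemma param_matching_inj P : injective (param_matching P).
Proof.
move=> k k' e; have : cedge (0 + k) (P.1 + k) \in param_matching P k'.
  by rewrite -e cedge_starter_matching /translate_cross /param_a !eqxx.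
by rewrite cedge_starter_matching /translate_cross /param_a !add0r => /andP[/eqP].
Qed.

Lemma starter_factorization_perfect P M : valid_params P ->
  M \in starter_factorization P -> perfect_matching H M.
Proof.
move=> vP; rewrite inE => /orP[/imsetP[e]|/imsetP[k _ ->]]; last exact: param_matching_perfect.
by rewrite !inE negb_or => /andP[_ eE] ->; apply: shift_matching_perfect.
Qed.

Lemma perfect_card M : perfect_matching H M -> #|M| = p.
Proof.
case/andP=> /subsetP sMH pM; apply: card_perfect pM _ => // e /sMH.
exact: H_card2.
Qed.

Lemma card_shift_part P : valid_params P -> #|~: (P.1 |: E)| = (p - 1 - #|E|)%N.
Proof.
case/and3P=> nE _ _; have := cardsC (P.1 |: E); rewrite cardsU1 nE card_Fp // => /(canRL (addKn _)) ->.
by rewrite subnDA.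
Qed.

(** Disjointness comes from counting: the at most (p - 1 - |E|) + p matchings of p edges each cover
    all p(2p - 1 - |E|) edges of H_E, so no edge is covered twice. *)
Lemma starter_factorizationP P : valid_params P -> one_factorization H (starter_factorization P).
Proof.
move=> vP; have perf := starter_factorization_perfect vP.
apply/andP; split; last by apply/forall_inP.
have cov : cover (starter_factorization P) = H.
  apply/eqP; rewrite eqEsubset; apply/andP; split.
    by apply/bigcupsP=> M /perf/andP[].
  apply/subsetP=> e He; apply/bigcupP.
  have [[s [t eE]]|[c [u [i eE]]]] := edge_cases p_pr pE (H_card2 He); rewrite {}eE in He *.
    rewrite cedge_H in He; have [ef|nf] := eqVneq (t - s) P.1.
      exists (param_matching P s); first by rewrite inE imset_f ?inE ?orbT.
      by rewrite cedge_starter_matching /translate_cross /param_a add0r eqxx -ef subrK eqxx.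
    exists (shift_matching (t - s)).
      by rewrite inE imset_f // !inE negb_or nf.
    by rewrite cedge_shift_matching addrC subrK.
  exists (param_matching P (u - param_w P c i)).
    by rewrite inE orbC imset_f ?inE.
  by rewrite ledge_starter_matching /translate_layers addrC subrK.
have cardF : (#|starter_factorization P| <= 2 * p - 1 - #|E|)%N.
  apply: leq_trans (leq_card_setU _ _) _.
  apply: leq_trans (leq_add (leq_imset_card _ _) (leq_imset_card _ _)) _.
  by rewrite card_shift_part // cardsT card_Fp //; lia.
have tF : trivIset (starter_factorization P).
  rewrite -(leq_card_cover _).2 cov (card_H p_pr); apply/eqP/anti_leq/andP; split.
    by rewrite -(card_H p_pr) -cov; apply: (leq_card_cover _).1.
  rewrite (eq_bigr (fun=> p)) => [|M /perf/perfect_card //].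
  by rewrite sum_nat_const mulnC leq_mul2l cardF orbT.
apply/and3P; split; rewrite ?cov //.
by apply/negP=> /perf/perfect_card; rewrite cards0; have := prime_gt0 p_pr; case: (p).
Qed.

Lemma relabel_shift_matching (k e : F) : relabel (shift k) (shift_matching e) = shift_matching e.
Proof.
apply/eqP; rewrite eqEcard [X in (_ <= X)%N]card_imset ?leqnn ?andbT; last exact/imset_inj/shift_inj.
apply/subsetP=> _ /imsetP[_ /imsetP[x _ ->] ->].
by rewrite -!/(cedge _ _) shift_cedge cedge_shift_matching addrAC.
Qed.

Lemma relabel_param_matching P k l :
  relabel (shift l) (param_matching P k) = param_matching P (k + l).
Proof.
rewrite relabel_starter_matching; apply: eq_starter_matching => [b|b i];
by rewrite /translate_cross /translate_layers addrA.
Qed.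

Lemma starter_factorization_fixed P :
  [set relabel (shift 1) M | M in starter_factorization P] = starter_factorization P.
Proof.
apply/eqP; rewrite eqEcard card_imset ?leqnn ?andbT; last exact/relabel_inj/shift_inj.
apply/subsetP=> _ /imsetP[M FM ->]; move: FM; rewrite !inE.
case/orP=> /imsetP[e eP ->].
  by rewrite relabel_shift_matching imset_f.
by rewrite relabel_param_matching imset_f ?orbT.
Qed.

Lemma starter_factorization_sign P : valid_params P ->
  factorization_sign lt (starter_factorization P) =
  (-1) ^+ (m * (p - 1 - #|E|)) *
  (starter_sign (@gap p m) P.2.1 * starter_sign (@gap p m) P.2.2).
Proof.
move=> vP; rewrite /factorization_sign /starter_factorization.
set A := [set shift_matching e | e in _]; set B := [set param_matching P k | k in setT].
rewrite (eq_bigl [predU A & B]) => [|M]; last by rewrite !inE.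
rewrite bigU /=; last first.
  rewrite disjoints_subset; apply/subsetP=> _ /imsetP[e _ ->]; rewrite inE.
  by apply/imsetP=> -[k _ /neq_shift_starter_matching].
congr (_ * _).
  rewrite big_imset /=; last by move=> e f _ _; apply: shift_matching_inj.
  rewrite (eq_bigr (fun=> (-1) ^+ m)) => [|e _]; last exact: shift_matching_sign.
  by rewrite prodr_const card_shift_part // exprM.
rewrite big_imset /=; last by move=> k k' _ _; apply: param_matching_inj.
rewrite (eq_bigl predT) => [|k]; last by rewrite inE.
rewrite (prod_starter_matching_sign p_pr pE (param_listing_inj vP)) big_bool /= mulrC.
case/and3P: vP => _ /injectiveP s0 /injectiveP s1; congr (_ * _).
  have w0 i : param_w P false i = P.2.1 i by rewrite /param_w /param_a add0r.
  rewrite /starter_sign /listing_sign !block_prodE; apply: eq_pair_prod => x y _ _ _.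
  have lE z : listing (param_a P false) (param_w P false) (fun i => param_w P false i + gap p i) z =
      listing 0 P.2.1 (fun i => P.2.1 i + gap p i) z.
    by case: z => [[i []]|] //=; rewrite w0.
  by rewrite !lE.
rewrite /starter_sign -(listing_sign_translate p_pr pE P.1 s1) /listing_sign !block_prodE.
apply: eq_pair_prod => x y _ _ _.
have w1 i : param_w P true i = P.2.2 i + P.1 by rewrite /param_w /param_a addrC.
have lE z : listing (param_a P true) (param_w P true) (fun i => param_w P true i + gap p i) z =
    listing (0 + P.1) (fun i => P.2.2 i + P.1) (fun i => P.2.2 i + gap p i + P.1) z.
  by case: z => [[i []]|] /=; rewrite ?add0r ?w1 // addrAC.
by rewrite !lE.
Qed.

(** The slope is the only one outside [E] whose shift matching is missing. The matching containing
    the cross edge at 0 then reveals both starters. *)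
Lemma starter_factorization_inj :
  {in [pred P | valid_params P] &, injective starter_factorization}.
Proof.
move=> P P'; rewrite !inE => vP vP' eF.
have shiftE Q e : (shift_matching e \in starter_factorization Q) = (e \notin Q.1 |: E).
  rewrite inE; apply/orP/idP => [[/imsetP[e' e'Q /shift_matching_inj ->]|/imsetP[k _]]|eQ].
  - by move: e'Q; rewrite inE.
  - by move/neq_shift_starter_matching.
  - by left; rewrite imset_f // inE.
have f_eq : P.1 = P'.1.
  have := shiftE P P'.1; rewrite eF shiftE !inE eqxx /= => /esym/negbFE.
  by case/and3P: vP' => /negbTE -> _ _; rewrite orbF => /eqP.
have w_eq b i : param_w P b i = param_w P' b i.
  have : param_matching P 0 \in starter_factorization P'.
    by rewrite -eF inE orbC imset_f ?inE.
  rewrite inE => /orP[/imsetP[e _ /esym/neq_shift_starter_matching //]|/imsetP[k _ e]].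
  have k0 : k = 0.
    have : cedge (0 + k) (P'.1 + k) \in param_matching P 0.
      by rewrite e cedge_starter_matching /translate_cross /param_a !eqxx.
    by rewrite cedge_starter_matching /translate_cross /param_a !addr0 add0r => /andP[/eqP].
  have : ledge b (param_w P b i) (param_w P b i + gap p i) \in param_matching P 0.
    by rewrite ledge_starter_matching /translate_layers addr0.
  by rewrite e k0 ledge_starter_matching /translate_layers addr0 => /eqP.
have x_eq b : param_x P b = param_x P' b.
  apply/ffunP=> i; have := w_eq b i; rewrite /param_w /param_a f_eq.
  exact: addrI.
case: P P' f_eq x_eq {vP vP' eF w_eq} => [f [x0 x1]] [f' [x0' x1']] /= -> x_eq.
by have /= -> := x_eq true; have /= -> := x_eq false.
Qed.

End FactorizationsFromStarters.

(** * Classification of the invariant factorizations *)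

Section FixedFactorizations.

Variables (p m : nat).
Hypothesis p_pr : prime p.
Hypothesis pE : p = m.*2.+1.
Hypothesis m_gt0 : (0 < m)%N.
Local Notation F := 'F_p.
Local Notation V := (vertex p).
Local Notation blk := (option ('I_m * bool)).
Local Notation lt := (@vertex_lt p).
Local Open Scope ring_scope.

Variable E : {set F}.
Hypothesis E_gt0 : (0 < #|E|)%N.
Hypothesis E_lt : (#|E| < p)%N.
Local Notation H := (H_graph E).
Implicit Types M : {set {set V}}.

Lemma relabel_shiftD M (k l : F) :
  relabel (shift l) (relabel (shift k) M) = relabel (shift (k + l)) M.
Proof.
rewrite /relabel -imset_comp; apply: eq_imset => e /=.
by rewrite -imset_comp; apply: eq_imset => v /=; rewrite /shift /= addrA.
Qed.

Lemma relabel_shift0 M : relabel (shift 0) M = M.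
Proof.
rewrite /relabel -[RHS]imset_id; apply: eq_imset => e /=.
by rewrite -[RHS]imset_id; apply: eq_imset => -[x b]; rewrite /shift /= addr0.
Qed.

Lemma relabel_shift_generated M (k l : F) : k != 0 -> relabel (shift k) M = M ->
  relabel (shift l) M = M.
Proof.
move=> k0 fixM; have -> : l = k *+ (l / k)%R.
  by rewrite -mulr_natr natr_Zp mulrC divfK.
elim: (nat_of_ord _) => [|n IHn]; first by rewrite relabel_shift0.
by rewrite mulrSr -relabel_shiftD IHn.
Qed.

Lemma mem_relabel_cedge M k s t : cedge s t \in M -> cedge (s + k) (t + k) \in relabel (shift k) M.
Proof. by move=> Mst; rewrite -shift_cedge; apply: imset_f. Qed.

Lemma mem_relabel_ledge M k c u v :
  ledge c u v \in M -> ledge c (u + k) (v + k) \in relabel (shift k) M.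
Proof. by move=> Muv; rewrite -shift_ledge; apply: imset_f. Qed.

(* A translation-invariant perfect matching has no edge inside a layer, since the
   translate_cross of an edge by its own gap meets it. *)
Lemma shift_invariant_matching M (k : F) : partition M [set: V] ->
  {in M, forall e : {set V}, #|e| = 2} -> k != 0 -> relabel (shift k) M = M ->
  exists e, M = shift_matching e.
Proof.
move=> pM M2 k0 fixM; have fixMl l := relabel_shift_generated l k0 fixM.
have tM := partition_setT_trivIset pM.
have no_ledge c u (i : 'I_m) : ledge c u (u + gap p i) \in M -> False.
  move=> Me; have := mem_relabel_ledge (gap p i) Me; rewrite fixMl => Me'.
  have /(trivIsetP tM _ _ Me Me') : ledge c u (u + gap p i) != ledge c (u + gap p i) (u + gap p i + gap p i).
    apply/eqP=> /(ledge_gap_inj p_pr pE)[_ /eqP + _].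
    by rewrite -[X in X == _]addr0 (inj_eq (addrI u)) eq_sym (negbTE (gap_neq0 p_pr pE i)).
  by rewrite -setI_eq0 => /eqP/setP/(_ (u + gap p i, c)); rewrite !inE !eqxx ?orbT.
have : ((0, false) : V) \in cover M by rewrite (cover_partition pM) inE.
case/bigcupP=> e Me e0; have [[s [t eE]]|[c [u [i eE]]]] := edge_cases p_pr pE (M2 e Me); last first.
  by case: (no_ledge c u i); rewrite -eE.
have s0 : s = 0 by move: e0; rewrite eE !inE !xpair_eqE andbF orbF andbT => /eqP.
exists t; apply/esym/eqP; rewrite eqEcard (card_perfect p_pr pM M2).
rewrite (card_perfect p_pr (shift_matching_partition t)) ?leqnn ?andbT; last first.
  by move=> _ /imsetP[x _ ->]; apply: card_cedge.
apply/subsetP=> _ /imsetP[x _ ->].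
have := mem_relabel_cedge x (s := 0) (t := t) (M := M); rewrite fixMl add0r addrC; apply.
by rewrite -s0 -eE.
Qed.

Lemma starter_edges_listing_inj a w M : trivIset M ->
  (forall x, starter_edge a w x \in M) -> forall b, injective (@layer_listing p m a w b).
Proof.
move=> tM MS b y y' eyy'.
have mem z : ((layer_listing a w b z, b) : V) \in starter_edge a w (layer_edge b z).
  by apply/mem_starter_edge; exists z.
have eE : starter_edge a w (layer_edge b y) = starter_edge a w (layer_edge b y').
  apply/eqP; apply: contraT => /(trivIsetP tM _ _ (MS _) (MS _)).
  rewrite -setI_eq0 => /eqP/setP/(_ (layer_listing a w b y, b)); rewrite in_setI in_set0.
  by rewrite mem {1}eyy' mem.
have gap1 i : w b i <> w b i + gap p i.
  move/eqP; rewrite -[X in X == _]addr0 (inj_eq (addrI _)) eq_sym.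
  by rewrite (negbTE (gap_neq0 p_pr pE i)).
case: y y' eyy' eE => [[i c]|] [[i' c']|] //=; last first.
- by move=> _ /cedge_ledge.
- by move=> _ /esym/cedge_ledge.
move=> + /(ledge_gap_inj p_pr pE)[_ _ ei]; rewrite -{}ei.
by case: c; case: c' => // e; case: (gap1 i).
Qed.

Lemma card_starter_fixed F0 : one_factorization H F0 -> #|F0| = (2 * p - 1 - #|E|)%N.
Proof.
clear E_gt0 m_gt0 pE m.
have lt_d : (0 < 2 * p - 1 - #|E|)%N by have := prime_gt1 p_pr; move: E_lt; lia.
move=> oF; rewrite -(prednK lt_d); apply: (card_one_factorization _ _ _ oF).
- by rewrite (card_vertex p_pr) double_gt0 prime_gt0.
- exact: H_card2.
- by rewrite prednK // (card_H p_pr) (card_vertex p_pr) -muln2 mulnAC.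
Qed.

(** A matching other than a shift matching has p distinct translates, and only one such orbit fits
    into the factorization. All layer edges of H_E lie in this orbit, so each member has one edge of
    each gap in each layer, which leaves exactly one cross edge. *)
Lemma fixed_factorization_starter F0 : one_factorization H F0 ->
  [set relabel (shift 1) M | M in F0] = F0 ->
  exists2 P, @valid_params p m E P & F0 = starter_factorization E P.
Proof.
move=> oF fixF; have [/and3P[/eqP covF tF _] /forall_inP perfF] := andP oF.
have partF M : M \in F0 -> partition M [set: V] by move=> /perfF/andP[].
have subF M : M \in F0 -> M \subset H by move=> /perfF/andP[].
have F2 M : M \in F0 -> {in M, forall e : {set V}, #|e| = 2}.
  by move=> /subF/subsetP sMH e /sMH; apply: H_card2.
have cardM M : M \in F0 -> #|M| = p by move=> FM; apply: card_perfect (partF M FM) (F2 M FM).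
have eqF M M' e : M \in F0 -> M' \in F0 -> e \in M -> e \in M' -> M = M'.
  move=> FM FM' Me M'e; apply/eqP; apply: contraT => /(trivIsetP tF _ _ FM FM').
  by rewrite -setI_eq0 => /eqP/setP/(_ e); rewrite !inE Me M'e.
have F1 M : M \in F0 -> relabel (shift 1) M \in F0.
  by move=> FM; rewrite -fixF imset_f.
have Fk k M : M \in F0 -> relabel (shift k) M \in F0.
  move=> FM; have -> : k = 1 *+ (k : nat) by rewrite natr_Zp.
  elim: (nat_of_ord k) => [|n IHn]; first by rewrite relabel_shift0.
  by rewrite mulrSr -relabel_shiftD F1.
have free M : M \in F0 -> (forall e, M <> shift_matching e) ->
    injective (fun k => relabel (shift k) M).
  move=> FM nM k l e; apply/eqP; rewrite -subr_eq0; apply: contraT => kl0.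
  have [|f Mf] := shift_invariant_matching (partF M FM) (F2 M FM) kl0; last by case: (nM f).
  by rewrite -relabel_shiftD e relabel_shiftD subrr relabel_shift0.
have inH c u (i : 'I_m) : ledge c u (u + gap p i) \in H.
  by rewrite ledge_H -[X in X != _]addr0 (inj_eq (addrI _)) eq_sym gap_neq0.
have not_shift M c u (i : 'I_m) : ledge c u (u + gap p i) \in M -> forall e, M <> shift_matching e.
  by move=> Me e eM; rewrite eM (negbTE (ledge_shift_matching _ _ _ _)) in Me.
pose i0 : 'I_m := Ordinal m_gt0.
(* A matching with a layer edge is no shift matching; as m > 0, there is an edge of gap 1 to start
   from. *)
have [M0 FM0 M0e] : exists2 M0, M0 \in F0 & ledge false 0 (0 + gap p i0) \in M0.
  by have := inH false 0 i0; rewrite -covF => /bigcupP[M FM Me]; exists M.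
have nM0 := not_shift _ _ _ _ M0e; have free0 := free M0 FM0 nM0.
have cardF := card_starter_fixed oF.
pose orb M := [set relabel (shift k) M | k in [set: F]].
have orbF M : M \in F0 -> orb M \subset F0.
  by move=> FM; apply/subsetP=> _ /imsetP[k _ ->]; apply: Fk.
have card_orb M : M \in F0 -> (forall e, M <> shift_matching e) -> #|orb M| = p.
  by move=> FM nM; rewrite card_imset ?cardsT ?card_Fp //; apply: free.
(* A second orbit would be disjoint from that of [M0] and bring the number of matchings to 2p,
   beyond the available 2p - 1 - |E|. *)
have dich M : M \in F0 -> (forall e, M <> shift_matching e) -> M \in orb M0.
  move=> FM nM; apply: contraT => nO.
  have dis : [disjoint orb M0 & orb M].
    rewrite disjoints_subset; apply/subsetP=> _ /imsetP[k _ ->]; rewrite inE.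
    apply/imsetP=> -[l _ e]; case/imsetP: nO; exists (k - l) => //.
    by rewrite -relabel_shiftD e relabel_shiftD subrr relabel_shift0.
  have : (#|orb M0 :|: orb M| <= #|F0|)%N.
    by apply: subset_leq_card; rewrite subUset !orbF.
  rewrite cardsU (disjoint_setI0 dis) cards0 subn0 !card_orb // cardF.
  by move: E_gt0; have := prime_gt0 p_pr; lia.
have /fin_all_exists[w wM] : forall bi : bool * 'I_m,
    exists u, ledge bi.1 u (u + gap p bi.2) \in M0.
  move=> [b i] /=; have := inH b 0 i; rewrite -covF => /bigcupP[M FM Me].
  have /imsetP[k _ Mk] := dich M FM (not_shift _ _ _ _ Me).
  exists (0 - k); have := mem_relabel_ledge (- k) Me.
  by rewrite Mk relabel_shiftD subrr relabel_shift0 addrAC.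
(* Two edges of [M0] with the same layer and gap are translates of each other; that translation
   would map [M0] to itself, so it is trivial. *)
have uniq b i u : ledge b u (u + gap p i) \in M0 -> u = w (b, i).
  move=> M0u; have := mem_relabel_ledge (w (b, i) - u) M0u.
  rewrite addrAC [u + _]addrC subrK => Mu.
  have e := eqF _ _ _ (Fk _ _ FM0) FM0 Mu (wM (b, i)).
  apply/eqP; rewrite eq_sym -subr_eq0; apply/eqP; apply: free0.
  by rewrite e relabel_shift0.
(* There are only 2m = p - 1 layer edges in [M0], but p edges in all. *)
have [s [t M0st]] : exists s t, cedge s t \in M0.
  pose L := [set ledge bi.1 (w bi) (w bi + gap p bi.2) | bi in [set: bool * 'I_m]].
  have /subsetPn[e M0e' nL] : ~~ (M0 \subset L).
    apply/negP=> /subset_leq_card; rewrite cardM // leqNgt => /negP; apply.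
    apply: leq_ltn_trans (leq_imset_card _ _) _.
    by rewrite cardsT card_prod card_bool card_ord pE mul2n.
  have [[s [t eE]]|[c [u [i eE]]]] := edge_cases p_pr pE (F2 M0 FM0 e M0e').
    by exists s, t; rewrite -eE.
  case/imsetP: nL; exists (c, i); rewrite ?inE //= eE.
  by rewrite [u](uniq c i) // -eE.
pose a (b : bool) := if b then t else s.
pose w' b i := w (b, i).
have M0S x : starter_edge a w' x \in M0 by case: x => [[i b]|] //=; apply: (wM (b, i)).
have inj := starter_edges_listing_inj (partition_setT_trivIset (partF M0 FM0)) M0S.
have M0E : M0 = starter_matching a w'.
  apply/esym/eqP; rewrite eqEcard cardM //.
  rewrite (card_perfect p_pr (starter_matching_partition p_pr pE inj)); last first.
    by move=> _ /imsetP[x _ ->]; apply: card_starter_edge.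
  by rewrite leqnn andbT; apply/subsetP=> _ /imsetP[x _ ->].
pose P : starter_params p m := (t - s, ([ffun i => w (false, i) - s], [ffun i => w (true, i) - t])).
have aP b : a b = param_a P b + s by rewrite /param_a; case: b; rewrite /= ?subrK ?add0r.
have wP b i : w' b i = param_w P b i + s.
  rewrite /param_w addrAC -aP /param_x; case: b; rewrite /= ffunE.
    by rewrite addrC subrK.
  by rewrite addrC subrK.
have st_E : t - s \notin E by rewrite -cedge_H; apply: (subsetP (subF M0 FM0)).
have starterP b (x : {ffun 'I_m -> F}) : (forall i, x i = w' b i - a b) -> is_starter (@gap p m) x.
  move=> xE; apply/injectiveP=> y y' e; apply: (inj b).
  have lE z : layer_listing a w' b z = listing 0 x (fun i => x i + gap p i) z + a b.
    case: z => [[i c]|]; rewrite /layer_listing /= ?add0r // !xE.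
    by case: c; rewrite ?[_ + gap p i + _]addrAC subrK.
  by rewrite !lE e.
have vP : valid_params E P.
  apply/and3P; split=> //=.
    by apply: (starterP false) => i; rewrite ffunE.
  by apply: (starterP true) => i; rewrite ffunE.
exists P => //.
have oP := starter_factorizationP p_pr pE m_gt0 E_lt vP.
(* Both factorizations have 2p - 1 - |E| members, so one inclusion is enough. *)
apply/eqP; rewrite eqEcard cardF (card_starter_fixed oP) leqnn andbT.
apply/subsetP=> M FM; rewrite inE.
case: (boolP (M \in orb M0)) => [/imsetP[k _ ->]|nO].
  apply/orP; right; apply/imsetP; exists (s + k); rewrite ?inE // M0E.
  rewrite relabel_starter_matching; apply: eq_starter_matching => [b|b i].
    by rewrite /translate_cross aP addrA.
  by rewrite /translate_layers wP addrA.
have [e Me] : exists e, M = shift_matching e.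
  have /existsP[e /eqP ->] : [exists e : F, M == shift_matching e]; last by exists e.
  apply: contraNT nO => /existsPn nM; apply: dich FM _ => e eM.
  by have := nM e; rewrite eM eqxx.
apply/orP; left; apply/imsetP; exists e => //; rewrite !inE negb_or; apply/andP; split.
  apply: contraNneq nO => e_st; have -> : M = M0; last by apply/imsetP; exists 0; rewrite ?relabel_shift0.
  apply: (eqF _ _ _ FM FM0 _ M0st).
  by rewrite Me cedge_shift_matching e_st addrC subrK.
have : cedge 0 e \in H by apply: (subsetP (subF M FM)); rewrite Me cedge_shift_matching add0r.
by rewrite cedge_H subr0.
Qed.

End FixedFactorizations.

(** * Evaluation modulo p and the coloring indices *)

Section FactorizationSumModP.

Variables (p m : nat).
Hypothesis p_pr : prime p.
Hypothesis pE : p = m.*2.+1.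
Local Notation F := 'F_p.
Local Notation V := (vertex p).
Local Open Scope ring_scope.

Lemma intr_Fp_eq0 (x : int) : (x%:~R == 0 :> F) = (p%:Z %| x)%Z.
Proof.
rewrite dvdzE [in LHS](intEsign x) rmorphM rmorph_sign /= mulf_eq0 signr_eq0 /=.
by rewrite natF_eq0.
Qed.

Lemma eq_mod_Fp (x y : int) : x%:~R = y%:~R :> F -> (x = y %[mod p%:Z])%Z.
Proof.
by move=> e; apply/eqP; rewrite eqz_mod_dvd -intr_Fp_eq0 rmorphB /= e subrr.
Qed.

Variable E : {set F}.
Hypothesis E_gt0 : (0 < #|E|)%N.
Hypothesis E_lt : (#|E| < p)%N.
Local Notation H := (H_graph E).

Lemma sum_valid_params :
  \sum_(P : starter_params p m | valid_params E P)
    starter_sign (@gap p m) P.2.1 * starter_sign (@gap p m) P.2.2 =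
  (p - #|E|)%:R * (starter_sum (@gap p m)) ^+ 2.
Proof.
have -> : (p - #|E|)%N = #|~: E| by have := cardsC E; rewrite card_Fp // => /(canRL (addKn _)).
rewrite /starter_sum expr2 mulr_suml mulr_natl -sumr_const.
rewrite (eq_bigl (fun P : starter_params p m => (P.1 \in ~: E) &&
  (is_starter (@gap p m) P.2.1 && is_starter (@gap p m) P.2.2))) => [|P]; last by rewrite inE.
rewrite -(pair_big_dep (fun f => f \in ~: E) (fun _ (x : {ffun 'I_m -> F} * {ffun 'I_m -> F}) =>
   is_starter (@gap p m) x.1 && is_starter (@gap p m) x.2)
   (fun _ x => starter_sign (@gap p m) x.1 * starter_sign (@gap p m) x.2)) /=.
apply: eq_bigr => f _.
rewrite -(pair_big (fun x : {ffun 'I_m -> F} => is_starter (@gap p m) x)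
   (fun x : {ffun 'I_m -> F} => is_starter (@gap p m) x)
   (fun x y => starter_sign (@gap p m) x * starter_sign (@gap p m) y)) /=.
by apply: eq_bigr => x _; rewrite mulr_sumr.
Qed.

Lemma half_gt0 : (0 < m)%N.
Proof. by case: (m) pE p_pr => // ->. Qed.

Lemma factorization_sum_H :
  (factorization_sum (@vertex_lt p) H)%:~R = (-1) ^+ (m * #|E| + 1) * #|E|%:R :> F.
Proof.
have p_odd : odd p by rewrite pE /= odd_double.
rewrite (factorization_sum_fixed (vertex_pos_inj p_pr) (vertex_ltE p_pr)
  (@shift_inj p 1) (@H_card2 p E) _ p_pr p_odd (iter_shift_p p_pr 1)
  (card_starter_fixed p_pr E_lt)); last first.
  by move=> e; apply: (shift_H p_pr pE).
rewrite (eq_bigl (mem [set starter_factorization E P |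
  P : starter_params p m & valid_params E P])); last first.
  move=> F0; apply/andP/imsetP => [[oF /eqP fixF]|[P vP ->]].
    have [P vP ->] := fixed_factorization_starter p_pr pE half_gt0 E_gt0 E_lt oF fixF.
    by exists P; rewrite ?inE.
  move: vP; rewrite inE => vP; split.
    exact: (starter_factorizationP p_pr pE half_gt0 E_lt vP).
  by rewrite starter_factorization_fixed.
rewrite big_imset /=; last first.
  move=> P P'; rewrite !inE => vP vP'.
  by apply: (starter_factorization_inj p_pr pE half_gt0); rewrite inE.
rewrite (eq_bigl (valid_params E)) => [|P]; last by rewrite inE.
rewrite (eq_bigr (fun P : starter_params p m => (-1) ^+ (m * (p - 1 - #|E|)) *
  (starter_sign (@gap p m) P.2.1 * starter_sign (@gap p m) P.2.2))); last first.
  by move=> P vP; apply: (starter_factorization_sign p_pr pE half_gt0 vP).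
rewrite -mulr_sumr sum_valid_params !rmorphM /= rmorph_sign -expr2 starter_sum_gap_sqr //.
(* In F_p the number p - r of slopes is -r, the origin of the + 1 in the exponent; p - 1 - r = 2m -
   r has the parity of r. *)
rewrite mulr1 rmorph_nat natrB ?(ltnW E_lt) // pchar_Fp_0 // sub0r mulrN -mulNr.
congr (_ * _); rewrite exprD expr1 mulrN1; congr (- _).
have -> : (m * (p - 1 - #|E|))%N = (m * (m.*2 - #|E|))%N by rewrite {1}pE subn1.
have le_E : (#|E| <= m.*2)%N by rewrite -ltnS -pE.
rewrite -[LHS]mulr1 -[X in _ * X = _](sqrr_sign _ (m * #|E|)) expr2 mulrA -exprD -mulnDr subnK //.
by rewrite -mul2n mulnCA exprM sqrrN !expr1n mul1r.
Qed.

End FactorizationSumModP.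

Theorem corollary6p3 (p : nat) (p_prime : prime p) (p_odd : odd p)
    (E : {set 'F_p}) (E_card : 1 <= #|E| <= p - 1) :
  let m := (p - 1) %/ 2 in
  let r := #|E| in
  (factorization_sum (@vertex_lt p) (H_graph E)
     = ((-1) ^+ (m * r + 1) * r%:R)%R %[mod p%:Z])%Z /\
  is_edge_paintability_index (H_graph E) (2 * p - 1 - r) /\
  is_list_chromatic_index (H_graph E) (2 * p - 1 - r).
Proof.
move=> m r; have /andP[E_gt0 E_le] := E_card; have p_gt1 := prime_gt1 p_prime.
have pE : p = m.*2.+1.
  by rewrite /m subn1 divn2 -{1}(odd_double_half p) p_odd -{2}(odd_double_half p) p_odd /= doubleK.
have E_lt : #|E| < p by rewrite (leq_ltn_trans E_le) // subn1 prednK // ltnW.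
have sumE := factorization_sum_H p_prime pE E_gt0 E_lt.
split.
  by apply: (eq_mod_Fp p_prime); rewrite sumE rmorphM /= rmorph_sign rmorph_nat.
(* Since 0 < r < p, the residue of r is nonzero, so the congruence alone shows that the integer
   S(H_E) does not vanish. *)
have S0 : factorization_sum (@vertex_lt p) (H_graph E) != 0%R.
  apply/negP=> /eqP S0; move: sumE; rewrite S0 => /esym/eqP.
  by rewrite mulf_eq0 signr_eq0 /= (natF_eq0 p_prime) gtnNdvd.
have d_gt0 : 0 < 2 * p - 1 - #|E| by lia.
have cardHT : #|H_graph E| * 2 = #|vertex p| * (2 * p - 1 - #|E|).
  by rewrite (card_H p_prime) (card_vertex p_prime) -muln2 mulnAC.
have T_gt0 : 0 < #|vertex p| by rewrite (card_vertex p_prime) double_gt0 ltnW.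
apply: coloring_indices => //; first exact: H_card2.
rewrite -(prednK d_gt0).
apply: (edge_paintable_of_factorization_sum (vertex_pos_inj p_prime) (vertex_ltE p_prime)) S0 => //.
  exact: H_card2.
by rewrite prednK.
Qed.
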